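(* Let $X$, $\psi$, $\{a_j\}$, $\{m_j\}$, $\{b_{jk}\}$ and $\delta_{jk}$ be as in the context. For positive integers $M$ set $\overline\delta_j^{(2,M)}:=\frac1M\sum_{k=1}^{M}\delta_{jk}^2$, let $M_j:=\Big[\dfrac{m_j}{(a_{j+1}^{-2}-a_{j+2}^{-2})^2}\Big]$ (integer part), and \[ \Delta\overline\delta_{j+1}^{(2,M_j)}:=\frac{\overline\delta_{j+1}^{(2,M_j)}-\overline\delta_{j+2}^{(2,M_j)}}{a_{j+1}^{-2}-a_{j+2}^{-2}} . \] Assume: (i) there is $B\in(0,A)$ with $\mathrm{supp}\,\widehat\psi\subseteq\{\xi\in\mathbb R: B\le|\xi|\le A\}$; (ii) for all $j\in\mathbb N$ and $(k,l)\in\mathbb Z^2$, $b_{jk}-b_{jl}=\gamma_j(k-l)$ where $\{\gamma_j\}$ is a sequence of positive reals with $\lim_{j\to+\infty}a_j/\gamma_j=c\in(0,+\infty)$ and $\lim_{j\to+\infty}m_j^2a_j^8\big(\gamma_j/a_j-1/c\big)=0$; and for some $j_0\in\mathbb N$, $a_{j+1}/a_j\ge A/B>1$ for all $j\ge j_0$; (iii) $\lim_{j\to+\infty}m_ja_j^{-4}=0$. Then, as $j\to+\infty$, the random variables \[ \overline Z_j:=\sqrt{m_j}\Big(\Delta\overline\delta_{j+1}^{(2,M_j)}-2\alpha s_0^{-4\alpha-2}\int_{\mathbb R}\eta^2|\widehat\psi(\eta)|^2d\eta\Big) \] converge in distribution to a centred Gaussian random variable with variance $2\mathcal V_1$, where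 \[ \mathcal V_1:=4c\pi s_0^{-8\alpha}\int_{-c\pi}^{c\pi}\Big|\sum_{n\in\mathbb Z}|\widehat\psi(\eta+2nc\pi)|^2\Big|^2d\eta . \]
   Context: Standing setting. $X(t)$, $t\in\mathbb R$, is a measurable mean-square continuous real-valued stationary zero-mean Gaussian process whose spectral density is $f(\lambda)=h(\lambda)/|\lambda^2-s_0^2|^{2\alpha}$, where $s_0>1$, $\alpha\in(0,1/2)$, and $h$ is an even, non-negative, bounded, four times continuously differentiable function with $h^{(i)}(0)=0$ for $i=1,2,3,4$, $h(0)=1$, $h>0$ in some neighbourhood of $\pm s_0$, and $\int_{\mathbb R}h(\lambda)(1+|\lambda|)^{-\varepsilon}d\lambda<\infty$ for every $\varepsilon>0$. $\psi\in L_1(\mathbb R)$ is real-valued with Fourier transform $\widehat\psi(\lambda)=\int_{\mathbb R}e^{-i\lambda t}\psi(t)\,dt$ supported in $[-A,A]$ for some $A>0$ and of bounded variation on $[-A,A]$. $\{a_j\}$ is an unbounded strictly increasing sequence of positive reals, $\{m_j\}$ an unboundedly increasing sequence of positive integers, $\{b_{jk}\}_{(j,k)\in\mathbb N\times\mathbb Z}$ an array of reals. $\delta_{jk}:=a_j^{-1/2}\int_{\mathbb R}\psi\big((t-b_{jk})/a_j\big)X(t)\,dt$. *)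

(* Defs.v *)
From HB Require Import structures.
From mathcomp Require Import all_boot all_order all_algebra.
From mathcomp Require Import all_classical all_reals all_analysis.
Set Implicit Arguments. Unset Strict Implicit. Unset Printing Implicit Defensive.
Import Order.TTheory GRing.Theory Num.Theory.
Import numFieldNormedType.Exports.
Local Open Scope classical_set_scope.
Local Open Scope ring_scope.

Section defs.
Context {R : realType}.
Notation leb := (@lebesgue_measure R).

Definition FT_re (psi : R -> R) (l : R) : R :=
  Rintegral leb setT (fun t => cos (l * t) * psi t).
Definition FT_im (psi : R -> R) (l : R) : R :=
  - Rintegral leb setT (fun t => sin (l * t) * psi t).
Definition FT_abs2 (psi : R -> R) (l : R) : R :=
  FT_re psi l ^+ 2 + FT_im psi l ^+ 2.

Definition spec_dens (h : R -> R) (s0 alpha : R) (l : R) : R :=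
  h l / (`|l ^+ 2 - s0 ^+ 2| `^ (2 * alpha)).

(** covariance function r(tau) = \int e^{i l tau} f(l) dl (f even) *)
Definition cov_fun (f : R -> R) (tau : R) : R :=
  Rintegral leb setT (fun l => cos (l * tau) * f l).

Definition centred_gauss_law (v : R) : set R -> \bar R :=
  if v == 0 then (\d_(0:R) : set R -> \bar R) else normal_prob 0 (Num.sqrt v).

Definition has_law d (Omega : measurableType d) (P : probability Omega R)
    (Y : Omega -> R) (mu : set R -> \bar R) : Prop :=
  measurable_fun setT Y /\
  forall V : set R, measurable V -> P (Y @^-1` V) = mu V.

Definition centred_gaussian_process d (Omega : measurableType d)
    (P : probability Omega R) (X : R -> Omega -> R) (r : R -> R) : Prop :=
  forall (n : nat) (t c : 'I_n -> R),
    has_law P (fun w => \sum_(i < n) c i * X (t i) w)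
      (centred_gauss_law (\sum_(i < n) \sum_(k < n) c i * c k * r (t i - t k))).

Definition cvg_in_law d (Omega : measurableType d) (P : probability Omega R)
    (Z : nat -> Omega -> R) (mu : set R -> \bar R) : Prop :=
  forall g : R -> R, continuous g -> (exists K, forall x, `|g x| <= K) ->
    (\int[P]_w (g (Z j w))%:E)%E @[j --> \oo] --> (\int[mu]_x (g x)%:E)%E.

Definition C4 (h : R -> R) : Prop :=
  (forall k, (k < 4)%N -> forall x, derivable (derive1n k h) x 1) /\
  continuous (derive1n 4 h).

Definition delta (Omega : Type) (X : R -> Omega -> R) (psi : R -> R)
    (a : nat -> R) (b : nat -> int -> R) (j : nat) (k : int) (w : Omega) : R :=
  (Num.sqrt (a j))^-1 *
  Rintegral leb setT (fun t => psi ((t - b j k) / a j) * X t w).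

Definition delta_bar2 (Omega : Type) (X : R -> Omega -> R) (psi : R -> R)
    (a : nat -> R) (b : nat -> int -> R) (j M : nat) (w : Omega) : R :=
  (M%:R)^-1 * \sum_(1 <= k < M.+1) delta X psi a b j k%:Z w ^+ 2.

Definition Mj (a : nat -> R) (m : nat -> nat) (j : nat) : nat :=
  Num.truncn ((m j)%:R / (a j.+1 ^- 2 - a j.+2 ^- 2) ^+ 2).

Definition Delta_delta_bar (Omega : Type) (X : R -> Omega -> R) (psi : R -> R)
    (a : nat -> R) (b : nat -> int -> R) (m : nat -> nat) (j : nat) (w : Omega) : R :=
  (delta_bar2 X psi a b j.+1 (Mj a m j) w - delta_bar2 X psi a b j.+2 (Mj a m j) w)
  / (a j.+1 ^- 2 - a j.+2 ^- 2).

(** sum_{n in Z} |psi^(eta + 2 n c pi)|^2 *)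
Definition periodized (psi : R -> R) (c eta : R) : R :=
  limn (fun N => \sum_(0 <= n < N)
     (FT_abs2 psi (eta + 2 * n%:R * c * pi) + FT_abs2 psi (eta - 2 * n.+1%:R * c * pi))).
End defs.

(* Main.v *)
Require Import Defs.

From HB Require Import structures.
From mathcomp Require Import all_boot all_order all_algebra.
From mathcomp Require Import all_classical all_reals all_analysis.
From mathcomp Require Import measurable_realfun lebesgue_Rintegral.
From mathcomp Require Import ring lra.
Set Implicit Arguments. Unset Strict Implicit. Unset Printing Implicit Defensive.
Import Order.TTheory GRing.Theory Num.Theory.
Import numFieldNormedType.Exports.
Local Open Scope classical_set_scope.
Local Open Scope ring_scope.

(** Within one scale the wavelet coefficients form a Gaussian vector whose covariance is a
    Toeplitz matrix: [Cov (delta_jk, delta_jl)] is the [(k - l)]-th Fourier coefficient,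
    for the period [2 c pi], of a symbol converging uniformly to
    [s0^(-4 alpha) |psi^|^2].  Coefficients of the scales [j+1] and [j+2] are uncorrelated,
    as [a_(j+2) / a_(j+1) >= A / B] separates the spectral supports.  The variable [Z_j]
    is thus a centred quadratic form [Y^T A Y - tr (A S)] in a Gaussian vector of covariance
    [S], plus a bias that tends to 0 by the Taylor expansion of the spectral density at 0
    and assumption (iii).

    Gaussian integration by parts gives a recursion for the moments of such a form which
    involves only the traces of the powers of [A S].  Hence, if [2 tr ((A S)^2) --> v] and
    [tr ((A S)^k) --> 0] for [k >= 3], the moments converge to those of [N(0, v)], so do the
    characteristic functions by Taylor's formula, and Levy's theorem applies.

    The trace of [(A S)^2] is an average of the symbol against the Fejer kernel; its limit is
    found by a Korovkin argument, folding the symbol onto one period.  The higher traces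
    vanish because the spectrum of a Toeplitz matrix is bounded by the range of its symbol. *)

(** * Integrals of real functions *)

(** Fourier analysis is kept real: a free phase [t] in [cos (u * x + t)] carries cosine and sine at
    once, and differentiating adds [pi / 2] to it. Moments are used instead of a diagonalisation, so
    no spectral theorem intervenes; the trace of [A S] itself, on which there is no control, cancels
    by centring. The choice of [M_j] fixes the scaling. With [g_j = a_(j+1)^(-2) - a_(j+2)^(-2)] the
    form is [nu_j = sqrt m_j / (M_j g_j)] times a difference of two centred sums of [M_j] squares,
    and [nu_j^2 M_j --> 1]. Each scale adds the same limit to [tr ((A S)^2)], whence the factor 4 in
    the variance, while higher traces carry extra powers of [nu_j --> 0]. In the mean, the leading
    Taylor term is common to both scales and drops out, the quadratic one divided by [g_j] is the
    constant subtracted, and the remainder of order [a_j^(-4)] is divided by a gap of order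
    [a_(j+1)^(-2)], which needs the geometric growth of the scales. Fejer averages are estimated by
    testing the positive Fejer kernel on nonnegative kernels of finite rank, which reduces
    everything to sums of products of one-dimensional integrals. *)

Notation Int mu f := (Rintegral mu setT f).

Definition L1 d (T : measurableType d) (R : realType)
  (mu : set T -> \bar R) (f : T -> R) : Prop :=
  mu.-integrable setT (EFin \o f).

Section base.
Context d (T : measurableType d) (R : realType) (mu : {measure set T -> \bar R}).
Implicit Types f g : T -> R.

Lemma L1_meas f : L1 mu f -> measurable_fun setT f.
Proof. by move=> /measurable_int/measurable_EFinP. Qed.

Lemma L1_le g f : measurable_fun setT f -> (forall x, `|f x| <= g x) ->
  L1 mu g -> L1 mu f.
Proof.
move=> mf fg Lg; apply: (le_integrable measurableT) Lg; first exact/measurable_EFinP.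
by move=> x _ /=; rewrite lee_fin (le_trans (fg x))// ler_norm.
Qed.

Lemma L1D f g : L1 mu f -> L1 mu g -> L1 mu (fun x => f x + g x).
Proof. by move=> Lf Lg; exact: (integrableD measurableT Lf Lg). Qed.

Lemma L1B f g : L1 mu f -> L1 mu g -> L1 mu (fun x => f x - g x).
Proof. by move=> Lf Lg; exact: (integrableB measurableT Lf Lg). Qed.

Lemma L1Z k f : L1 mu f -> L1 mu (fun x => k * f x).
Proof. by move=> Lf; exact: (integrableZl measurableT k Lf). Qed.

Lemma L1_abs f : L1 mu f -> L1 mu (fun x => `|f x|).
Proof. by move=> Lf; exact: (integrable_norm Lf). Qed.

Lemma L1_0 : L1 mu (fun=> 0).
Proof. exact: integrable0. Qed.

Lemma L1_sum (I : Type) (s : seq I) (p : pred I) (F : I -> T -> R) :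
  (forall i, p i -> L1 mu (F i)) -> L1 mu (fun x => \sum_(i <- s | p i) F i x).
Proof.
move=> LF; elim: s => [|i s IH].
  by rewrite (_ : (fun x => _) = fun=> 0); [exact: L1_0|apply/funext => x; rewrite big_nil].
rewrite (_ : (fun x => _) = fun x => (if p i then F i x + \sum_(i <- s | p i) F i x
    else \sum_(i <- s | p i) F i x)); last by apply/funext => x; rewrite big_cons.
case: (boolP (p i)) => pi //; apply: L1D => //; exact: LF.
Qed.

Lemma L1_ge0P f : measurable_fun setT f -> (forall x, 0 <= f x) ->
  (\int[mu]_x (f x)%:E < +oo)%E -> L1 mu f.
Proof.
move=> mf f0 fi; apply/integrableP; split; first exact/measurable_EFinP.
by under eq_integral do rewrite /= ger0_norm//.
Qed.

Lemma L1Mb k f g : L1 mu f -> measurable_fun setT g -> (forall x, `|g x| <= k) ->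
  L1 mu (fun x => g x * f x).
Proof.
move=> Lf mg gk; apply: (@L1_le (fun x => k * `|f x|)).
- by apply: measurable_funM => //; exact: L1_meas.
- by move=> x; rewrite normrM ler_wpM2r.
- exact/L1Z/L1_abs.
Qed.

Lemma Int_EFin f : L1 mu f -> (Int mu f)%:E = (\int[mu]_x (f x)%:E)%E.
Proof. by move=> Lf; rewrite fineK//; exact: integrable_fin_num. Qed.

Lemma IntD f g : L1 mu f -> L1 mu g ->
  Int mu (fun x => f x + g x) = Int mu f + Int mu g.
Proof. by move=> Lf Lg; exact: RintegralD. Qed.

Lemma IntB f g : L1 mu f -> L1 mu g ->
  Int mu (fun x => f x - g x) = Int mu f - Int mu g.
Proof. by move=> Lf Lg; exact: RintegralB. Qed.

Lemma IntZ k f : L1 mu f -> Int mu (fun x => k * f x) = k * Int mu f.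
Proof. by move=> Lf; exact: RintegralZl. Qed.

Lemma IntZr k f : L1 mu f -> Int mu (fun x => f x * k) = Int mu f * k.
Proof. by move=> Lf; exact: RintegralZr. Qed.

Lemma IntN f : L1 mu f -> Int mu (fun x => - f x) = - Int mu f.
Proof.
move=> Lf; rewrite -mulN1r -IntZ//.
by congr (Rintegral _ _ _); apply/funext => x; rewrite mulN1r.
Qed.

Lemma Int0 : Int mu (fun=> 0) = 0.
Proof. by rewrite /Rintegral integral0. Qed.

Lemma Int_sum (I : Type) (s : seq I) (p : pred I) (F : I -> T -> R) :
  (forall i, p i -> L1 mu (F i)) ->
  Int mu (fun x => \sum_(i <- s | p i) F i x) = \sum_(i <- s | p i) Int mu (F i).
Proof.
move=> LF; elim: s => [|i s IH].
  by rewrite big_nil -[RHS]Int0; congr (Rintegral _ _ _); apply/funext => x; rewrite big_nil.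
rewrite (_ : (fun x => _) = fun x => (if p i then F i x + \sum_(i <- s | p i) F i x
    else \sum_(i <- s | p i) F i x)); last by apply/funext => x; rewrite big_cons.
rewrite big_cons; case: (boolP (p i)) => pi //; rewrite IntD ?IH//; first exact: LF.
exact: L1_sum.
Qed.

Lemma Int_le f g : L1 mu f -> L1 mu g -> (forall x, f x <= g x) ->
  Int mu f <= Int mu g.
Proof. by move=> Lf Lg fg; apply: le_Rintegral. Qed.

Lemma Int_ge0 f : (forall x, 0 <= f x) -> 0 <= Int mu f.
Proof. by move=> f0; apply: Rintegral_ge0. Qed.

Lemma Int_abs f : L1 mu f -> `|Int mu f| <= Int mu (fun x => `|f x|).
Proof. by move=> Lf; apply: le_normr_Rintegral. Qed.

Lemma Int_abs_le f g : measurable_fun setT f -> L1 mu g ->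
  (forall x, `|f x| <= g x) -> `|Int mu f| <= Int mu g.
Proof.
move=> mf Lg fg; have Lf := L1_le mf fg Lg.
by rewrite (le_trans (Int_abs Lf))// Int_le//; exact: L1_abs.
Qed.

Lemma eq_Int f g : f =1 g -> Int mu f = Int mu g.
Proof. by move=> /funext ->. Qed.

Lemma Int_cvg (F : nat -> T -> R) f g :
  (forall n, measurable_fun setT (F n)) -> L1 mu g ->
  (forall n x, `|F n x| <= g x) ->
  (forall x, F n x @[n --> \oo] --> f x) ->
  L1 mu f /\ Int mu (F n) @[n --> \oo] --> Int mu f.
Proof.
move=> mF Lg Fg Ff.
have mf : measurable_fun setT f.
  by apply: (@measurable_fun_cvg _ _ _ _ F) => // x _; exact: Ff.
have fg x : `|f x| <= g x.
  apply: (@closed_cvg _ _ \oo _ (fun n => `|F n x|) [set y | y <= g x]).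
  - exact: closed_le.
  - by apply: nearW => n; exact: Fg.
  - exact: cvg_norm.
have Lf := L1_le mf fg Lg; split=> //.
have [] := @dominated_convergence _ _ _ mu setT measurableT
  (fun n => EFin \o F n) (EFin \o f) (EFin \o g).
- by move=> n; apply/measurable_EFinP.
- exact/measurable_EFinP.
- apply: aeW => x _ /=; apply/cvg_EFin; last exact: Ff.
  by apply: nearW.
- exact: Lg.
- by apply: aeW => /= x n _; rewrite lee_fin.
move=> _ _ h; rewrite /Rintegral; apply: fine_cvg.
rewrite fineK; last exact: integrable_fin_num.
exact: h.
Qed.

Lemma eq_Int_ae f g : {ae mu, forall x, f x = g x} ->
  measurable_fun setT f -> measurable_fun setT g -> Int mu f = Int mu g.
Proof.
move=> fg mf mg; rewrite /Rintegral; congr fine; apply: ae_eq_integral => //.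
- exact/measurable_EFinP.
- exact/measurable_EFinP.
- by apply: filterS fg => x /= -> _.
Qed.

End base.

Section finite.
Context d (T : measurableType d) (R : realType) (P : probability T R).

Lemma L1_bdd k (f : T -> R) : measurable_fun setT f -> (forall x, `|f x| <= k) -> L1 P f.
Proof.
move=> mf fk; apply: (L1_le mf fk).
exact: finite_measure_integrable_cst.
Qed.

Lemma L1_cst k : L1 P (fun=> k).
Proof. exact: finite_measure_integrable_cst. Qed.

Lemma Int_cst k : Int P (fun=> k) = k.
Proof. by rewrite Rintegral_cst// (_ : _ setT = 1%E) ?mulr1//; exact: probability_setT. Qed.

End finite.

Section measurable_trig.
Context {R : realType}.

Lemma measurable_cosR : measurable_fun setT (@cos R).
Proof. by apply: continuous_measurable_fun; exact: continuous_cos. Qed.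

Lemma measurable_sinR : measurable_fun setT (@sin R).
Proof. by apply: continuous_measurable_fun; exact: continuous_sin. Qed.

Lemma measurable_normR : measurable_fun setT (@Num.norm R R).
Proof. by []. Qed.

End measurable_trig.

Ltac mfun_step := first
  [ assumption
  | match goal with
    | H : measurable_fun _ _ |- _ => exact: H
    | H : L1 _ _ |- _ => exact: (L1_meas H)
    | H : forall _, measurable_fun _ _ |- _ => exact: H
    | H : forall _ _, measurable_fun _ _ |- _ => exact: H
    | H : forall _, L1 _ _ |- _ => apply: (@L1_meas); exact: H
    end
  | exact: measurable_cst
  | exact: measurable_id
  | exact: measurable_gauss_fun
  | match goal with
    | |- measurable_fun _ (fun x => (_ + _)%R) => apply: measurable_funD
    | |- measurable_fun _ (fun x => (- _)%R) => apply: measurable_funN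
    | |- measurable_fun _ (fun x => (_ * _)%R) => apply: measurable_funM
    | |- measurable_fun _ (fun x => (_ ^+ _)%R) => apply: measurable_funX
    | |- measurable_fun _ (fun x => `|_|%R) => apply: (measurableT_comp measurable_normR)
    | |- measurable_fun _ (fun x => cos _) => apply: (measurableT_comp measurable_cosR)
    | |- measurable_fun _ (fun x => sin _) => apply: (measurableT_comp measurable_sinR)
    | |- measurable_fun _ (fun x => expR _) => apply: (measurableT_comp (@measurable_expR _))
    | |- measurable_fun _ (fun x => gauss_fun _) => apply: (measurableT_comp measurable_gauss_fun)
    | |- measurable_fun _ (fun x => \1__ _) => apply: measurable_indic
    | |- measurable_fun _ (fun x => (bigop _ _ _)) => apply: measurable_sum => ?
    end ].
Ltac mfun := repeat mfun_step.

Section fubini.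
Context d1 d2 (T1 : measurableType d1) (T2 : measurableType d2) (R : realType)
  (mu1 : {sigma_finite_measure set T1 -> \bar R})
  (mu2 : {sigma_finite_measure set T2 -> \bar R}).

(** Domination by a product bounds the Tonelli integral of [|F|] by that of [|g|] times that of
    [|h|]; below, [F] is a bounded trigonometric or Gaussian factor times an integrable function of
    one variable. *)
Lemma Int_fubini (F : T1 -> T2 -> R) (g : T1 -> R) (h : T2 -> R) :
  measurable_fun setT (fun p : T1 * T2 => F p.1 p.2) ->
  L1 mu1 g -> L1 mu2 h -> (forall x y, `|F x y| <= g x * h y) ->
  [/\ L1 mu1 (fun x => Int mu2 (F x)), L1 mu2 (fun y => Int mu1 (F ^~ y)) &
  Int mu1 (fun x => Int mu2 (F x)) = Int mu2 (fun y => Int mu1 (F ^~ y))].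
Proof.
move=> mF Lg Lh Fgh.
have mF1 x : measurable_fun setT (F x).
  exact: (measurableT_comp mF (measurable_pair1 x)).
have mF2 y : measurable_fun setT (F ^~ y).
  exact: (measurableT_comp mF (measurable_pair2 y)).
have L1F x : L1 mu2 (F x) by apply: (L1_le (mF1 x) (Fgh x)); exact: L1Z.
have L2F y : L1 mu1 (F ^~ y).
  apply: (L1_le (g := fun x => h y * g x) (mF2 y)); last exact: L1Z.
  by move=> x; rewrite mulrC.
have mFE : measurable_fun setT (fun p => (F p.1 p.2)%:E) by exact/measurable_EFinP.
have iF : (mu1 \x mu2)%E.-integrable setT (fun p => (F p.1 p.2)%:E).
  apply/(integrable12ltyP mu1 mu2 mFE) => /=.
  have -> : (fun x => \int[mu2]_y (`|F x y|%:E))%E =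
            EFin \o (fun x => Int mu2 (fun y => `|F x y|)).
    by apply/funext => x /=; rewrite Int_EFin//; exact: L1_abs.
  have L : L1 mu1 (fun x => Int mu2 (fun y => `|F x y|)).
    apply: (@L1_le _ _ _ _ (fun x => Int mu2 (fun y => `|h y|) * `|g x|)).
    - apply/measurable_EFinP; rewrite [X in measurable_fun _ X](_ : _ =
        fubini_F mu2 (fun p => (`|F p.1 p.2|)%:E)).
        apply: measurable_fun_fubini_tonelli_F.
        + by apply/measurable_EFinP; exact: measurableT_comp.
        + by move=> ?; rewrite lee_fin.
      by apply/funext => x /=; rewrite Int_EFin//; exact: L1_abs.
    - move=> x; rewrite ger0_norm; last exact: Int_ge0.
      rewrite mulrC -IntZ; last exact: L1_abs.
      apply: Int_le; [exact: L1_abs|exact/L1Z/L1_abs|move=> y].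
      by rewrite -normrM (le_trans (Fgh x y))// ler_norm.
    - exact/L1Z/L1_abs.
  by apply: integrable_lty; [exact: measurableT|exact: L].
have E1 : EFin \o (fun x => Int mu2 (F x)) = fubini_F mu2 (fun p => (F p.1 p.2)%:E).
  by apply/funext => x /=; rewrite Int_EFin.
have E2 : EFin \o (fun y => Int mu1 (F ^~ y)) = fubini_G mu1 (fun p => (F p.1 p.2)%:E).
  by apply/funext => x /=; rewrite Int_EFin.
split.
- by rewrite /L1 E1; exact: integrable_fubini_F.
- apply: (@L1_le _ _ _ _ (fun y => Int mu1 (fun x => `|g x|) * `|h y|)).
  + by apply/measurable_EFinP; rewrite E2; exact: (measurable_fubini_G iF).
  + move=> y; rewrite (le_trans (Int_abs (L2F y)))// mulrC -IntZ; last exact: L1_abs.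
    apply: Int_le; [exact: L1_abs|exact/L1Z/L1_abs|move=> x].
    by rewrite mulrC -normrM (le_trans (Fgh x y))// ler_norm.
  + exact/L1Z/L1_abs.
- rewrite /Rintegral; congr fine; rewrite -/(EFin \o _).
  have := Fubini iF => /=.
  under eq_integral => x _ do rewrite -Int_EFin//.
  by under [in RHS]eq_integral => x _ do rewrite -Int_EFin//.
Qed.

End fubini.

(** * Affine changes of variable *)

Section affine.
Context {R : realType}.
Notation leb := (@lebesgue_measure R).

(** By uniqueness of Lebesgue measure it suffices to compare half-open intervals; for negative [k]
    the preimage is closed on the other side, which does not affect its length. *)
Lemma lebesgue_affine (k b : R) (A : set R) : k != 0 -> measurable A ->
  (leb A = `|k|%:E * leb ((fun x => k * x + b)%R @^-1` A))%E.
Proof.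
move=> k0 mA.
pose phi : R -> measurableTypeR R := fun x => k * x + b.
have mphi : measurable_fun setT phi.
  by apply: measurable_funD => //; exact: measurable_funM.
pose nu : {measure set (measurableTypeR R) -> \bar R} :=
  measure_function_pushforward__canonical__measure_function_Measure leb mphi.
pose m := mscale (NngNum (normr_ge0 k)) nu.
have -> : (`|k|%:E * leb ((fun x => k * x + b)%R @^-1` A) = m A)%E by [].
apply: lebesgue_measure_unique => //= _ [[u v]] _ <-.
rewrite /m /mscale /= /pushforward /=.
have [kp|kn] := ltP 0 k.
  have -> : phi @^-1` `]u, v] = `](u - b) / k, (v - b) / k]%classic.
    apply/seteqP; split => x /=; rewrite !in_itv /= /phi;
    by rewrite ltr_pdivrMr// ler_pdivlMr// (mulrC x) ltrBlDr lerBrDr.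
  rewrite !lebesgue_measure_itv/= !lte_fin ltr_pM2r ?invr_gt0// ltrD2r.
  case: ifPn => uv; last by rewrite mule0.
  rewrite -!EFinD -EFinM gtr0_norm//; congr EFin; field; lra.
have {}kn : k < 0 by rewrite lt_neqAle k0.
have -> : phi @^-1` `]u, v] = `[(v - b) / k, (u - b) / k[%classic.
  apply/seteqP; split => x /=; rewrite !in_itv /= /phi;
  by rewrite ler_ndivrMr// ltr_ndivlMr// (mulrC x) ltrBlDr lerBrDr andbC.
rewrite !lebesgue_measure_itv/= !lte_fin ltr_nM2r ?invr_lt0// ltrD2r.
case: ifPn => uv; last by rewrite mule0.
by rewrite -!EFinD -EFinM ltr0_norm//; congr EFin; field; lra.
Qed.

Lemma Int_affine (k b : R) (f : R -> R) : k != 0 -> L1 leb f ->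
  L1 leb (fun x => f (k * x + b)) /\
  Int leb (fun x => f (k * x + b)) = `|k|^-1 * Int leb f.
Proof.
move=> k0 Lf.
pose phi : R -> measurableTypeR R := fun x => k * x + b.
have mphi : measurable_fun setT phi.
  by apply: measurable_funD => //; exact: measurable_funM.
(* For nonnegative functions the formula is a change of measure; it is then applied to the positive
   and negative parts of [f]. *)
have key (g : R -> \bar R) : measurable_fun setT g -> (forall x, 0 <= g x)%E ->
    (\int[leb]_x g x = `|k|%:E * \int[leb]_x g (k * x + b)%R)%E.
  move=> mg g0.
  have -> : (\int[leb]_x g (k * x + b)%R = \int[pushforward leb phi]_x g x)%E.
    rewrite ge0_integral_pushforward//=.
  pose nu : {measure set (measurableTypeR R) -> \bar R} :=
    measure_function_pushforward__canonical__measure_function_Measure leb mphi.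
  rewrite -(@ge0_integral_mscale _ _ _ nu setT measurableT (NngNum (normr_ge0 k)))//.
  apply: eq_measure_integral => //= A mA _.
  by rewrite /mscale/= /pushforward (@lebesgue_affine k b).
have kk : `|k| != 0 by rewrite normr_eq0.
have mf := L1_meas Lf.
have L : L1 leb (fun x => f (k * x + b)).
  apply/integrableP; split; first by apply/measurable_EFinP; exact: measurableT_comp mf mphi.
  have /integrableP[_] := Lf.
  rewrite key /=.
  - by rewrite muleC -lte_pdivlMr ?normr_gt0//= gt0_mulye ?ltry// lte_fin invr_gt0 normr_gt0.
  - by apply/measurable_EFinP; exact: measurableT_comp.
  - by move=> x; rewrite lee_fin.
split=> //.
apply: (mulfI kk); rewrite mulrA divff// mul1r.
apply: EFin_inj; rewrite EFinM !Int_EFin//.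
rewrite integralE [in RHS]integralE.
rewrite (key (fun x => (EFin \o f)^\+ x)%E)//; last exact/measurable_funepos/measurable_EFinP.
rewrite (key (fun x => (EFin \o f)^\- x)%E)//; last exact/measurable_funeneg/measurable_EFinP.
have I1 : (\int[leb]_x ((EFin \o f)^\+ (k * x + b)%R) \is a fin_num)%E.
  have := @integrable_pos_fin_num _ _ _ leb setT measurableT _ L.
  have -> : EFin \o (fun x => f (k * x + b)) = (EFin \o f) \o phi by [].
  by rewrite funepos_comp.
rewrite -muleBr//; last exact: fin_num_adde_defr.
rewrite -[X in integral leb setT X^\+%E]/((EFin \o f) \o phi) funepos_comp.
by rewrite -[X in integral leb setT X^\-%E]/((EFin \o f) \o phi) funeneg_comp.
Qed.

Lemma Int_opp (f : R -> R) : L1 leb f ->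
  L1 leb (fun x => f (- x)) /\ Int leb (fun x => f (- x)) = Int leb f.
Proof.
move=> Lf; have N1 : (-1 : R) != 0 by rewrite oppr_eq0 oner_eq0.
have [] := Int_affine 0 N1 Lf.
rewrite normrN1 invr1 mul1r (_ : (fun x => f (-1 * x + 0)) = fun x => f (- x))//.
by apply/funext => x; rewrite addr0 mulN1r.
Qed.

End affine.

(** * Quadratic remainders and the Taylor formula of the cosine *)

Section calculus.
Context {R : realType}.
Notation leb := (@lebesgue_measure R).
Implicit Types f g h : R -> R.

Lemma is_derive_quad f (x l K : R) :
  (forall s, `|f (x + s) - f x - s * l| <= K * s ^+ 2) -> is_derive x 1 f l.
Proof.
move=> fK.
have K0 : 0 <= K by have := fK 1; rewrite expr1n mulr1; exact: le_trans.
have H : h^-1 *: (f (h *: (1:R) + x) - f x) @[h --> 0^'] --> l.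
  apply/cvgrPdist_le => /= e e0; near=> s.
  have s0 : s != 0 by near: s; exact: nbhs_dnbhs_neq.
  rewrite /GRing.scale/= mulr1 (addrC s).
  have -> : l - s^-1 * (f (x + s) - f x) = - s^-1 * (f (x + s) - f x - s * l).
    by field.
  rewrite normrM normrN normfV ler_pdivrMl ?normr_gt0//.
  apply: (le_trans (fK s)); rewrite -real_normK ?num_real//.
  have : `|s| <= e / (K + 1).
    by near: s; apply: dnbhs0_le; apply: divr_gt0 => //; lra.
  rewrite ler_pdivlMr; last by lra.
  by have := normr_ge0 s; nra.
apply: DeriveDef; first by apply/cvg_ex; exists l.
exact/cvg_lim.
Unshelve. all: by end_near. Qed.

Lemma ge0_is_derive h (h' : R -> R) : (forall x : R, is_derive x 1 h (h' x)) ->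
  h 0 = 0 -> (forall x, 0 <= x -> 0 <= h' x) -> forall x, 0 <= x -> 0 <= h x.
Proof.
move=> dh h0 h'0 x x0.
have ch : {within `[0, x], continuous h}.
  apply: derivable_within_continuous => y _.
  by have := dh y => /@ex_derive.
have [c /andP[c0 cx]] := MVT_segment x0 (fun y _ => dh y) ch.
rewrite h0 !subr0 => ->; rewrite mulr_ge0// h'0//.
Qed.

Lemma is_derive_pow n (y : R) : is_derive y 1 (fun y : R => y ^+ n) (n%:R * y ^+ n.-1).
Proof.
have -> : (fun y : R => y ^+ n) = id ^+ n by apply/funext => z; rewrite exprfctE.
have H := is_deriveX n (is_derive_id y (1 : R)).
by apply: (is_derive_eq H); rewrite /GRing.scale/= mulr1.
Qed.

Lemma is_derive_shiftr (f : R -> R) (t y l : R) : is_derive (y + t) 1 f l ->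
  is_derive y 1 (fun y => f (y + t)) l.
Proof.
move=> df; have ds : is_derive y 1 (fun y : R => y + t) 1.
  have H := is_deriveD (is_derive_id y (1 : R)) (is_derive_cst t y (1 : R)).
  by apply: (is_derive_eq H); rewrite addr0.
have H : is_derive y 1 (f \o (fun y => y + t)) (l * 1) by exact: is_derive1_comp.
by rewrite mulr1 in H; exact: H.
Qed.

(** Writing every derivative of the cosine as a shifted cosine lets a single induction with [t]
    generalised suffice: the derivative of the remainder of order [n.+1] at phase [t] is the
    remainder of order [n] at phase [t + pi / 2]. *)
Lemma cos_taylor n (t x : R) :
  `|cos (x + t) - \sum_(k < n) x ^+ k / k`!%:R * cos (t + k%:R * (pi / 2))|
  <= `|x| ^+ n / n`!%:R.
Proof.
(* Changing the signs of [t] and [x] multiplies the [k]-th power and the [k]-th shifted cosine by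
   the same sign, so the sum is unchanged. *)
wlog x0 : t x / 0 <= x => [H|].
  have [x0|x0] := leP 0 x; first exact: H.
  have := H (- t) (- x); rewrite oppr_ge0 (ltW x0) normrN => /(_ isT).
  apply: le_trans; rewrite le_eqVlt; apply/orP; left; apply/eqP; congr `|_ - _|.
    by rewrite -opprD cosN.
  apply: eq_bigr => k _.
  have : cos (- t + k%:R * (pi / 2)) = (-1) ^+ k * cos (t + k%:R * (pi / 2)).
    elim: (nat_of_ord k) t => [|i IH] s; first by rewrite !mul0r !addr0 expr0 mul1r cosN.
    have E r : r + i.+1%:R * (pi / 2) = (r + i%:R * (pi / 2)) + pi / 2 :> R.
      by rewrite -natr1 mulrDl mul1r addrA.
    have S : sin (- s + i%:R * (pi / 2)) = (-1) ^+ i.+1 * sin (s + i%:R * (pi / 2)).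
      have := IH (s + pi / 2); rewrite opprD.
      rewrite (addrAC (- s)) cosBpihalf (addrAC s) cosDpihalf => ->.
      by rewrite exprS mulrN -mulrA mulN1r.
    by rewrite !E !cosDpihalf S mulrN.
  move=> ->; have S1 : (-1) ^+ k * (-1) ^+ k = 1 :> R.
    by rewrite -exprD -signr_odd oddD addbb.
  rewrite (exprNn x); set e := (-1) ^+ k in S1 *; set y := x ^+ k; set C := cos _.
  by apply/esym; rewrite mulrACA (mulrAC e y) S1 mul1r mulrA.
rewrite (ger0_norm x0).
elim: n t x x0 => [|n IH] t x x0.
  by rewrite big_ord0 subr0 expr0 fact0 divr1 cos_max.
pose Rm s y : R := cos (y + s) - \sum_(k < n) y ^+ k / k`!%:R * cos (s + k%:R * (pi / 2)).
pose G y : R := cos (y + t) - \sum_(k < n.+1) y ^+ k / k`!%:R * cos (t + k%:R * (pi / 2)).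
have G0 : G 0 = 0.
  rewrite /G big_ord_recl/= fact0 expr0 mul0r addr0 add0r big1 => [|k _].
    by rewrite addr0 invr1 !mul1r subrr.
  by rewrite expr0n/= !mul0r.
have dG (y : R) : is_derive y 1 G (Rm (t + pi / 2) y).
  have d1 : is_derive y 1 (fun y => cos (y + t)) (cos (y + (t + pi / 2))).
    by rewrite addrA cosDpihalf; exact: is_derive_shiftr.
  have d2 : is_derive y 1 (fun y => \sum_(k < n.+1) y ^+ k / k`!%:R * cos (t + k%:R * (pi / 2)))
     (\sum_(k < n) y ^+ k / k`!%:R * cos (t + pi / 2 + k%:R * (pi / 2))).
    have -> : (fun y => \sum_(k < n.+1) y ^+ k / k`!%:R * cos (t + k%:R * (pi / 2))) =
      \sum_(k < n.+1) (fun y => (k`!%:R^-1 * cos (t + k%:R * (pi / 2))) *: y ^+ k).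
      apply/funext => z; rewrite fct_sumE; apply: eq_bigr => k _.
      by rewrite -mulrA mulrC.
    have H := @is_derive_sum _ _ _ n.+1 _ y 1 _
      (fun k => is_deriveZ (k`!%:R^-1 * cos (t + k%:R * (pi / 2))) (is_derive_pow k y)).
    apply: (is_derive_eq H); rewrite big_ord_recl [X in X + _](_ : _ = 0); last first.
      by rewrite /GRing.scale/= !mul0r mulr0.
    rewrite add0r.
    apply: eq_bigr => k _.
    rewrite !lift0 factS natrM.
    have -> : t + pi / 2 + k%:R * (pi / 2) = t + k.+1%:R * (pi / 2) :> R by rewrite -natr1; ring.
    rewrite /GRing.scale/=.
    by field; rewrite pnatr_eq0 -lt0n fact_gt0 nat1r pnatr_eq0.
  exact: is_deriveB.
have dX (y : R) : is_derive y 1 (fun y : R => y ^+ n.+1 / n.+1`!%:R) (y ^+ n / n`!%:R).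
  have -> : (fun y : R => y ^+ n.+1 / n.+1`!%:R) = n.+1`!%:R^-1 *: (fun y => y ^+ n.+1).
    by apply/funext => z; rewrite mulrC.
  have H := is_deriveZ (n.+1`!%:R^-1 : R) (is_derive_pow n.+1 y).
  apply: (is_derive_eq H); rewrite /GRing.scale/= factS natrM; field.
  by rewrite pnatr_eq0 -lt0n fact_gt0 nat1r pnatr_eq0.
(* The bounding monomial plus or minus the remainder [G] vanishes at 0 and has a nonnegative
   derivative by the induction hypothesis. *)
rewrite ler_norml; apply/andP; split.
  rewrite -subr_ge0 opprK addrC.
  apply: (@ge0_is_derive (fun y => y ^+ n.+1 / n.+1`!%:R + G y) _
    (fun y => is_deriveD (dX y) (dG y)) _ _ x x0).
    by rewrite G0 expr0n/= mul0r addr0.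
  by move=> y y0; have := IH (t + pi / 2) y y0; rewrite ler_norml -/(Rm _ y); lra.
rewrite -subr_ge0.
apply: (@ge0_is_derive (fun y => y ^+ n.+1 / n.+1`!%:R - G y) _
    (fun y => is_deriveB (dX y) (dG y)) _ _ x x0).
  by rewrite G0 expr0n/= mul0r subr0.
by move=> y y0; have := IH (t + pi / 2) y y0; rewrite ler_norml -/(Rm _ y); lra.
Qed.

Lemma cos_taylor2 (t x : R) :
  `|cos (t + x) - cos t - x * cos (t + pi / 2)| <= x ^+ 2.
Proof.
have := cos_taylor 2 t x; rewrite big_ord_recr big_ord1.
have f0 : (nat_of_ord (@ord0 0))`! = 1%N by [].
have f1 : (nat_of_ord (@ord_max 1))`! = 1%N by [].
rewrite [X in `|_ - (X + _)|](_ : _ = cos t); last first.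
  by rewrite /= expr0 fact0 divr1 mul1r mul0r addr0.
rewrite [X in `|_ - (_ + X)|](_ : _ = x * cos (t + pi / 2)); last first.
  by rewrite f1 /= expr1 divr1 mul1r.
rewrite (addrC x) opprD addrA -normrX (ger0_norm (sqr_ge0 x)) => /le_trans; apply.
by rewrite (_ : 2`! = 2)%N//; have := sqr_ge0 x; lra.
Qed.

End calculus.

Import HBNNSimple.

(** * Characteristic functions *)

Section density.
Local Open Scope ereal_scope.
Context d (T : measurableType d) (R : realType)
  (mu nu : {measure set T -> \bar R}) (p : T -> R).
Hypotheses (mp : measurable_fun setT p) (p0 : forall x, (0 <= p x)%R)
  (nuE : forall A, measurable A -> nu A = \int[mu]_(x in A) (p x)%:E).

(** Stated for a measure known only through its values on measurable sets, which is how
    [normal_prob] is given. *)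
Lemma ge0_integral_density (f : T -> \bar R) : measurable_fun setT f ->
  (forall x, 0 <= f x) -> \int[nu]_x f x = \int[mu]_x (f x * (p x)%:E).
Proof.
move=> mf f0; pose h := nnsfun_approx measurableT mf.
have -> : \int[nu]_x f x = lim (\int[nu]_x (EFin \o h n) x @[n --> \oo]).
  have fE x : f x = lim ((EFin \o h n) x @[n --> \oo]).
    by apply/esym/cvg_lim => //; exact: cvg_nnsfun_approx.
  under eq_integral => x _ do rewrite fE //.
  apply: monotone_convergence => //.
  - by move=> n; exact/measurable_EFinP/measurable_funP.
  - by move=> n x Ex //=; rewrite lee_fin.
  - by move=> x Ex a b ab; rewrite lee_fin; exact/lefP/nd_nnsfun_approx.
have -> : \int[mu]_x (f x * (p x)%:E) =
    lim (\int[mu]_x ((EFin \o h n) x * (p x)%:E) @[n --> \oo]).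
  have fg x : f x * (p x)%:E = lim ((EFin \o h n) x * (p x)%:E @[n --> \oo]).
    by apply/esym/cvg_lim => //; apply: cvgeZr => //; exact: cvg_nnsfun_approx.
  under eq_integral => x _ do rewrite fg //.
  apply: monotone_convergence => [//| | |].
  - move=> n; apply/emeasurable_funM; first exact/measurable_EFinP.
    exact/measurable_EFinP.
  - by move=> n x Ex /=; rewrite mule_ge0 ?lee_fin.
  - by move=> x Ex a b ab/=; rewrite lee_wpmul2r ?lee_fin//; exact/lefP/nd_nnsfun_approx.
suff suf n : \int[mu]_x ((EFin \o h n) x * (p x)%:E) = \int[nu]_x (EFin \o h n) x.
  by congr (lim (_ @ \oo)); apply/funext => n; rewrite suf.
transitivity (\int[nu]_x
   (\sum_(y \in range (h n)) (y * \1_(h n @^-1` [set y]) x)%:E)); last first.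
  by apply: eq_integral => t tE; rewrite /= fimfunE -fsumEFin.
have indich m r : measurable_fun setT (fun x => (r * \1_(h m @^-1` [set r]) x)%:E).
  by apply: (measurable_comp measurableT) => //; exact: measurable_funM.
rewrite ge0_integral_fsum//; last by move=> m y Ey; exact: nnfun_muleindic_ge0.
transitivity (\int[mu]_x (\sum_(y \in range (h n))
    (y * \1_(h n @^-1` [set y]) x)%:E * (p x)%:E)).
  under [RHS]eq_integral => x xE.
    rewrite -ge0_mule_fsuml => [|y]; last exact: nnfun_muleindic_ge0.
    rewrite fsumEFin // -(fimfunE _ x); over.
  by [].
rewrite ge0_integral_fsum//; last 2 first.
  - by move=> y; apply: emeasurable_funM => //; exact/measurable_EFinP.
  - move=> m y Ey; apply: mule_ge0; last by rewrite lee_fin.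
    by rewrite EFinM; exact: nnfun_muleindic_ge0.
apply: eq_fsbigr => r rhn.
under [RHS]eq_integral do rewrite EFinM.
rewrite integralZl_indic_nnsfun => //.
under eq_integral do rewrite EFinM -muleA.
rewrite ge0_integralZl//.
- under eq_integral do rewrite muleC.
  rewrite (eq_integral ((EFin \o p) \_ (h n @^-1` [set r]))); last first.
    by move=> x xE; rewrite epatch_indic.
  by rewrite -integral_mkcond -nuE// integral_indic// setIT.
- apply: emeasurable_funM; first exact/measurable_EFinP.
  exact/measurable_EFinP.
- by move=> t Et; rewrite mule_ge0 ?lee_fin.
- by move: rhn; rewrite inE => -[t _ <-]; rewrite lee_fin.
Qed.

Lemma L1_density (g : T -> R) : measurable_fun setT g ->
  L1 mu (fun x => (g x * p x)%R) -> L1 nu g /\ Int nu g = Int mu (fun x => (g x * p x)%R).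
Proof.
move=> mg L; split.
  apply/integrableP; split; first exact/measurable_EFinP.
  rewrite ge0_integral_density//; last by apply/measurable_EFinP; exact: measurableT_comp.
  have /integrableP[_] := L; congr (_ < _); apply: eq_integral => x _ /=.
  by rewrite -EFinM normrM (ger0_norm (p0 x)).
rewrite /Rintegral; congr fine; rewrite integralE [RHS]integralE.
rewrite !ge0_integral_density//; last 2 first.
- exact/measurable_funeneg/measurable_EFinP.
- exact/measurable_funepos/measurable_EFinP.
congr (_ - _); apply: eq_integral => x _ /=.
  by rewrite !funeposE -!EFin_max -EFinM maxr_pMl ?mul0r.
by rewrite !funenegE -!EFinN -!EFin_max -EFinM maxr_pMl ?mul0r ?mulNr.
Qed.

End density.

Section normal.
Context {R : realType}.
Notation leb := (@lebesgue_measure R).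

(** The substitution of factor [s * Num.sqrt 2] carries the normal density to [gauss_fun] over
    [Num.sqrt pi], to which all Gaussian integrals are thus reduced. *)
Lemma normal_Int (s : R) (g : R -> R) : 0 < s -> measurable_fun setT g ->
  L1 leb (fun x => g (s * Num.sqrt 2 * x) * gauss_fun x) ->
  L1 (normal_prob 0 s) g /\
  Int (normal_prob 0 s) g =
    (Num.sqrt pi)^-1 * Int leb (fun x => g (s * Num.sqrt 2 * x) * gauss_fun x).
Proof.
move=> s0 mg L; set k := s * Num.sqrt 2.
have k0 : 0 < k by rewrite mulr_gt0// sqrtr_gt0.
have pE x : normal_pdf 0 s x = (Num.sqrt pi)^-1 * k^-1 * gauss_fun (k^-1 * x).
  rewrite normal_pdfE ?gt_eqF// /normal_peak /normal_fun /gauss_fun subr0.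
  congr (_ * expR _).
    rewrite -mulr_natr sqrtrM; last by rewrite mulr_ge0 ?sqr_ge0 ?pi_ge0.
    rewrite sqrtrM ?sqr_ge0// sqrtr_sqr (gtr0_norm s0) /k !invfM; ring.
  rewrite /k -mulr_natr exprMn exprVn exprMn sqr_sqrtr//; field; lra.
have L' : L1 leb (fun x => g x * normal_pdf 0 s x) /\
   Int leb (fun x => g x * normal_pdf 0 s x) =
   (Num.sqrt pi)^-1 * Int leb (fun x => g (k * x) * gauss_fun x).
  have ki0 : k^-1 != 0 by rewrite invr_eq0 gt_eqF.
  have [L2 I2] := Int_affine 0 ki0 L.
  have E : (fun x => g x * normal_pdf 0 s x) =
    (fun x => (Num.sqrt pi)^-1 * k^-1 * (g (k * (k^-1 * x + 0)) * gauss_fun (k^-1 * x + 0))).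
    by apply/funext => x; rewrite pE addr0 mulVKf ?gt_eqF//; ring.
  rewrite E; split; first exact: L1Z.
  rewrite (@IntZ _ _ R leb _ _ L2) I2 normfV invrK gtr0_norm// mulrA mulfVK// gt_eqF//.
case: L' => L1' <-.
by apply: (@L1_density _ _ R leb (normal_prob 0 s) (normal_pdf 0 s)
  (measurable_normal_pdf 0 s) (normal_pdf_ge0 0 s)).
Qed.

End normal.

(** * Gaussian integrals and the Gaussian characteristic function *)

Section gauss.
Context {R : realType}.
Notation leb := (@lebesgue_measure R).

Lemma L1_gauss_pow n : L1 leb (fun x : R => x ^+ n.*2 * gauss_fun x).
Proof.
have L0 : L1 leb (@gauss_fun R) by exact: integrableT_gauss.
have mx : measurable_fun setT (fun x : R => x ^+ n.*2 * gauss_fun x).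
  by apply: measurable_funM; [exact: measurable_funX|exact: measurable_gauss_fun].
have s2 : (Num.sqrt 2)^-1 != 0 :> R by rewrite invr_eq0 gt_eqF// sqrtr_gt0.
have [L2 _] := Int_affine 0 s2 L0.
apply: (@L1_le _ _ _ leb (fun x => (n`!%:R * 2 ^+ n) * gauss_fun ((Num.sqrt 2)^-1 * x + 0)) _ mx); last exact: L1Z.
move=> x; rewrite -mul2n exprM normrM normrX ger0_norm ?sqr_ge0//.
rewrite (ger0_norm (gauss_fun_ge0 x)).
have y0 : 0 <= x ^+ 2 / 2 by rewrite divr_ge0 ?sqr_ge0.
(* From the exponential series at [x ^+ 2 / 2]: half of the Gaussian exponent absorbs the power, the
   other half stays integrable. *)
have H : (x ^+ 2 / 2) ^+ n <= n`!%:R * expR (x ^+ 2 / 2).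
  case: n {mx} => [|n]; first by rewrite expr0 fact0 mul1r -[leLHS]expR0 ler_expR.
  have := expR_ge1Dxn n y0; rewrite -ler_pdivrMl ?ltr0n ?fact_gt0// mulrC; lra.
have -> : gauss_fun ((Num.sqrt 2)^-1 * x + 0) = expR (x ^+ 2 / 2) * gauss_fun x :> R.
  rewrite /gauss_fun -expRD addr0 exprMn exprVn sqr_sqrtr//; congr expR; by field.
rewrite [leRHS]mulrA ler_wpM2r ?gauss_fun_ge0//.
have -> : (x ^+ 2) ^+ n = (x ^+ 2 / 2) ^+ n * 2 ^+ n.
  by rewrite -exprMn mulfVK.
by rewrite [leRHS]mulrAC ler_wpM2r// exprn_ge0.
Qed.

Lemma Int_derive0 (F f : R -> R) : (forall x : R, is_derive x 1 F (f x)) ->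
  continuous f -> L1 leb f -> F n%:R @[n --> \oo] --> 0 -> F (- n%:R) @[n --> \oo] --> 0 ->
  Int leb f = 0.
Proof.
move=> dF cf Lf Fp Fm.
pose D n : set R := `[- n%:R, n%:R]%classic.
have mD n : measurable (D n) by exact: measurable_itv.
have [_ H] : L1 leb f /\ Int leb (fun x => \1_(D n) x * f x) @[n --> \oo] --> Int leb f.
  apply: (@Int_cvg _ _ _ leb (fun n x => \1_(D n) x * f x) f (fun x => `|f x|)).
  - move=> n; apply: measurable_funM; last exact: L1_meas Lf.
    exact: (@measurable_indic _ _ R setT (D n)).
  - exact: L1_abs.
  - move=> n x.
    by rewrite normrM indicE; case: (_ \in _); rewrite /= ?normr1 ?normr0 ?mul1r ?mul0r.
  move=> x; apply: cvg_near_cst; near=> n.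
  rewrite indicE mem_set ?mul1r//= /D /= in_itv/= -ler_norml.
  by near: n; exact: nbhs_infty_ger.
have E n : (0 < n)%N -> Int leb (fun x => \1_(D n) x * f x) = F n%:R - F (- n%:R).
  move=> n0; rewrite /Rintegral -[RHS]/(fine ((F n%:R)%:E - (F (- n%:R))%:E)); congr fine.
  rewrite -(@continuous_FTC2 _ f F).
  - rewrite [RHS]integral_mkcond; apply: eq_integral => x _ /=.
    by rewrite patchE indicE; case: ifPn => _ /=; rewrite ?mul1r ?mul0r.
  - have : 0 < n%:R :> R by rewrite ltr0n.
    lra.
  - exact: continuous_subspaceT.
  - have dd x : derivable F x 1 by have := dF x => /@ex_derive.
    have cF x : F y @[y --> x] --> F x.
      by apply: differentiable_continuous; exact/derivable1_diffP.
    split; first by move=> x _.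
    + exact/cvg_at_right_filter/cF.
    + exact/cvg_at_left_filter/cF.
  - by move=> x _; rewrite derive1E; have := dF x => /@derive_val.
apply: (cvg_unique _ H) => //.
have : F n%:R - F (- n%:R) @[n --> \oo] --> 0 - 0 by exact: cvgB.
rewrite subr0; apply: cvg_trans; apply: near_eq_cvg; near=> n.
by rewrite E//; near: n; exact: nbhs_infty_gt.
Unshelve. all: by end_near. Qed.

Lemma cvg_gauss_nat : gauss_fun (n%:R : R) @[n --> \oo] --> 0.
Proof.
by have /cvg_pinftyP := @cvg_gauss_fun R; apply; exact: cvgr_idn.
Qed.

(** The transform [phi] solves [phi' = - (v / 2) * phi], by an integration by parts ([xs]); hence
    [phi v * expR (v ^+ 2 / 4)] is constant, equal to [Num.sqrt pi]. The phase is added at the end,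
    the sine part being zero by oddness. *)
Lemma gauss_charfun (u t : R) :
  Int leb (fun x => cos (u * x + t) * gauss_fun x) =
  Num.sqrt pi * expR (- u ^+ 2 / 4) * cos t.
Proof.
have mG := @measurable_gauss_fun R.
have LG : L1 leb (@gauss_fun R) by exact: integrableT_gauss.
have mu_ (v : R) : measurable_fun setT (fun x : R => v * x) by exact: measurable_funM.
have mc v : measurable_fun setT (fun x : R => cos (v * x)).
  exact: (measurableT_comp measurable_cosR (mu_ v)).
have ms v : measurable_fun setT (fun x : R => sin (v * x)).
  exact: (measurableT_comp measurable_sinR (mu_ v)).
have Lc v : L1 leb (fun x => cos (v * x) * gauss_fun x).
  by apply: (@L1Mb _ _ R leb 1 _ (fun x => cos (v * x)) LG (mc v)) => x; exact: cos_max.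
have Ls v : L1 leb (fun x => sin (v * x) * gauss_fun x).
  by apply: (@L1Mb _ _ R leb 1 _ (fun x => sin (v * x)) LG (ms v)) => x; exact: sin_max.
have Lxs v : L1 leb (fun x => x * sin (v * x) * gauss_fun x).
  apply: (@L1_le _ _ _ leb (fun x => gauss_fun x + x ^+ 1.*2 * gauss_fun x)).
  - by mfun.
  - move=> x; rewrite !normrM (ger0_norm (gauss_fun_ge0 x)) -{2}[gauss_fun x]mul1r -mulrDl.
    rewrite ler_wpM2r ?gauss_fun_ge0//.
    have := sin_max (v * x); have := normr_ge0 x.
    have : x ^+ 1.*2 = `|x| ^+ 2 by rewrite real_normK ?num_real.
    move=> ->; nra.
  - exact/L1D/L1_gauss_pow.
have s0 : Int leb (fun x => sin (u * x) * gauss_fun x) = 0.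
  have [_] := Int_opp (Ls u).
  rewrite (_ : (fun x => _) = fun x => - (sin (u * x) * gauss_fun x)).
    by rewrite IntN// => /eqP; rewrite eq_sym -addr_eq0 -mulr2n mulrn_eq0/= => /eqP.
  by apply/funext => x; rewrite mulrN sinN mulNr /gauss_fun sqrrN.
pose phi v := Int leb (fun x => cos (v * x) * gauss_fun x).
have xs v : Int leb (fun x => x * sin (v * x) * gauss_fun x) = v / 2 * phi v.
  (* The derivative of [sin (v * x) * gauss_fun x], which vanishes at both infinities. *)
  pose f x := v * (cos (v * x) * gauss_fun x) - 2 * (x * sin (v * x) * gauss_fun x).
  have Lf : L1 leb f by apply: L1B; exact: L1Z.
  suff : Int leb f = 0.
    rewrite /f IntB ?IntZ; [|exact: Lxs|exact: Lc|exact: L1Z|exact: L1Z].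
    rewrite -/(phi v); move: (Int leb _) (phi v) => {}b {}c; clear.
    by move=> H; lra.
  have dl (x : R) : is_derive x 1 (fun x : R => v * x) v.
    have H := is_deriveZ v (is_derive_id x (1 : R)).
    by apply: (is_derive_eq H); rewrite /GRing.scale/= mulr1.
  have dsv (x : R) : is_derive x 1 (fun x => sin (v * x)) (cos (v * x) * v).
    exact: (is_derive1_comp (is_derive_sin (v * x)) (dl x)).
  have dg (x : R) : is_derive x 1 (@gauss_fun R) (gauss_fun x * (- (2 * x))).
    have H : is_derive x 1 (fun x : R => - x ^+ 2) (- (2 * x)).
      by have := is_deriveN (is_derive_pow 2 x); rewrite expr1.
    exact: (@is_derive1_comp _ expR (fun x => - x ^+ 2) x _ _ (is_derive_expR (- x ^+ 2)) H).
  have df (x : R) : is_derive x 1 (fun x => sin (v * x) * gauss_fun x) (f x).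
    have H := is_deriveM (dsv x) (dg x).
    by apply: (is_derive_eq H); rewrite /f /GRing.scale/=; ring.
  apply: (Int_derive0 df) => //.
  - have ccos x : {for x, continuous (fun x : R => cos (v * x))}.
      apply: (continuous_comp (g := cos)); last exact: continuous_cos.
      by apply: cvgM; [exact: cvg_cst|exact: cvg_id].
    have csin x : {for x, continuous (fun x : R => sin (v * x))}.
      apply: (continuous_comp (g := sin)); last exact: continuous_sin.
      by apply: cvgM; [exact: cvg_cst|exact: cvg_id].
    move=> x; apply: cvgB; apply: cvgM; try exact: cvg_cst; apply: cvgM; try exact: continuous_gauss_fun.
      exact: ccos.
    by apply: cvgM; [exact: cvg_id|exact: csin].
  - apply/norm_cvg0P; apply: (squeeze_cvgr _ (cvg_cst 0) cvg_gauss_nat).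
    near=> n; rewrite normr_ge0/= normrM (ger0_norm (gauss_fun_ge0 _)).
    by rewrite ler_piMl ?gauss_fun_ge0// sin_max.
  - apply/norm_cvg0P; apply: (squeeze_cvgr _ (cvg_cst 0) cvg_gauss_nat).
    near=> n; rewrite normr_ge0/= normrM (ger0_norm (gauss_fun_ge0 _)).
    by rewrite {1}/gauss_fun sqrrN -/(gauss_fun _) ler_piMl ?gauss_fun_ge0// sin_max.
have dphi (v : R) : is_derive v 1 phi (- (v / 2) * phi v).
  apply: (@is_derive_quad _ _ _ _ (Int leb (fun x => x ^+ 1.*2 * gauss_fun x))) => s.
  rewrite mulNr -xs mulrN opprK -IntZ// /phi -IntB// -IntD//; last exact: L1Z.
    rewrite mulrC -IntZ; last exact: L1_gauss_pow.
    apply: Int_abs_le.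
    + by mfun.
    + exact/L1Z/L1_gauss_pow.
    + move=> x.
      have := cos_taylor2 (v * x) (s * x).
      rewrite cosDpihalf -mulrDl => H.
      rewrite (_ : _ + _ = (cos ((v + s) * x) - cos (v * x) - s * x * - sin (v * x)) *
         gauss_fun x); last by ring.
      rewrite normrM (ger0_norm (gauss_fun_ge0 x)) mulrA ler_wpM2r ?gauss_fun_ge0//.
      by rewrite -exprMn.
  by apply: L1B.
have phi0 : phi 0 = Num.sqrt pi.
  transitivity (Int leb (@gauss_fun R)); last by rewrite /Rintegral integralT_gauss.
  by apply: eq_Int => x; rewrite mul0r cos0 mul1r.
have phiE : phi u = Num.sqrt pi * expR (- u ^+ 2 / 4).
  have dq (v : R) : is_derive v 1 (fun v : R => v ^+ 2 / 4) (v / 2).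
    have H := is_deriveZ (4^-1 : R) (is_derive_pow 2 v).
    have -> : (fun v : R => v ^+ 2 / 4) = 4^-1 *: (fun v => v ^+ 2).
      by apply/funext => z; rewrite mulrC.
    by apply: (is_derive_eq H); rewrite /GRing.scale/= expr1; field.
  have de (v : R) : is_derive v 1 (fun v => expR (v ^+ 2 / 4)) (expR (v ^+ 2 / 4) * (v / 2)).
    exact: (@is_derive1_comp _ expR (fun v => v ^+ 2 / 4) v _ _ (is_derive_expR (v ^+ 2 / 4)) (dq v)).
  have dd (v : R) : is_derive v 1 (fun v => phi v * expR (v ^+ 2 / 4)) 0.
    have H := is_deriveM (dphi v) (de v).
    by apply: (is_derive_eq H); rewrite /GRing.scale/=; ring.
  have := is_derive_0_is_cst u 0 dd.
  rewrite phi0 expr0n mul0r expR0 mulr1 => <-.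
  by rewrite -mulrA -expRD mulNr subrr expR0 mulr1.
rewrite -phiE /phi -[RHS]addr0 -[0 in RHS](mulr0 (- sin t)) -s0.
rewrite -(IntZr (cos t) (Lc u)) -(IntZ (- sin t) (Ls u)) -IntD; last 2 first.
  by have := L1Z (cos t) (Lc u); congr (L1 leb _); apply/funext => x; rewrite mulrC.
  exact: L1Z.
by apply: eq_Int => x; rewrite cosD; ring.
Unshelve. all: by end_near. Qed.

End gauss.

Section unif.
Context {R : realType}.

(** Uniform continuity in affine form: such a bound can be integrated against a kernel, the
    Lipschitz term becoming a first moment. The constant [K] depends on [e]. *)
Lemma unif_lip (g : R -> R) (L e : R) : continuous g ->
  (forall x, L < `|x| -> g x = 0) -> 0 < e ->
  exists2 K, 0 <= K & forall x y, `|g x - g y| <= e + K * `|x - y|.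
Proof.
move=> cg g0 e0.
pose Q (r : R) x := forall y, `|x - y| < r -> `|g x - g y| <= e.
have [r r0 Hr] : exists2 r, 0 < r & forall x y, `|x - y| < r -> `|g x - g y| <= e.
  have : compact `[- (L + 1), L + 1]%classic by exact: segment_compact.
  move=> /compact_near_coveringP /(_ R (0^'+) (fun r x => Q r x) _) H.
  have {H} : \forall r \near 0^'+, `[- (L + 1), L + 1]%classic `<=` Q r.
    apply: H => x _.
    have /cvgrPdist_lt/(_ _ (divr_gt0 e0 (ltr0n R 2))) := cg x.
    move=> /nbhs_ballP[d /= d0 H].
    exists (ball x (d / 2), [set r | r < d / 2]).
      split => /=; first by apply: nbhsx_ballx; rewrite divr_gt0.
      by apply: nbhs_right_lt; rewrite divr_gt0.
    move=> [x' r] /= [xx' rd] y x'y.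
    have h1 : `|g x - g x'| < e / 2.
      by apply: H => /=; rewrite /ball/=; move: xx'; rewrite /ball/=; lra.
    have h2 : `|g x - g y| < e / 2.
      apply: H => /=; rewrite /ball/=; move: xx'; rewrite /ball/= => xx'.
      by have := ler_distD x' x y; lra.
    rewrite (_ : g x' - g y = (g x - g y) - (g x - g x')); last by ring.
    by rewrite (le_trans (ler_normB _ _))//; lra.
  move=> H.
  have : \forall r \near 0^'+, r < 1 :> R by exact: nbhs_right_lt.
  have : \forall r \near 0^'+, 0 < r :> R by exact: nbhs_right_gt.
  move=> H0 H1; near (0:R)^'+ => r; exists r; first by near: r.
  have Hr : `[- (L + 1), L + 1]%classic `<=` Q r by near: r.
  have r1 : r < 1 by near: r.
  move=> x y xy.
  have [xL|xL] := leP `|x| (L + 1).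
    by apply: Hr => //=; rewrite in_itv/= -ler_norml.
  have yL : L < `|y| by have := ler_distD y x 0; rewrite !subr0; lra.
  by rewrite !g0 ?subrr ?normr0 ?(ltW e0)//; lra.
exists (2 * e / r).
  by rewrite divr_ge0// ?mulr_ge0// ltW.
(* The segment from [x] to [y] is cut into [n] equal pieces shorter than [r], each costing [e];
   below, [n] is at most [1 + |x - y| / (r / 2)], which gives the slope [2 * e / r]. *)
have key n x y : `|x - y| <= n%:R * (r / 2) -> `|g x - g y| <= n%:R * e.
  elim: n x y => [|n IH] x y.
    by rewrite !mul0r !normr_le0 !subr_eq0 => /eqP ->.
  pose z := x + (y - x) / n.+1%:R; rewrite -natr1 => H.
  have n0 : 0 < n%:R + 1 :> R by rewrite natr1 ltr0n.
  rewrite (_ : g x - g y = (g x - g z) + (g z - g y)); last by ring.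
  rewrite (le_trans (ler_normD _ _))// mulrDl mul1r addrC lerD//.
    apply: IH; rewrite (_ : z - y = n%:R / (n%:R + 1) * (x - y)); last first.
      by rewrite /z -natr1; field; lra.
    rewrite normrM ger0_norm ?divr_ge0 ?(ltW n0)// -mulrA ler_wpM2l//.
    by rewrite mulrC ler_pdivrMr// mulrC.
  apply: Hr; rewrite (_ : x - z = (x - y) / (n%:R + 1)); last first.
    by rewrite /z -natr1; field; lra.
  rewrite normrM normfV (gtr0_norm n0) ltr_pdivrMr// (le_lt_trans H)//.
  by rewrite mulrC ltr_pM2r//; lra.
move=> x y; pose n := (Num.truncn (`|x - y| / (r / 2))).+1.
have q0 : 0 <= `|x - y| / (r / 2) by rewrite divr_ge0// divr_ge0// ltW.
have /andP[n1 n2] := Num.Theory.truncn_itv q0.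
apply: le_trans (key n x y _) _.
  by rewrite -ler_pdivrMr ?divr_gt0// ltW.
have -> : n%:R = (Num.truncn (`|x - y| / (r / 2)))%:R + 1 :> R by rewrite natr1.
rewrite mulrDl mul1r [leLHS]addrC lerD2l.
rewrite -ler_pdivlMr//; apply: (le_trans n1); rewrite le_eqVlt; apply/orP; left; apply/eqP.
by field; lra.
Unshelve. all: by end_near. Qed.

End unif.

(** * Levy's continuity theorem by Gaussian smoothing *)

Section kernel.
Context d (T : measurableType d) (R : realType) (P : probability T R) (Z : T -> R).
Hypothesis mZ : measurable_fun setT Z.
Notation leb := (@lebesgue_measure R).

(** A Gaussian is a Gaussian mixture of cosines, so the expectation of a Gaussian kernel in [Z]
    depends on [Z] only through its characteristic function. *)
Lemma gauss_kernel_rep (s y : R) :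
  Int P (fun w => gauss_fun (s * (Z w - y))) =
  (Num.sqrt pi)^-1 * Int leb (fun u => Int P (fun w => cos (2 * s * u * Z w + - (2 * s * u * y))) * gauss_fun u).
Proof.
have sp : Num.sqrt pi != 0 :> R by rewrite gt_eqF// sqrtr_gt0 pi_gt0.
have LG : L1 leb (@gauss_fun R) by exact: integrableT_gauss.
have E w : gauss_fun (s * (Z w - y)) = (Num.sqrt pi)^-1 *
    Int leb (fun u => cos (2 * s * (Z w - y) * u + 0) * gauss_fun u).
  by rewrite gauss_charfun cos0 mulr1 mulKf// /gauss_fun; congr expR; field.
pose F (w : T) (u : R) := cos (2 * s * (Z w - y) * u + 0) * gauss_fun u.
have [L1a L1b FE] : [/\ L1 P (fun w => Int leb (F w)), L1 leb (fun u => Int P (F ^~ u)) &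
  Int P (fun w => Int leb (F w)) = Int leb (fun u => Int P (F ^~ u))].
  apply: (@Int_fubini _ _ _ _ _ P leb F (fun=> 1) (@gauss_fun R)) => //.
  - have m1 : measurable_fun setT (fun p : T * R => Z p.1) by exact: measurableT_comp mZ measurable_fst.
    have m2 : measurable_fun setT (fun p : T * R => p.2) by exact: measurable_snd.
    by rewrite /F; mfun.
  - exact: L1_cst.
  - move=> w u; rewrite /F normrM (ger0_norm (gauss_fun_ge0 u)) ler_wpM2r ?gauss_fun_ge0//.
    exact: cos_max.
rewrite (eq_Int _ E) IntZ// -/F FE; congr (_ * _); apply: eq_Int => u.
rewrite -IntZr; last first.
  by apply: (@L1_bdd _ _ _ _ 1) => [|w]; [mfun|exact: cos_max].
by apply: eq_Int => w; rewrite /F; congr (cos _ * _); ring.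
Qed.

(* The convolution of [g] with a Gaussian of width [1/s], left unnormalized:
   its total mass is [sqrt pi / s]. *)
Definition gauss_smooth (g : R -> R) (s x : R) :=
  Int leb (fun y => g y * gauss_fun (s * (x - y))).

Lemma gauss_smooth_E (g : R -> R) (s : R) : L1 leb g ->
  Int P (fun w => gauss_smooth g s (Z w)) =
  Int leb (fun y => g y * Int P (fun w => gauss_fun (s * (Z w - y)))) /\
  L1 P (fun w => gauss_smooth g s (Z w)).
Proof.
move=> Lg; pose F (w : T) (y : R) := g y * gauss_fun (s * (Z w - y)).
have [L1a L1b FE] : [/\ L1 P (fun w => Int leb (F w)), L1 leb (fun u => Int P (F ^~ u)) &
  Int P (fun w => Int leb (F w)) = Int leb (fun u => Int P (F ^~ u))].
  apply: (@Int_fubini _ _ _ _ _ P leb F (fun=> 1) (fun y => `|g y|)) => //.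
  - have m1 : measurable_fun setT (fun p : T * R => Z p.1) by exact: measurableT_comp mZ measurable_fst.
    have m2 : measurable_fun setT (fun p : T * R => p.2) by exact: measurable_snd.
    have m3 : measurable_fun setT (fun p : T * R => g p.2).
      exact: measurableT_comp (L1_meas Lg) m2.
    by rewrite /F; mfun.
  - exact: L1_cst.
  - exact: L1_abs.
  - move=> w y; rewrite /F normrM (ger0_norm (gauss_fun_ge0 _)) mul1r ler_piMr//.
    exact: gauss_fun_le1.
split=> //; rewrite FE; apply: eq_Int => y; rewrite IntZ//.
apply: (@L1_bdd _ _ _ _ 1) => [|w]; first by mfun.
by rewrite ger0_norm ?gauss_fun_ge0// gauss_fun_le1.
Qed.

End kernel.

Section levy.
Context {R : realType}.
Notation leb := (@lebesgue_measure R).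

Lemma L1_cont_supp (g : R -> R) L : continuous g -> (forall x, L < `|x| -> g x = 0) ->
  L1 leb g.
Proof.
move=> cg g0; have mg : measurable_fun setT g by exact: continuous_measurable_fun.
have [K K0 HK] := unif_lip cg g0 ltr01.
pose L' := `|L| + 1.
apply: (@L1_le _ _ R leb (fun x => (1 + K * (2 * L' + 1)) * \1_(`[- L', L']%classic) x)).
- by mfun.
- move=> x; have [xL|xL] := leP `|x| L'.
    rewrite indicE mem_set ?mulr1; last by rewrite /= in_itv/= -ler_norml.
    have := HK x (L' + 1); rewrite (g0 (L' + 1)) ?subr0; last first.
      by rewrite ger0_norm /L'; have := ler_norm L; have := normr_ge0 L; lra.
    move=> /le_trans; apply; rewrite lerD2l ler_wpM2l//.
    rewrite (le_trans (ler_normB _ _))// (ger0_norm (_ : 0 <= L' + 1)); first by lra.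
    by rewrite /L'; have := normr_ge0 L; lra.
  rewrite g0 ?normr0; last by rewrite /L' in xL; have := ler_norm L; lra.
  rewrite mulr_ge0// ?indicE// addr_ge0// mulr_ge0//.
  by rewrite /L'; have := normr_ge0 L; lra.
- by apply: L1Z; exact: integrable_indic_itv.
Qed.

(** The modulus [e + K * |x - y|] integrated against the normalised kernel gives [e] plus [K / s]
    times the first absolute moment of the Gaussian. *)
Lemma gauss_smooth_close (g : R -> R) L (e : R) : continuous g ->
  (forall x, L < `|x| -> g x = 0) -> 0 < e ->
  exists2 K, 0 <= K & forall s x, 0 < s ->
    `|s / Num.sqrt pi * gauss_smooth g s x - g x| <= e + K / s.
Proof.
move=> cg g0 e0; have [K K0 HK] := unif_lip cg g0 e0.
have sp : 0 < Num.sqrt pi :> R by rewrite sqrtr_gt0 pi_gt0.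
have LG : L1 leb (@gauss_fun R) by exact: integrableT_gauss.
have IG : Int leb (@gauss_fun R) = Num.sqrt pi by rewrite /Rintegral integralT_gauss.
have Lxg : L1 leb (fun x : R => `|x| * gauss_fun x).
  apply: (@L1_le _ _ _ leb (fun x => gauss_fun x + x ^+ 1.*2 * gauss_fun x)).
  - by mfun.
  - move=> x; rewrite normrM normr_id (ger0_norm (gauss_fun_ge0 x)) -{2}[gauss_fun x]mul1r -mulrDl.
    rewrite ler_wpM2r ?gauss_fun_ge0//.
    have -> : x ^+ 1.*2 = `|x| ^+ 2 by rewrite real_normK ?num_real.
    by have := normr_ge0 x; nra.
  - exact/L1D/L1_gauss_pow.
pose C := Int leb (fun x : R => `|x| * gauss_fun x).
have C0 : 0 <= C by apply: Int_ge0 => x; rewrite mulr_ge0// gauss_fun_ge0.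
have Lg := L1_cont_supp cg g0.
exists (K * C / Num.sqrt pi); first by rewrite divr_ge0 ?mulr_ge0// ltW.
move=> s x s0.
have mg : measurable_fun setT g by exact: continuous_measurable_fun.
have Lk : L1 leb (fun y => g y * gauss_fun (s * (x - y))).
  apply: (@L1_le _ _ _ leb (fun y => `|g y|)); [by mfun| |exact: L1_abs].
  move=> y; rewrite normrM (ger0_norm (gauss_fun_ge0 _)) ler_piMr//.
  exact: gauss_fun_le1.
have si0 : - s^-1 != 0 by rewrite oppr_eq0 invr_eq0 gt_eqF.
have [L2 I2] := Int_affine x si0 Lk.
have E : (fun z => g (- s^-1 * z + x) * gauss_fun (s * (x - (- s^-1 * z + x)))) =
   (fun z => g (x - z / s) * gauss_fun z).
  apply/funext => z; congr (g _ * gauss_fun _); [ring|field; lra].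
rewrite E normrN normfV invrK (gtr0_norm s0) in I2; rewrite E in L2.
have -> : s / Num.sqrt pi * gauss_smooth g s x - g x =
   (Num.sqrt pi)^-1 * Int leb (fun z => (g (x - z / s) - g x) * gauss_fun z).
  rewrite (_ : (fun z => (g (x - z / s) - g x) * gauss_fun z) =
    (fun z => g (x - z / s) * gauss_fun z - g x * gauss_fun z)); last first.
    by apply/funext => z; ring.
  rewrite IntB//; last exact: L1Z.
  by rewrite I2 IntZ// IG /gauss_smooth; field; lra.
rewrite normrM normfV (gtr0_norm sp) ler_pdivrMl//.
have -> : Num.sqrt pi * (e + K * C / Num.sqrt pi / s) =
   Int leb (fun z => e * gauss_fun z + K / s * (`|z| * gauss_fun z)).
  rewrite IntD; [|exact: L1Z|exact: L1Z].
  by rewrite !IntZ// IG -/C; field; lra.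
apply: Int_abs_le.
- mfun; first by apply: (measurableT_comp mg); mfun.
- by apply: L1D; exact: L1Z.
- move=> z; rewrite normrM (ger0_norm (gauss_fun_ge0 z)) mulrA -mulrDl ler_wpM2r ?gauss_fun_ge0//.
  apply: (le_trans (HK _ _)); rewrite lerD2l -!mulrA ler_wpM2l//.
  rewrite (_ : x - z / s - x = - (z / s)); last by ring.
  by rewrite normrN normrM normfV (gtr0_norm s0) mulrC.
Qed.

Lemma dist_le3 (x x' y y' d1 d2 d3 e : R) : `|x - x'| <= d1 -> `|y - y'| <= d2 ->
  `|x' - y'| <= d3 -> d1 + d2 + d3 <= e -> `|x - y| <= e.
Proof.
move=> h1 h2 h3; apply: le_trans.
have -> : x - y = (x - x') - (y - y') + (x' - y') by ring.
by rewrite (le_trans (ler_normD _ _))// lerD// (le_trans (ler_normB _ _))// lerD.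
Qed.

(** For [L >= 0], a trapezoid: 1 on [[-L, L]] and 0 outside [[-L - 1, L + 1]]. Absolute values
    instead of cases make its continuity immediate. *)
Definition clamp (L x : R) : R := (`|L + 1 - `|x| | - `|L - `|x| | + 1) / 2.

Lemma clamp_itv L x : 0 <= clamp L x <= 1.
Proof.
rewrite /clamp; set a := L + 1 - _; set b := L - _.
have ab : a + -1 = b by rewrite /a /b; ring.
have ba : b + 1 = a by rewrite -ab; ring.
have := ler_normD a (-1); rewrite normrN1 ab => h1.
have := ler_normD b 1; rewrite normr1 ba => h2.
by apply/andP; split; lra.
Qed.

Lemma clamp1 L x : `|x| <= L -> clamp L x = 1.
Proof.
move=> xL; rewrite /clamp (ger0_norm (_ : 0 <= L + 1 - `|x|)); last lra.
by rewrite (ger0_norm (_ : 0 <= L - `|x|)); lra.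
Qed.

Lemma clamp0 L x : L + 1 < `|x| -> clamp L x = 0.
Proof.
move=> xL; rewrite /clamp (ltr0_norm (_ : L + 1 - `|x| < 0)); last lra.
by rewrite (ltr0_norm (_ : L - `|x| < 0)); lra.
Qed.

Lemma continuous_clamp L : continuous (clamp L).
Proof.
move=> x; rewrite /clamp; apply: cvgM; last exact: cvg_cst.
have cn : `|y| @[y --> x] --> `|x| by apply: cvg_norm; exact: cvg_id.
apply: cvgD; last exact: cvg_cst.
by apply: cvgB; apply: cvg_norm; apply: cvgB => //; exact: cvg_cst.
Qed.

Context d (T : measurableType d) (P : probability T R) (Z : nat -> T -> R)
  (mu : probability (measurableTypeR R) R).
Hypothesis mZ : forall j, measurable_fun setT (Z j).
Hypothesis cfcvg : forall u t, Int P (fun w => cos (u * Z j w + t)) @[j --> \oo] -->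
  Int mu (fun x => cos (u * x + t)).

Let mid : measurable_fun setT (fun x : measurableTypeR R => x : R).
Proof. exact: measurable_id. Qed.

Lemma gauss_kernel_cvg s y : Int P (fun w => gauss_fun (s * (Z j w - y))) @[j --> \oo]
  --> Int mu (fun x => gauss_fun (s * (x - y))).
Proof.
have LG : L1 leb (@gauss_fun R) by exact: integrableT_gauss.
rewrite (gauss_kernel_rep mu mid).
under eq_fun => j do rewrite (gauss_kernel_rep P (mZ j)).
apply: cvgM; first exact: cvg_cst.
pose F j (u : R) := Int P (fun w => cos (2 * s * u * Z j w + - (2 * s * u * y))) * gauss_fun u.
have [] := @Int_cvg _ _ R leb F (fun u =>
  Int mu (fun w => cos (2 * s * u * w + - (2 * s * u * y))) * gauss_fun u) (@gauss_fun R) => //.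
- move=> j; rewrite /F.
  pose G (w : T) (u : R) := cos (2 * s * u * Z j w + - (2 * s * u * y)) * gauss_fun u.
  have [_ LL _] : [/\ L1 P (fun w => Int leb (G w)), L1 leb (fun u => Int P (G ^~ u)) &
    Int P (fun w => Int leb (G w)) = Int leb (fun u => Int P (G ^~ u))].
    apply: (@Int_fubini _ _ _ _ _ P leb G (fun=> 1) (@gauss_fun R)) => //.
    + have m1 : measurable_fun setT (fun p : T * R => Z j p.1).
        exact: measurableT_comp (mZ j) measurable_fst.
      have m2 : measurable_fun setT (fun p : T * R => p.2) by exact: measurable_snd.
      by rewrite /G; mfun.
    + exact: L1_cst.
    + move=> w u; rewrite /G normrM (ger0_norm (gauss_fun_ge0 u)) ler_wpM2r ?gauss_fun_ge0//.
      exact: cos_max.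
  have E : (fun u => Int P (G ^~ u)) = F j.
    apply/funext => u; rewrite /G IntZr//.
    by apply: (@L1_bdd _ _ _ _ 1) => [|w]; [mfun|exact: cos_max].
  by rewrite -/(F j) -E; exact: L1_meas LL.
- move=> j u; rewrite /F normrM (ger0_norm (gauss_fun_ge0 u)) ler_piMl ?gauss_fun_ge0//.
  rewrite -[leRHS](@Int_cst _ _ _ P 1); apply: Int_abs_le => [||w].
  + by mfun.
  + exact: L1_cst.
  + exact: cos_max.
- by move=> u; apply: cvgM; [exact: cfcvg|exact: cvg_cst].
Qed.

Lemma gauss_smooth_cvg (g : R -> R) s : L1 leb g ->
  Int P (fun w => gauss_smooth g s (Z j w)) @[j --> \oo] --> Int mu (gauss_smooth g s).
Proof.
move=> Lg; have [-> _] := gauss_smooth_E mu mid s Lg.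
under eq_fun => j do rewrite (gauss_smooth_E P (mZ j) s Lg).1.
have [] := @Int_cvg _ _ R leb (fun j y => g y * Int P (fun w => gauss_fun (s * (Z j w - y))))
   (fun y => g y * Int mu (fun w => gauss_fun (s * (w - y)))) (fun y => `|g y|) => //.
- move=> j.
  pose F (w : T) (y : R) := g y * gauss_fun (s * (Z j w - y)).
  have [_ LL _] : [/\ L1 P (fun w => Int leb (F w)), L1 leb (fun u => Int P (F ^~ u)) &
    Int P (fun w => Int leb (F w)) = Int leb (fun u => Int P (F ^~ u))].
    apply: (@Int_fubini _ _ _ _ _ P leb F (fun=> 1) (fun y => `|g y|)) => //.
    + have m1 : measurable_fun setT (fun p : T * R => Z j p.1).
        exact: measurableT_comp (mZ j) measurable_fst.
      have m2 : measurable_fun setT (fun p : T * R => p.2) by exact: measurable_snd.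
      have m3 : measurable_fun setT (fun p : T * R => g p.2).
        exact: measurableT_comp (L1_meas Lg) m2.
      by rewrite /F; mfun.
    + exact: L1_cst.
    + exact: L1_abs.
    + move=> w y; rewrite /F normrM (ger0_norm (gauss_fun_ge0 _)) mul1r ler_piMr//.
      exact: gauss_fun_le1.
  have E : (fun y => Int P (F ^~ y)) = fun y => g y * Int P (fun w => gauss_fun (s * (Z j w - y))).
    apply/funext => y; rewrite /F IntZ//.
    apply: (@L1_bdd _ _ _ _ 1) => [|w]; first by mfun.
    by rewrite ger0_norm ?gauss_fun_ge0// gauss_fun_le1.
  by rewrite -E; exact: L1_meas LL.
- exact: L1_abs.
- move=> j y; rewrite normrM ler_piMr//.
  rewrite -[leRHS](@Int_cst _ _ _ P 1); apply: Int_abs_le => [||w].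
  + by mfun.
  + exact: L1_cst.
  + by rewrite ger0_norm ?gauss_fun_ge0// gauss_fun_le1.
- by move=> y; apply: cvgM; [exact: cvg_cst|exact: gauss_kernel_cvg].
Qed.

(** Smoothing by a narrow Gaussian costs the same under every law, hence uniformly in [j], and the
    smoothed expectations converge. *)
Lemma cvg_cont_supp (g : R -> R) L : continuous g -> (forall x, L < `|x| -> g x = 0) ->
  Int P (fun w => g (Z j w)) @[j --> \oo] --> Int mu g.
Proof.
move=> cg g0; have Lg := L1_cont_supp cg g0.
have mg : measurable_fun setT g by exact: continuous_measurable_fun.
have sp : 0 < Num.sqrt pi :> R by rewrite sqrtr_gt0 pi_gt0.
have [C C0 gC] : exists2 C, 0 <= C & forall x, `|g x| <= C.
  have [K K0 HK] := gauss_smooth_close cg g0 ltr01.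
  exists (1 + K + (Num.sqrt pi)^-1 * Int leb (fun y => `|g y|)).
    rewrite addr_ge0 ?mulr_ge0 ?invr_ge0 ?(ltW sp) ?addr_ge0//.
    by apply: Int_ge0.
  move=> x; have := HK 1 x ltr01; rewrite !divr1 mul1r => H.
  have : `|(Num.sqrt pi)^-1 * gauss_smooth g 1 x| <= (Num.sqrt pi)^-1 * Int leb (fun y => `|g y|).
    rewrite normrM normfV (gtr0_norm sp) ler_wpM2l ?invr_ge0 ?(ltW sp)//.
    apply: Int_abs_le; [by mfun|exact: L1_abs|move=> y].
    rewrite normrM (ger0_norm (gauss_fun_ge0 _)) ler_piMr//; exact: gauss_fun_le1.
  by move: H; rewrite !ler_norml => /andP[? ?] /andP[? ?]; apply/andP; split; lra.
have cl d' (T' : measurableType d') (P' : probability T' R) (W : T' -> R) s e K :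
    measurable_fun setT W ->
    (forall x, `|s / Num.sqrt pi * gauss_smooth g s x - g x| <= e + K / s) ->
    `|s / Num.sqrt pi * Int P' (fun w => gauss_smooth g s (W w)) - Int P' (fun w => g (W w))| <= e + K / s.
  move=> mW H; have LS := (gauss_smooth_E P' mW s Lg).2.
  have Lw : L1 P' (fun w => g (W w)).
    by apply: (@L1_bdd _ _ _ _ C) => [|w //]; exact: (measurableT_comp mg mW).
  rewrite -IntZ// -IntB//; last exact: L1Z.
  rewrite -[leRHS](@Int_cst _ _ _ P' (e + K / s)); apply: Int_abs_le => [||w //].
    by apply: (@L1_meas _ _ _ P'); apply: L1B => //; exact: L1Z.
  exact: L1_cst.
apply/cvgrPdist_le => /= e e0.
have e4 : 0 < e / 4 by lra.
have [K K0 HK] := gauss_smooth_close cg g0 e4.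
(* Makes [K / s <= e / 8] even if [K] is 0; the total error is then [3 / 8 + 3 / 8 + 1 / 4] of
   [e]. *)
pose s := K / (e / 8) + 1.
have s0 : 0 < s by rewrite /s ltr_wpDl// divr_ge0//; lra.
have Ks : K / s <= e / 8.
  rewrite ler_pdivrMr// /s mulrDr mulrC divfK; last by lra.
  by lra.
have : s / Num.sqrt pi * Int P (fun w => gauss_smooth g s (Z j w)) @[j --> \oo] -->
    s / Num.sqrt pi * Int mu (gauss_smooth g s).
  by apply: cvgM; [exact: cvg_cst|exact: gauss_smooth_cvg].
move=> /cvgrPdist_le/(_ _ e4).
apply: filterS => j.
have hP := cl _ _ P (Z j) s _ K (mZ j) (fun x => HK s x s0).
have hmu := cl _ _ mu _ s _ K mid (fun x => HK s x s0).
rewrite distrC in hP; rewrite distrC in hmu.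
move=> hc; apply: (dist_le3 hmu hP hc).
by rewrite [leRHS](_ : e = e / 4 + e / 8 + (e / 4 + e / 8) + e / 4); [rewrite !lerD|field].
Qed.

(** Tightness comes for free: the cut-off [chi] has mass close to 1 under [mu], hence also under the
    law of [Z j] for large [j], because [chi] is itself a test function of compact support. Cutting
    off [g] loses at most [C] times the missing mass. *)
Theorem levy (g : R -> R) C : continuous g -> (forall x, `|g x| <= C) ->
  Int P (fun w => g (Z j w)) @[j --> \oo] --> Int mu g.
Proof.
move=> cg gC; have mg : measurable_fun setT g by exact: continuous_measurable_fun.
have C0 : 0 <= C by exact: le_trans (gC 0).
have mcl L : measurable_fun setT (clamp L).
  exact: continuous_measurable_fun (@continuous_clamp L).
have [_ cl1] : L1 mu (fun=> 1) /\ Int mu (clamp n%:R) @[n --> \oo] --> Int mu (fun=> 1).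
  apply: (@Int_cvg _ _ R mu (fun n => clamp n%:R) (fun=> 1) (fun=> 1)) => [n||n x|x].
  - exact: mcl.
  - exact: L1_cst.
  - by have /andP[? ?] := clamp_itv n%:R x; rewrite ger0_norm.
  - apply: cvg_near_cst; near=> n; apply: clamp1.
    by near: n; exact: nbhs_infty_ger.
rewrite Int_cst in cl1.
apply/cvgrPdist_le => /= e e0.
have C1 : 0 < C + 1 by lra.
(* The denominator contains [C + 1] because [C] may be 0. *)
have e4 : 0 < e / (8 * (C + 1)) by rewrite divr_gt0// mulr_gt0.
have e8 : 0 < e / 8 by lra.
have [N HN] : exists N : nat, `|1 - Int mu (clamp N%:R)| <= e / (8 * (C + 1)).
  by have /cvgrPdist_le/(_ _ e4)[N _ H] := cl1; exists N; exact: (H N (leqnn N)).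
pose chi := clamp N%:R.
have chi0 x : N%:R + 1 < `|x| -> chi x = 0 by exact: clamp0.
have cc : continuous chi by exact: continuous_clamp.
have cgc : continuous (fun x => g x * chi x).
  by move=> x; apply: cvgM; [exact: cg|exact: cc].
have gc0 x : N%:R + 1 < `|x| -> g x * chi x = 0 by move=> /chi0 ->; rewrite mulr0.
have key d' (T' : measurableType d') (P' : probability T' R) (W : T' -> R) :
    measurable_fun setT W ->
  `|Int P' (fun w => g (W w)) - Int P' (fun w => g (W w) * chi (W w))| <=
    C * (1 - Int P' (fun w => chi (W w))).
  move=> mW; have mgW := measurableT_comp mg mW; have mcW := measurableT_comp (mcl N%:R) mW.
  have Lg : L1 P' (fun w => g (W w)) by apply: (@L1_bdd _ _ _ _ C) => [|w]; [exact: mgW|exact: gC].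
  have Lc : L1 P' (fun w => chi (W w)).
    apply: (@L1_bdd _ _ _ _ 1) => // w.
    by have /andP[? ?] := clamp_itv N%:R (W w); rewrite /chi ger0_norm.
  have Lgc : L1 P' (fun w => g (W w) * chi (W w)).
    by apply: (@L1Mb _ _ _ P' C (fun w => chi (W w)) (fun w => g (W w))).
  rewrite -IntB// -[1](@Int_cst _ _ _ P' 1) -IntB//; last exact: L1_cst.
  rewrite -IntZ; last by apply: L1B => //; exact: L1_cst.
  apply: Int_abs_le => [||w].
  - by apply: (@L1_meas _ _ _ P'); exact: L1B.
  - by apply: L1Z; apply: L1B => //; exact: L1_cst.
  - rewrite -{1}[g (W w)]mulr1 -mulrBr normrM.
    have /andP[? ?] := clamp_itv N%:R (W w).
    by rewrite (ger0_norm (_ : 0 <= 1 - chi (W w))) ?subr_ge0// ler_wpM2r ?subr_ge0.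
have Cb x : x <= e / (8 * (C + 1)) -> C * x <= e / 8.
  move=> H; apply: (@le_trans _ _ (C * (e / (8 * (C + 1))))); first exact: ler_wpM2l.
  rewrite -subr_ge0 (_ : _ - _ = e / (8 * (C + 1))); last by field; lra.
  exact: ltW.
have H1 := cvg_cont_supp cgc gc0.
have H2 := cvg_cont_supp cc chi0.
move/cvgrPdist_le : H1 => /(_ _ e8) H1.
move/cvgrPdist_le : H2 => /(_ _ e4) H2.
near=> j.
have h1 : `|Int mu (fun x => g x * chi x) - Int P (fun w => g (Z j w) * chi (Z j w))| <= e / 8.
  by near: j.
have h2 : `|Int mu chi - Int P (fun w => chi (Z j w))| <= e / (8 * (C + 1)) by near: j.
have := key _ _ P (Z j) (mZ j); have := key _ _ mu _ mid.
have k1 : C * (1 - Int mu chi) <= e / 8.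
  by apply: Cb; move: HN; rewrite ler_norml => /andP[].
have k2 : C * (Int mu chi - Int P (fun w => chi (Z j w))) <= e / 8.
  by apply: Cb; move: h2; rewrite ler_norml => /andP[].
move: k1 k2 h1; rewrite !ler_norml => k1 k2 /andP[? ?] /andP[? ?] /andP[? ?].
apply/andP; split; lra.
Unshelve. all: by end_near. Qed.

End levy.

(** * Quadratic forms of Gaussian vectors *)

Section derive_fun.
Context {R : realType}.
Implicit Types f g : R -> R.

Lemma is_derive_addf f g (x a b : R) : is_derive x 1 f a -> is_derive x 1 g b ->
  is_derive x 1 (fun s => f s + g s) (a + b).
Proof. by move=> df dg; exact: is_deriveD. Qed.

Lemma is_derive_mulf f g (x a b : R) : is_derive x 1 f a -> is_derive x 1 g b ->
  is_derive x 1 (fun s => f s * g s) (f x * b + g x * a).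
Proof. by move=> df dg; exact: is_deriveM. Qed.

Lemma is_derive_scalef k f (x a : R) : is_derive x 1 f a ->
  is_derive x 1 (fun s => k * f s) (k * a).
Proof. by move=> df; exact: is_deriveZ. Qed.

Lemma is_derive_sumf n (F : 'I_n -> R -> R) (x : R) (l : 'I_n -> R) :
  (forall i, is_derive x 1 (F i) (l i)) ->
  is_derive x 1 (fun s => \sum_i F i s) (\sum_i l i).
Proof.
move=> dF; rewrite (_ : (fun s => _) = \sum_i F i); first exact: is_derive_sum.
by apply/funext => s; rewrite fct_sumE.
Qed.

Lemma is_derive_affine (c k x : R) : is_derive x 1 (fun s => c + s * k) k.
Proof.
have H := is_derive_addf (is_derive_cst c x 1)
  (is_derive_mulf (is_derive_id x (1 : R)) (is_derive_cst k x 1)).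
by apply: (is_derive_eq H); rewrite /= mulr0 mulr1 !add0r.
Qed.

Lemma is_derive_uniq f (x a b : R) : is_derive x 1 f a -> is_derive x 1 f b -> a = b.
Proof. by move=> /@derive_val <- /@derive_val <-. Qed.

End derive_fun.

Section gauss_vec.
Context d (T : measurableType d) (R : realType) (P : probability T R).
Implicit Types F G H W U : T -> R.

(** Unlike [L1], finiteness of all absolute moments is stable under products, so every polynomial in
    Gaussian coordinates stays in this class. *)
Definition Lall F := measurable_fun setT F /\ forall n, L1 P (fun w => `|F w| ^+ n).

Lemma Lall_meas F : Lall F -> measurable_fun setT F. Proof. by case. Qed.

Lemma Lall_L1 F : Lall F -> L1 P F.
Proof.
move=> [mF LF]; apply: (L1_le mF _ (LF 1%N)) => x; by rewrite expr1.
Qed.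

Lemma Lall_bdd k F : measurable_fun setT F -> (forall w, `|F w| <= k) -> Lall F.
Proof.
move=> mF Fk; split=> // n; apply: (@L1_bdd _ _ _ _ (k ^+ n)); first by mfun.
move=> w; rewrite ger0_norm ?exprn_ge0//; apply: lerXn2r => //.
by rewrite nnegrE (le_trans _ (Fk w)).
Qed.

Lemma Lall_cst k : Lall (fun=> k).
Proof. exact: (@Lall_bdd `|k|). Qed.

Lemma LallD F G : Lall F -> Lall G -> Lall (fun w => F w + G w).
Proof.
move=> [mF LF] [mG LG]; split; first by mfun.
move=> n; apply: (@L1_le _ _ _ _ (fun w => 2 ^+ n * (`|F w| ^+ n + `|G w| ^+ n))).
- by mfun.
- move=> w; rewrite ger0_norm ?exprn_ge0//.
  have : `|F w + G w| <= 2 * Num.max `|F w| `|G w|.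
    rewrite (le_trans (ler_normD _ _))// mulr_natl mulr2n lerD// le_max lexx ?orbT//.
  move=> /(lerXn2r n) /=; rewrite !nnegrE normr_ge0 mulr_ge0 ?le_max ?normr_ge0// => /(_ isT isT).
  move=> /le_trans; apply; rewrite exprMn ler_wpM2l ?exprn_ge0//.
  by case: (leP `|F w| `|G w|) => _; rewrite ?lerDl ?lerDr ?exprn_ge0.
- exact/L1Z/L1D.
Qed.

Lemma LallM F G : Lall F -> Lall G -> Lall (fun w => F w * G w).
Proof.
move=> [mF LF] [mG LG]; split; first by mfun.
move=> n; apply: (@L1_le _ _ _ _ (fun w => `|F w| ^+ (n + n) + `|G w| ^+ (n + n))).
- by mfun.
- move=> w; rewrite ger0_norm ?exprn_ge0// normrM exprMn !exprD.
  have := sqr_ge0 (`|F w| ^+ n - `|G w| ^+ n).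
  have : 0 <= `|F w| ^+ n by rewrite exprn_ge0.
  have : 0 <= `|G w| ^+ n by rewrite exprn_ge0.
  by move: (`|F w| ^+ n) (`|G w| ^+ n) => x y; rewrite expr2; clear; nra.
- exact: L1D.
Qed.

Lemma LallZ k F : Lall F -> Lall (fun w => k * F w).
Proof. by move=> LF; apply: LallM => //; exact: Lall_cst. Qed.

Lemma Lall_sum (I : Type) (s : seq I) (F : I -> T -> R) :
  (forall i, Lall (F i)) -> Lall (fun w => \sum_(i <- s) F i w).
Proof.
move=> LF; elim: s => [|i s IH].
  rewrite (_ : (fun w => _) = fun=> 0); first exact: Lall_cst.
  by apply/funext => w; rewrite big_nil.
rewrite (_ : (fun w => _) = fun w => F i w + \sum_(i <- s) F i w); first exact: LallD.
by apply/funext => w; rewrite big_cons.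
Qed.

Lemma LallX n F : Lall F -> Lall (fun w => F w ^+ n).
Proof.
move=> LF; elim: n => [|n IH]; first exact: (Lall_cst 1).
by rewrite (_ : (fun w => _) = fun w => F w * F w ^+ n);
  [exact: LallM|apply/funext => w; rewrite exprS].
Qed.

Lemma Lall_cos U (t : R) : measurable_fun setT U -> Lall (fun w => cos (U w + t)).
Proof. by move=> mU; apply: (@Lall_bdd 1) => [|w]; [mfun|exact: cos_max]. Qed.

(** The second-order remainder is at most [|H| * W ^+ 2 * s ^+ 2], integrable since [H] and [W] have
    all moments. *)
Lemma is_derive_Ecos H W U (t : R) : Lall H -> Lall W -> measurable_fun setT U ->
  is_derive (0 : R) 1 (fun s => Int P (fun w => H w * cos (U w + s * W w + t)))
    (Int P (fun w => H w * W w * cos (U w + (t + pi / 2)))).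
Proof.
move=> LH LW mU; have [mH _] := LH; have [mW _] := LW.
have LHW : Lall (fun w => `|H w| * W w ^+ 2).
  apply: LallM; last exact: LallX.
  split; first by mfun.
  by move=> n; under eq_fun do rewrite normr_id; exact: LH.2.
apply: (@is_derive_quad _ _ _ _ (Int P (fun w => `|H w| * W w ^+ 2))) => s.
have L1a s' : L1 P (fun w => H w * cos (U w + s' * W w + t)).
  by apply: Lall_L1; apply: LallM => //; apply: Lall_cos; mfun.
have L1b : L1 P (fun w => H w * W w * cos (U w + (t + pi / 2))).
  by apply: Lall_L1; apply: LallM => //; [exact: LallM|exact: Lall_cos].
rewrite -IntB; [|exact: L1a|exact: L1a].
rewrite -(IntZ s L1b) -IntB; [|exact: L1B|exact: L1Z].
rewrite [leRHS]mulrC -IntZ; last exact: Lall_L1.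
apply: Int_abs_le; first by mfun.
  exact/L1Z/Lall_L1.
move=> w; have K := cos_taylor2 (U w + t) (s * W w).
rewrite add0r mul0r addr0.
have -> : H w * cos (U w + s * W w + t) - H w * cos (U w + t) -
    s * (H w * W w * cos (U w + (t + pi / 2))) =
  H w * (cos (U w + t + s * W w) - cos (U w + t) - s * W w * cos (U w + t + pi / 2)).
  by rewrite (addrAC (U w)) (addrA (U w)); ring.
by rewrite normrM mulrCA ler_wpM2l// -exprMn.
Qed.

Variables (n : nat) (Y : 'I_n -> T -> R) (S : 'M[R]_n).

(** The joint law is encoded by the characteristic functions of the linear combinations, so [S] may
    be singular. Phase 0 gives the real part, and phase [- pi / 2] says that the sine part is 0. *)
Definition gauss_vec :=
  [/\ forall i, Lall (Y i), forall i j, S i j = S j i &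
    forall (c : 'I_n -> R) t, Int P (fun w => cos (\sum_i c i * Y i w + t)) =
      cos t * expR (- (2^-1 * \sum_i \sum_j c i * c j * S i j))].

Definition lin (c : 'I_n -> R) (w : T) : R := \sum_i c i * Y i w.

(* Gaussian integration by parts against [cos (lin c + t)]; [DF k] stands for the
   [k]-th partial derivative of [F], and the sine is written as a shifted cosine. *)
Definition IBP F (DF : 'I_n -> T -> R) := [/\ Lall F, forall k, Lall (DF k) &
  forall i c t, Int P (fun w => Y i w * F w * cos (lin c w + t)) =
   \sum_k S i k * (Int P (fun w => DF k w * cos (lin c w + t)) +
     c k * Int P (fun w => F w * cos (lin c w + (t + pi / 2))))].

Hypothesis GV : gauss_vec.

Let LY i : Lall (Y i). Proof. by case: GV. Qed.
Let SC i j : S i j = S j i. Proof. by case: GV. Qed.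

Lemma Lall_lin c : Lall (lin c).
Proof. by apply: Lall_sum => i; exact: LallZ. Qed.

Lemma lin_shift c l s w : lin (fun k => c k + s * (k == l)%:R) w = lin c w + s * Y l w.
Proof.
rewrite /lin; under eq_bigr do rewrite mulrDl.
rewrite big_split/=; congr (_ + _).
rewrite (bigD1 l)//= eqxx mulr1 big1 ?addr0// => i /negbTE ->.
by rewrite mulr0 mul0r.
Qed.

Lemma sum_delta (l : 'I_n) (f : 'I_n -> R) : \sum_k (k == l)%:R * f k = f l.
Proof.
rewrite (bigD1 l)//= eqxx mul1r big1 ?addr0// => i /negbTE ->.
by rewrite mul0r.
Qed.

(** The characteristic function is differentiated along the [i]-th coordinate in two ways: under the
    integral ([d1]) and in closed form ([d2]). *)
Lemma IBP1 : IBP (fun=> 1) (fun _ _ => 0).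
Proof.
split; [exact: Lall_cst|by move=> _; exact: Lall_cst|move=> i c t].
have [_ _ HE] := GV.
set q := \sum_i \sum_j c i * c j * S i j; set b := \sum_k c k * S i k.
have qs s : \sum_k \sum_l (c k + s * (k == i)%:R) * (c l + s * (l == i)%:R) * S k l =
    q + (s * (2 * b) + s ^+ 2 * S i i).
  transitivity (\sum_k (\sum_l c k * c l * S k l + s * (c k * S i k) +
      s * ((k == i)%:R * (b + s * S i i)))).
    apply: eq_bigr => k _.
    transitivity (\sum_l (c k * c l * S k l + s * ((l == i)%:R * (c k * S k l)) +
       (k == i)%:R * s * (c l * S k l + s * ((l == i)%:R * S k l)))).
      by apply: eq_bigr => l _; ring.
    rewrite !big_split/= -!mulr_sumr big_split/= -!mulr_sumr !sum_delta (SC k i).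
    congr (_ + _); have [->|_] := eqVneq k i; last by rewrite !mul0r mulr0.
    by rewrite /b; ring.
  by rewrite !big_split/= -!mulr_sumr sum_delta -/b -/q; ring.
(* The phase starts at [t - pi / 2] because differentiation adds [pi / 2] to it. *)
have d1 : is_derive (0:R) 1 (fun s => Int P (fun w => 1 * cos (lin c w + s * Y i w + (t - pi / 2))))
    (Int P (fun w => 1 * Y i w * cos (lin c w + (t - pi / 2 + pi / 2)))).
  by apply: is_derive_Ecos; [exact: Lall_cst|exact: LY|exact: Lall_meas (Lall_lin c)].
have d2 : is_derive (0:R) 1 (fun s => Int P (fun w => 1 * cos (lin c w + s * Y i w + (t - pi / 2))))
    (cos (t - pi / 2) * (expR (- (2^-1 * q)) * - b)).
  rewrite (_ : (fun s => _) = fun s => cos (t - pi / 2) *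
     expR (- (2^-1 * q) + (s * (- b) + s ^+ 2 * (- (2^-1 * S i i))))); last first.
    apply/funext => s.
    rewrite (_ : _ + (s * _ + _) = - (2^-1 * (q + (s * (2 * b) + s ^+ 2 * S i i)))); last by field.
    rewrite -qs -HE; apply: eq_Int => w; rewrite mul1r; congr (cos (_ + _)).
    by rewrite -lin_shift.
  apply: is_derive_scalef.
  pose h (s : R) := - (2^-1 * q) + (s * (- b) + s ^+ 2 * (- (2^-1 * S i i))).
  have dh : is_derive (0:R) 1 h (- b).
    have H := is_derive_addf (is_derive_cst (- (2^-1 * q)) (0:R) 1)
      (is_derive_addf (is_derive_affine 0 (- b) 0)
        (is_derive_mulf (is_derive_pow 2 (0:R)) (is_derive_cst (- (2^-1 * S i i)) (0:R) 1))).
    rewrite (_ : h = fun s => cst (- (2^-1 * q)) s + (0 + s * - b + s ^+ 2 * cst (- (2^-1 * S i i)) s)).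
      by apply: (is_derive_eq H); rewrite /= expr1; ring.
    by apply/funext => s; rewrite /h /= add0r.
  have := @is_derive1_comp _ expR h 0 _ _ (is_derive_expR (h 0)) dh.
  by rewrite /h /= mul0r expr0n/= mul0r !addr0.
have := is_derive_uniq d1 d2.
rewrite (_ : t - pi / 2 + pi / 2 = t); last by ring.
have -> : (fun w => 1 * Y i w * cos (lin c w + t)) = (fun w => Y i w * 1 * cos (lin c w + t)).
  by apply/funext => w; rewrite mul1r mulr1.
move=> ->; rewrite /b.
have E0 : Int P (fun w => 0 * cos (lin c w + t)) = 0.
  by rewrite -[RHS](@Int0 _ _ _ P); apply: eq_Int => w; rewrite mul0r.
under [RHS]eq_bigr do rewrite E0 add0r.
have -> : Int P (fun w => 1 * cos (lin c w + (t + pi / 2))) =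
    cos (t + pi / 2) * expR (- (2^-1 * q)).
  by rewrite -HE; apply: eq_Int => w; rewrite mul1r.
rewrite cosBpihalf cosDpihalf mulrN mulrN mulr_sumr mulr_sumr -sumrN.
by apply: eq_bigr => k _; ring.
Qed.

(** The identity for [F] holds for all [c]. Differentiating it in [c l] brings down the factor
    [Y l], and the derivative of the coefficient [c k] on the right produces the Kronecker term. *)
Lemma IBPM l F DF : IBP F DF ->
  IBP (fun w => Y l w * F w) (fun k w => (k == l)%:R * F w + Y l w * DF k w).
Proof.
move=> [LF LDF HF]; split; first exact: LallM.
  by move=> k; apply: LallD; [exact: LallZ|exact: LallM].
move=> i c t; have mc := Lall_meas (Lall_lin c).
set t' := t - pi / 2.
have tE : t' + pi / 2 = t by rewrite /t'; ring.
have d1 := is_derive_Ecos t' (LallM (LY i) LF) (LY l) mc.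
have d2 : is_derive (0:R) 1 (fun s => Int P (fun w => Y i w * F w * cos (lin c w + s * Y l w + t')))
   (\sum_k S i k * (Int P (fun w => DF k w * Y l w * cos (lin c w + (t' + pi / 2))) +
    (c k * Int P (fun w => F w * Y l w * cos (lin c w + (t' + pi / 2 + pi / 2))) +
     Int P (fun w => F w * cos (lin c w + (t' + pi / 2))) * (k == l)%:R))).
  rewrite (_ : (fun s => _) = fun s => \sum_k S i k * (
     Int P (fun w => DF k w * cos (lin c w + s * Y l w + t')) +
     (c k + s * (k == l)%:R) * Int P (fun w => F w * cos (lin c w + s * Y l w + (t' + pi / 2))))); last first.
    apply/funext => s; rewrite -[LHS](_ : Int P (fun w => Y i w * F w *
      cos (lin (fun k => c k + s * (k == l)%:R) w + t')) = _); last first.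
      by apply: eq_Int => w; rewrite lin_shift.
    rewrite HF; apply: eq_bigr => k _; congr (_ * (_ + _ * _)); apply: eq_Int => w;
    by rewrite lin_shift.
  apply: is_derive_sumf => k; apply: is_derive_scalef; apply: is_derive_addf.
    exact: is_derive_Ecos.
  have H := is_derive_mulf (is_derive_affine (c k) (k == l)%:R 0)
     (is_derive_Ecos (t' + pi / 2) LF (LY l) mc).
  apply: (is_derive_eq H); rewrite mul0r addr0; congr (_ + _ * _).
  by apply: eq_Int => w; rewrite mul0r addr0.
have := is_derive_uniq d1 d2; rewrite !tE => E.
transitivity (Int P (fun w => Y i w * F w * Y l w * cos (lin c w + t))).
  by apply: eq_Int => w; ring.
rewrite E; apply: eq_bigr => k _; congr (_ * _).
have La : L1 P (fun w => (k == l)%:R * (F w * cos (lin c w + t))).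
  by apply: L1Z; apply: Lall_L1; apply: LallM => //; exact: Lall_cos.
have Lb : L1 P (fun w => DF k w * Y l w * cos (lin c w + t)).
  by apply: Lall_L1; apply: LallM; [exact: LallM|exact: Lall_cos].
have -> : (fun w => ((k == l)%:R * F w + Y l w * DF k w) * cos (lin c w + t)) =
   (fun w => (k == l)%:R * (F w * cos (lin c w + t)) + DF k w * Y l w * cos (lin c w + t)).
  by apply/funext => w; ring.
rewrite IntD// IntZ; last by apply: Lall_L1; apply: LallM => //; exact: Lall_cos.
have -> : (fun w => Y l w * F w * cos (lin c w + (t + pi / 2))) =
  (fun w => F w * Y l w * cos (lin c w + (t + pi / 2))) by apply/funext => w; ring.
ring.
Qed.

End gauss_vec.

(** * Moments of a centred quadratic form *)

Section quad.
Context d (T : measurableType d) (R : realType) (P : probability T R).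
Variables (n : nat) (Y : 'I_n -> T -> R) (S : 'M[R]_n).
Hypothesis GV : gauss_vec P Y S.
Implicit Types F G : T -> R.

Let LY i : Lall P (Y i). Proof. by case: GV. Qed.

Lemma IBP_lin (a : R) F DF G DG : IBP P Y S F DF -> IBP P Y S G DG ->
  IBP P Y S (fun w => a * F w + G w) (fun k w => a * DF k w + DG k w).
Proof.
move=> [LF LDF HF] [LG LDG HG]; split.
- by apply: LallD => //; exact: LallZ.
- by move=> k; apply: LallD => //; exact: LallZ.
move=> i c t.
have mc : measurable_fun setT (lin Y c) := Lall_meas (Lall_lin GV c).
have key (V W : T -> R) t' : Lall P V -> Lall P W ->
   Int P (fun w => (a * V w + W w) * cos (lin Y c w + t')) =
   a * Int P (fun w => V w * cos (lin Y c w + t')) + Int P (fun w => W w * cos (lin Y c w + t')).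
  move=> LV LW.
  have L U : Lall P U -> L1 P (fun w => U w * cos (lin Y c w + t')).
    by move=> LU; apply: Lall_L1; apply: LallM => //; exact: Lall_cos.
  rewrite -IntZ; last exact: L.
  rewrite -IntD; [|exact/L1Z/L|exact: L].
  by apply: eq_Int => w; ring.
rewrite (_ : (fun w => Y i w * (a * F w + G w) * _) =
  fun w => (a * (Y i w * F w) + Y i w * G w) * cos (lin Y c w + t)); last first.
  by apply/funext => w; ring.
rewrite key; [|exact: LallM|exact: LallM].
rewrite HF HG mulr_sumr -big_split/=; apply: eq_bigr => k _.
by rewrite !key//; ring.
Qed.

(** A factor and its gradient, seen as an operator on [IBP] pairs. Such operators can be added and
    composed, so a polynomial in [Y] is built first and applied to the constant 1 at the end. *)
Definition IBPmul G (DG : 'I_n -> T -> R) := forall F DF, IBP P Y S F DF ->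
  IBP P Y S (fun w => G w * F w) (fun k w => DG k w * F w + G w * DF k w).

Lemma IBPmulY l : IBPmul (Y l) (fun k _ => (k == l)%:R).
Proof. by move=> F DF; exact: IBPM. Qed.

Lemma IBPmul_eq G DG G' DG' : G =1 G' -> (forall k, DG k =1 DG' k) ->
  IBPmul G DG -> IBPmul G' DG'.
Proof.
by move=> /funext <- E; have -> : DG' = DG by apply/funext => k; apply/esym/funext/E.
Qed.

Lemma IBPmul0 : IBPmul (fun=> 0) (fun _ _ => 0).
Proof.
move=> F DF H; have := IBP_lin (-1) H H.
congr (IBP _ _ _ _ _); first by apply/funext => w; ring.
by apply/funext => k; apply/funext => w; ring.
Qed.

Lemma IBPmul_lin a G DG G' DG' : IBPmul G DG -> IBPmul G' DG' ->
  IBPmul (fun w => a * G w + G' w) (fun k w => a * DG k w + DG' k w).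
Proof.
move=> HG HG' F DF H; have := IBP_lin a (HG _ _ H) (HG' _ _ H).
congr (IBP _ _ _ _ _); first by apply/funext => w; ring.
by apply/funext => k; apply/funext => w; ring.
Qed.

Lemma IBPmulM G DG G' DG' : IBPmul G DG -> IBPmul G' DG' ->
  IBPmul (fun w => G w * G' w) (fun k w => DG k w * G' w + G w * DG' k w).
Proof.
move=> HG HG' F DF H; have := HG _ _ (HG' _ _ H).
congr (IBP _ _ _ _ _); first by apply/funext => w; ring.
by apply/funext => k; apply/funext => w; ring.
Qed.

Lemma IBPmul_cst a : IBPmul (fun=> a) (fun _ _ => 0).
Proof.
move=> F DF H; have := IBP_lin a H (IBPmul0 H).
congr (IBP _ _ _ _ _); first by apply/funext => w; ring.
by apply/funext => k; apply/funext => w; ring.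
Qed.

Lemma IBPmul_sum (I : Type) (s : seq I) (G : I -> T -> R) DG :
  (forall i, IBPmul (G i) (DG i)) ->
  IBPmul (fun w => \sum_(i <- s) G i w) (fun k w => \sum_(i <- s) DG i k w).
Proof.
move=> HG; elim: s => [|i s IH].
  by apply: IBPmul_eq IBPmul0 => [w|k w]; rewrite big_nil.
apply: IBPmul_eq (IBPmul_lin 1 (HG i) IH) => [w|k w];
by rewrite big_cons mul1r.
Qed.

Lemma IBPmulX p G DG : IBPmul G DG ->
  IBPmul (fun w => G w ^+ p) (fun k w => p%:R * G w ^+ p.-1 * DG k w).
Proof.
move=> HG; elim: p => [|p IH].
  by apply: IBPmul_eq (IBPmul_cst 1) => [w|k w]; rewrite ?expr0 ?mul0r.
apply: IBPmul_eq (IBPmulM HG IH) => [w|k w]; first by rewrite exprS.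
case: p {IH} => [|p]; first by rewrite expr0 !mulr1 !mul0r mulr0 addr0 mul1r.
by rewrite /= exprS -[in RHS]natr1; ring.
Qed.

Lemma IBP_E F DF i : IBP P Y S F DF ->
  Int P (fun w => Y i w * F w) = \sum_k S i k * Int P (DF k).
Proof.
case=> _ _ /(_ i (fun=> 0) 0).
have E (G : T -> R) : Int P (fun w => G w * cos (lin Y (fun=> 0) w + 0)) = Int P G.
  apply: eq_Int => w; rewrite /lin big1 ?addr0 ?cos0 ?mulr1// => k _.
  by rewrite mul0r.
rewrite E => ->; apply: eq_bigr => k _.
by rewrite E mul0r addr0.
Qed.

Variable A : 'M[R]_n.
Hypothesis symA : forall i j, A i j = A j i.

(** The subtracted trace is the mean of the form, so [quad] is centred. *)
Definition quad (w : T) : R := \sum_i \sum_j A i j * (Y i w * Y j w) - \tr (A *m S).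

Lemma Lall_quad : Lall P quad.
Proof.
apply: LallD; last exact: Lall_cst.
apply: Lall_sum => i; apply: Lall_sum => j; apply: LallZ; exact: LallM.
Qed.

Lemma IBPmul_quad : IBPmul quad (fun k w => 2 * \sum_j A k j * Y j w).
Proof.
have H i j : IBPmul (fun w => A i j * (Y i w * Y j w))
    (fun k w => A i j * ((k == i)%:R * Y j w + Y i w * (k == j)%:R)).
  apply: IBPmul_eq (IBPmul_lin (A i j) (IBPmulM (@IBPmulY i) (@IBPmulY j)) IBPmul0) => [w|k w];
  by rewrite addr0.
have H2 := IBPmul_sum (index_enum 'I_n) (fun i => IBPmul_sum (index_enum 'I_n) (H i)).
apply: IBPmul_eq (IBPmul_lin 1 H2 (IBPmul_cst (- \tr (A *m S)))) => [w|k w].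
  by rewrite mul1r.
rewrite mul1r addr0 mulr_natl mulr2n.
under eq_bigr => i _ do under eq_bigr => j _ do rewrite mulrDr.
under eq_bigr => i _ do rewrite big_split/=.
rewrite big_split/=; congr (_ + _).
  rewrite (bigD1 k)//= [X in _ + X]big1 ?addr0 => [|i ik].
    by apply: eq_bigr => j _; rewrite eqxx mul1r.
  by apply: big1 => j _; rewrite eq_sym (negbTE ik) mul0r mulr0.
apply: eq_bigr => i _; rewrite (bigD1 k)//= big1 ?addr0 => [|j jk].
  by rewrite eqxx mulr1 symA.
by rewrite eq_sym (negbTE jk) !mulr0.
Qed.

Definition qmom p := Int P (fun w => quad w ^+ p).
(** The unknowns that close the recursion: a moment of [quad] is a trace against these matrices, and
    integration by parts expresses them by lower degrees. *)
Definition emx p : 'M[R]_n := \matrix_(i, j) Int P (fun w => Y i w * (Y j w * quad w ^+ p)).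

(** Integration by parts on [Y i]: the derivative falls either on [Y j], which gives [S], or on a
    factor of [quad ^+ p], whose gradient [2 A Y] gives the second term. At [p = 0] the default
    [p.-1 = 0] is killed by its coefficient. *)
Lemma emx_rec p : emx p = qmom p *: S + (2 * p%:R) *: (S *m A *m emx p.-1).
Proof.
apply/matrixP => i j.
rewrite mxE [RHS]mxE [X in _ = X + _]mxE [X in _ = _ + X]mxE.
have HI := IBPmulY j (IBPmulX p IBPmul_quad (IBP1 GV)).
have -> : Int P (fun w => Y i w * (Y j w * quad w ^+ p)) =
          Int P (fun w => Y i w * (Y j w * (quad w ^+ p * 1))).
  by apply: eq_Int => w; rewrite mulr1.
rewrite (IBP_E i HI).
have Lq m : L1 P (fun w => quad w ^+ m) by apply: Lall_L1; apply: LallX; exact: Lall_quad.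
have Le l m : L1 P (fun w => Y l w * (Y j w * quad w ^+ m)).
  apply: Lall_L1; apply: LallM => //; apply: LallM => //; apply: LallX; exact: Lall_quad.
transitivity (\sum_k S i k * ((k == j)%:R * qmom p +
   2 * p%:R * \sum_l A k l * emx p.-1 l j)).
  apply: eq_bigr => k _; congr (_ * _).
  transitivity (Int P (fun w => (k == j)%:R * quad w ^+ p +
     \sum_l (2 * p%:R * A k l) * (Y l w * (Y j w * quad w ^+ p.-1)))).
    apply: eq_Int => w; rewrite !mulr1 mulr0 addr0; congr (_ + _).
    rewrite !mulr_sumr; apply: eq_bigr => l _; ring.
  rewrite IntD; [|exact: L1Z|by apply: L1_sum => l _; exact: L1Z].
  rewrite IntZ// Int_sum; last by move=> l _; exact: L1Z.
  congr (_ + _); rewrite mulr_sumr; apply: eq_bigr => l _.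
  by rewrite IntZ// mxE mulrA.
under eq_bigr => k _ do rewrite mulrDr mulrCA.
rewrite big_split/= sum_delta mulrC; congr (_ + _).
rewrite -mulmxA mxE mulr_sumr; apply: eq_bigr => k _.
by rewrite mxE; ring.
Qed.

Lemma qmomS p : qmom p.+1 = \tr (A *m emx p) - \tr (A *m S) * qmom p.
Proof.
have Lq m : L1 P (fun w => quad w ^+ m) by apply: Lall_L1; apply: LallX; exact: Lall_quad.
have Le l j m : L1 P (fun w => Y l w * (Y j w * quad w ^+ m)).
  apply: Lall_L1; apply: LallM => //; apply: LallM => //; apply: LallX; exact: Lall_quad.
have -> : \tr (A *m emx p) = Int P (fun w =>
   \sum_i \sum_j A i j * (Y j w * (Y i w * quad w ^+ p))).
  rewrite Int_sum; last by move=> i _; apply: L1_sum => j _; exact: L1Z.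
  apply: eq_bigr => i _; rewrite mxE Int_sum; last by move=> j _; exact: L1Z.
  by apply: eq_bigr => j _; rewrite IntZ// mxE.
rewrite /qmom -IntZ// -IntB; [|by apply: L1_sum => i _; apply: L1_sum => j _; exact: L1Z|exact: L1Z].
apply: eq_Int => w; rewrite exprS {1}/quad mulrBl; congr (_ - _).
rewrite mulr_suml; apply: eq_bigr => i _; rewrite mulr_suml; apply: eq_bigr => j _; ring.
Qed.

Lemma qmom0 : qmom 0 = 1.
Proof. by rewrite /qmom -[RHS](@Int_cst _ _ _ P 1); apply: eq_Int => w; rewrite expr0. Qed.

(* Matrix powers: ['M_n] is a ring only for [n] of the form [_.+1], whereas here the
   number of coefficients may be 0. *)
Definition mxpw (M : 'M[R]_n) k : 'M[R]_n := iter k (mulmx^~ M) 1%:M.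

(** Only scalars remain: each step trades one degree of [quad] for one more factor [A S] under the
    trace. *)
Lemma tr_emx_rec k p : \tr (mxpw (A *m S) k *m A *m emx p) =
  qmom p * \tr (mxpw (A *m S) k.+1) + 2 * p%:R * \tr (mxpw (A *m S) k.+1 *m A *m emx p.-1).
Proof.
rewrite [in LHS]emx_rec mulmxDr mxtraceD -!scalemxAr !mxtraceZ /= !mulmxA.
by [].
Qed.

End quad.

(** The moments of the centred normal law of variance [v], in the form in which integration by parts
    produces them. *)
Fixpoint mom {R : realType} (v : R) p : R :=
  match p with 0%N => 1 | 1%N => 0 | p'.+2 => p'.+1%:R * v * mom v p' end.

(** * From moments to characteristic functions *)

Section moment_method.
Context {R : realType}.

Let aux1 (u v q a b f : R) : 0 <= q -> f != 0 ->
  u * (u * a) * ((2 * q + 1) * v * b) / ((2 * q + 2) * ((2 * q + 1) * f)) =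
  u ^+ 2 * v / (2 * q + 2) * (a * b / f).
Proof. by move=> q0 f0; field; rewrite f0/=; apply/andP; split; lra. Qed.

Let aux2 (w q a f : R) : 0 <= q -> f != 0 ->
  w / (2 * q + 2) * (a / f) = w / 2 * a / ((q + 1) * f).
Proof. by move=> q0 f0; field; rewrite f0/=; apply/andP; split; lra. Qed.

(** The Taylor remainder of order [N.*2] for the normal law is thus the [N]-th term of an
    exponential series, hence as small as desired. *)
Lemma mom_even (v u : R) N :
  u ^+ N.*2 * mom v N.*2 / (N.*2)`!%:R = (u ^+ 2 * v / 2) ^+ N / N`!%:R.
Proof.
elim: N => [|N IH]; first by rewrite !expr0 mul1r.
rewrite doubleS (exprS _ N.*2.+1) (exprS _ N.*2) (exprS _ N) /= !factS !natrM.
have f1 : (N.*2)`!%:R != 0 :> R by rewrite pnatr_eq0 -lt0n fact_gt0.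
have f2 : N`!%:R != 0 :> R by rewrite pnatr_eq0 -lt0n fact_gt0.
have n0 : 0 <= N%:R :> R by [].
have E2 : N.*2%:R = 2 * N%:R :> R by rewrite -mul2n natrM.
have E3 : N.*2.+1%:R = 2 * N%:R + 1 :> R by rewrite -natr1 E2.
have E4 : N.*2.+2%:R = 2 * N%:R + 2 :> R by rewrite -natr1 E3; ring.
have E5 : N.+1%:R = N%:R + 1 :> R by rewrite natr1.
rewrite E3 E4 E5.
transitivity (u ^+ 2 * v / (2 * N%:R + 2) * (u ^+ N.*2 * mom v N.*2 / (N.*2)`!%:R)).
  exact: aux1.
by rewrite IH aux2.
Qed.

(** The order is even so that the remainder is a moment without absolute value. *)
Lemma cos_moments d (T : measurableType d) (P : probability T R) (Z : T -> R) u t N :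
  Lall P Z -> `|Int P (fun w => cos (u * Z w + t)) -
    \sum_(k < N.*2) u ^+ k / k`!%:R * cos (t + k%:R * (pi / 2)) * Int P (fun w => Z w ^+ k)|
  <= u ^+ N.*2 / (N.*2)`!%:R * Int P (fun w => Z w ^+ N.*2).
Proof.
move=> LZ; have mZ := Lall_meas LZ.
have LX k : L1 P (fun w => Z w ^+ k) by apply: Lall_L1; exact: LallX.
rewrite (_ : \sum_(k < N.*2) _ = Int P (fun w => \sum_(k < N.*2)
    u ^+ k / k`!%:R * cos (t + k%:R * (pi / 2)) * Z w ^+ k)); last first.
  by rewrite Int_sum => [|k _]; [apply: eq_bigr => k _; rewrite IntZ|exact: L1Z].
have Lc : L1 P (fun w => cos (u * Z w + t)).
  by apply: (@L1_bdd _ _ _ _ 1) => [|w]; [mfun|exact: cos_max].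
have Ls : L1 P (fun w => \sum_(k < N.*2)
    u ^+ k / k`!%:R * cos (t + k%:R * (pi / 2)) * Z w ^+ k).
  by apply: L1_sum => k _; exact: L1Z.
rewrite -IntB// -IntZ//; apply: Int_abs_le; [by apply: (@L1_meas _ _ _ P); exact: L1B|exact: L1Z|move=> w].
have H := cos_taylor N.*2 t (u * Z w).
rewrite (_ : \sum_(k < N.*2) _ = \sum_(k < N.*2) (u * Z w) ^+ k / k`!%:R *
    cos (t + k%:R * (pi / 2))); last first.
  by apply: eq_bigr => k _; rewrite exprMn; ring.
apply: (le_trans H); rewrite -normrX ger0_norm.
  by rewrite exprMn le_eqVlt; apply/orP; left; apply/eqP; ring.
by rewrite -mul2n exprM exprn_ge0// sqr_ge0.
Qed.

Context d (T : measurableType d) (P : probability T R) (Z : nat -> T -> R)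
  d' (T' : measurableType d') (P' : probability T' R) (G : T' -> R) (v : R).
Hypotheses (LZ : forall j, Lall P (Z j)) (LG : Lall P' G).
Hypothesis Zmom : forall p, Int P (fun w => Z j w ^+ p) @[j --> \oo] --> mom v p.
Hypothesis Gmom : forall p, Int P' (fun w => G w ^+ p) = mom v p.

(** The order [N] is chosen from the limit law alone; convergence of the finitely many moments up to
    [N.*2] then controls the Taylor polynomial and the remainder of [Z j]. *)
Lemma moment_charfun u t :
  Int P (fun w => cos (u * Z j w + t)) @[j --> \oo] --> Int P' (fun w => cos (u * G w + t)).
Proof.
apply/cvgrPdist_le => /= e e0.
pose c N := u ^+ N.*2 / (N.*2)`!%:R.
have [N HN] : exists N, c N * mom v N.*2 <= e / 8.
  have e8 : 0 < e / 8 by lra.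
  have /cvgrPdist_le/(_ _ e8)[N _ H] := @cvg_exp_coeff R (u ^+ 2 * v / 2).
  exists N; have := H N (leqnn N); rewrite sub0r normrN /exp_coeff /= => h.
  apply: (le_trans (ler_norm _)); apply: le_trans h.
  by rewrite /c mulrAC mom_even.
pose pol (m : nat -> R) := \sum_(k < N.*2) u ^+ k / k`!%:R * cos (t + k%:R * (pi / 2)) * m k.
have polc : pol (fun k => Int P (fun w => Z j w ^+ k)) @[j --> \oo] --> pol (mom v).
  rewrite /pol; apply: cvg_big.
    exact: add_continuous.
  move=> k _; apply: cvgM; [exact: cvg_cst|exact: Zmom].
have mc : c N * Int P (fun w => Z j w ^+ N.*2) @[j --> \oo] --> c N * mom v N.*2.
  by apply: cvgM; [exact: cvg_cst|exact: Zmom].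
have e4 : 0 < e / 4 by lra.
move/cvgrPdist_le : polc => /(_ _ e4); move/cvgrPdist_le : mc => /(_ _ e4).
apply: filterS2 => j h1 h2.
have := cos_moments u t N (LZ j); rewrite -/(c N) -/(pol (fun k => Int P (fun w => Z j w ^+ k))).
have := cos_moments u t N LG; rewrite -/(c N) (_ : \sum_(k < N.*2) _ = pol (mom v)); last first.
  by apply: eq_bigr => k _; rewrite Gmom.
rewrite Gmom; move: h1 h2; rewrite !ler_norml => /andP[? ?] /andP[? ?] /andP[? ?] /andP[? ?].
apply/andP; split; lra.
Qed.

End moment_method.

(** * Convergence of the moments of quadratic forms *)

Section quad_clt.
Context d (T : measurableType d) (R : realType) (P : probability T R).

Lemma gauss_mom (Z : T -> R) (v : R) : gauss_vec P (fun _ : 'I_1 => Z) v%:M ->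
  forall p, Int P (fun w => Z w ^+ p) = mom v p.
Proof.
move=> GV.
have H p : Int P (fun w => Z w ^+ p.+1) = p%:R * v * Int P (fun w => Z w ^+ p.-1).
  have HI := IBPmulX GV p (IBPmulY GV ord0) (IBP1 GV).
  have := IBP_E ord0 HI.
  rewrite big_ord1 mxE eqxx mulr1n.
  have LZ m : L1 P (fun w => Z w ^+ m).
    by case: GV => /(_ ord0) LZ _ _; apply: Lall_L1; exact: LallX.
  rewrite (_ : (fun w => Z w * (Z w ^+ p * 1)) = fun w => Z w ^+ p.+1); last first.
    by apply/funext => w; rewrite mulr1 exprS.
  move=> ->; rewrite -mulrA mulrCA; congr (_ * _); rewrite -IntZ//; apply: eq_Int => w.
  by rewrite !mulr1 mulr0 addr0.
move=> p; elim/ltn_ind: p => -[|[|p]] IH /=.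
- by rewrite -[RHS](@Int_cst _ _ _ P 1); apply: eq_Int => w; rewrite expr0.
- by rewrite H !mul0r.
- by rewrite H IH.
Qed.

Variables (n : nat -> nat) (Y : forall j, 'I_(n j) -> T -> R)
  (S A : forall j, 'M[R]_(n j)) (v : R).
Arguments Y : clear implicits.
Hypothesis GV : forall j, gauss_vec P (Y j) (S j).
Hypothesis symA : forall j i k, A j i k = A j k i.
Hypothesis tr2 : 2 * \tr (mxpw (A j *m S j) 2) @[j --> \oo] --> v.
Hypothesis tr3 : forall k, \tr (mxpw (A j *m S j) k.+3) @[j --> \oo] --> 0.

Let m j p := qmom P (Y j) (S j) (A j) p.
Let t j k p := \tr (mxpw (A j *m S j) k *m A j *m emx P (Y j) (S j) (A j) p).

(** Strong induction on the degree, jointly with [t j k p --> 0] for [k >= 2]. The trace of [A S]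
    cancels by centring ([mrec]), and that of [(A S)^2] enters through [m_(p+2) = (p + 1) * (2 tr
    ((A S)^2) * m_p + o(1))], which is the recursion of [mom] in the limit. *)
Lemma quad_mom_cvg p : m j p @[j --> \oo] --> mom v p.
Proof.
have trec j k p' : t j k p' = m j p' * \tr (mxpw (A j *m S j) k.+1) + 2 * p'%:R * t j k.+1 p'.-1.
  exact: tr_emx_rec.
have mrec j p' : m j p'.+1 = 2 * p'%:R * t j 1%N p'.-1.
  rewrite /m (qmomS (GV j)).
  have := trec j 0%N p'; rewrite /t /= !mul1mx => ->; rewrite /m; ring.
have main q : m j q @[j --> \oo] --> mom v q /\
    forall k, t j k.+2 q @[j --> \oo] --> 0.
  elim/ltn_ind: q => p' IH.
  have Hm : m j p' @[j --> \oo] --> mom v p'.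
    case: p' IH => [|[|p']] IH.
    - rewrite (_ : (fun j => _) = fun=> 1); first exact: cvg_cst.
      by apply/funext => j; exact: qmom0.
    - rewrite (_ : (fun j => _) = fun=> 0); first exact: cvg_cst.
      by apply/funext => j; rewrite mrec mulr0 mul0r.
    - have [IHm IHt] := IH p' (ltnW (ltnSn _)).
      rewrite (_ : (fun j => _) = fun j => p'.+1%:R * (2 * \tr (mxpw (A j *m S j) 2) * m j p' +
         2 * (2 * p'%:R * t j 2%N p'.-1))); last first.
        by apply/funext => j; rewrite mrec trec /=; ring.
      rewrite /= -mulrA -[v * _]addr0 -[0 in X in _ --> X](mulr0 2).
      apply: cvgM; first exact: cvg_cst.
      apply: cvgD; first exact: cvgM.
      apply: cvgM; first exact: cvg_cst.
      case: p' IH IHm IHt => [|p'] IH IHm IHt.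
        rewrite (_ : (fun j => _) = fun=> 0); first exact: cvg_cst.
        by apply/funext => j; rewrite mulr0 mul0r.
      rewrite -(mulr0 (2 * p'.+1%:R)); apply: cvgM; first exact: cvg_cst.
      by have [_ ] := IH p' (ltnW (ltnW (ltnSn _))); apply.
  split=> // k.
  rewrite (_ : (fun j => _) = fun j => m j p' * \tr (mxpw (A j *m S j) k.+3) +
     2 * p'%:R * t j k.+3 p'.-1); last by apply/funext => j; rewrite trec.
  rewrite -[0](addr0 0) -{1}(mulr0 (mom v p')); apply: cvgD; first exact: cvgM.
  case: p' IH Hm => [|p'] IH Hm.
    rewrite (_ : (fun j => _) = fun=> 0); first exact: cvg_cst.
    by apply/funext => j; rewrite mulr0 mul0r.
  rewrite -(mulr0 (2 * p'.+1%:R)); apply: cvgM; first exact: cvg_cst.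
  by have [_ ] := IH p' (ltnSn _); apply.
by have [] := main p.
Qed.

End quad_clt.

(** * Integrals of the process *)

Section law.
Context {R : realType}.
Notation leb := (@lebesgue_measure R).

Lemma Int_law d (T : measurableType d) (P : probability T R)
  (N : probability (measurableTypeR R) R) (Y : T -> R) (g : R -> R) :
  measurable_fun setT Y -> (forall V : set R, measurable V -> P (Y @^-1` V) = N V) ->
  measurable_fun setT g -> L1 N g ->
  L1 P (fun w => g (Y w)) /\ Int P (fun w => g (Y w)) = Int N g.
Proof.
move=> mY PN mg Lg.
have mY' : measurable_fun setT (Y : T -> measurableTypeR R) by exact: mY.
pose nu : {measure set (measurableTypeR R) -> \bar R} :=
  measure_function_pushforward__canonical__measure_function_Measure P mY'.
have nuN A : measurable A -> A `<=` setT -> nu A = N A by move=> mA _; exact: PN.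
have mgY : measurable_fun setT (fun w => g (Y w)) := measurableT_comp mg mY.
have L : L1 P (fun w => g (Y w)).
  apply/integrableP; split; first exact/measurable_EFinP.
  have mag : measurable_fun setT (fun x : measurableTypeR R => (`|g x|)%:E).
    by apply/measurable_EFinP; mfun.
  have /integrableP[_] := Lg.
  have <- : (\int[nu]_x `|(EFin \o g) x| = \int[N]_x `|(EFin \o g) x|)%E.
    by apply: eq_measure_integral => A mA _; exact: nuN.
  by rewrite ge0_integral_pushforward.
split=> //; rewrite /Rintegral; congr fine.
have <- : (\int[nu]_x (g x)%:E = \int[N]_x (g x)%:E)%E.
  by apply: eq_measure_integral => A mA _; exact: nuN.
rewrite (@integral_pushforward _ _ _ (measurableTypeR R) R Y mY' P setT (EFin \o g))//.
exact/measurable_EFinP.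
Qed.

(** The degenerate case [v = 0] is a Dirac mass and is treated apart. Casting the law as a
    [gauss_vec] of dimension 1 gives its moments by integration by parts. *)
Lemma gauss_law (v : R) : 0 <= v -> exists N : probability (measurableTypeR R) R,
  (N : set _ -> \bar R) = centred_gauss_law v /\
  gauss_vec N (fun (_ : 'I_1) (x : measurableTypeR R) => x : R) v%:M.
Proof.
have Sv (c : 'I_1 -> R) : \sum_i \sum_j c i * c j * (v%:M : 'M[R]_1) i j = c ord0 ^+ 2 * v.
  by rewrite !big_ord1 mxE eqxx mulr1n expr2.
have symv (i j : 'I_1) : (v%:M : 'M[R]_1) i j = (v%:M : 'M[R]_1) j i.
  by rewrite !mxE eq_sym.
have mid : measurable_fun setT (fun x : measurableTypeR R => x : R) by exact: measurable_id.
rewrite le_eqVlt => /predU1P[v0|v0].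
  pose D0 : probability (measurableTypeR R) R := \d_(0 : measurableTypeR R).
  exists D0.
  have E (g : R -> R) : measurable_fun setT g ->
      (\int[D0]_x (g x)%:E = (g 0%R)%:E)%E.
    by move=> mg; rewrite /D0 integral_dirac ?diracT ?mul1e//; exact/measurable_EFinP.
  split; first by rewrite /centred_gauss_law -v0 eqxx.
  split => //.
    move=> _; split=> // n; apply: L1_ge0P; [by mfun|by move=> x; rewrite exprn_ge0|].
    by rewrite (E (fun x => `|x| ^+ n)) ?ltry//; mfun.
  move=> c t; rewrite Sv -v0 mulr0 mulr0 oppr0 expR0 mulr1.
  rewrite /Rintegral (E (fun x => cos (\sum_(i < 1) c i * x + t))) /=.
    by rewrite big_ord1 mulr0 add0r.
  by mfun.
pose N0 : probability (measurableTypeR R) R := normal_prob 0 (Num.sqrt v).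
exists N0.
have s0 : 0 < Num.sqrt v by rewrite sqrtr_gt0.
have sp : Num.sqrt pi != 0 :> R by rewrite gt_eqF// sqrtr_gt0 pi_gt0.
have LG : L1 leb (@gauss_fun R) by exact: integrableT_gauss.
split; first by rewrite /centred_gauss_law gt_eqF.
split => //.
  move=> _; split=> // n.
  have [] := @normal_Int R (Num.sqrt v) (fun x => `|x| ^+ n) s0 _ _ => //; first by mfun.
  set k := Num.sqrt v * Num.sqrt 2.
  apply: (@L1_le _ _ _ leb (fun x => gauss_fun x + k ^+ n.*2 * (x ^+ n.*2 * gauss_fun x))).
  - by mfun.
  - move=> x; rewrite normrM (ger0_norm (gauss_fun_ge0 x)) ger0_norm ?exprn_ge0//.
    rewrite mulrA -{2}[gauss_fun x]mul1r -mulrDl ler_wpM2r ?gauss_fun_ge0//.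
    rewrite -exprMn -(mul2n n) mulnC exprM -real_normK ?num_real// normrX.
    by move: (`|k * x| ^+ n) => y; have := sqr_ge0 (y - 1); have := sqr_ge0 y; nra.
  - by apply: L1D => //; apply: L1Z; exact: L1_gauss_pow.
move=> c t; rewrite Sv.
have [] := @normal_Int R (Num.sqrt v) (fun x => cos (c ord0 * x + t)) s0 _ _.
- by mfun.
- apply: (@L1_le _ _ _ leb (@gauss_fun R)) => //; first by mfun.
  move=> x; rewrite normrM (ger0_norm (gauss_fun_ge0 x)) ler_piMl ?gauss_fun_ge0//.
  exact: cos_max.
move=> _ H; transitivity (Int (normal_prob 0 (Num.sqrt v)) (fun x => cos (c ord0 * x + t))).
  by apply: eq_Int => x; rewrite big_ord1.
rewrite H; under eq_Int => x do rewrite mulrA.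
rewrite gauss_charfun -mulrA mulKf// mulrC; congr (_ * expR _).
by rewrite !exprMn !sqr_sqrtr ?(ltW v0)//; field.
Qed.

End law.

Section process.
Context {R : realType} d (Omega : measurableType d) (P : probability Omega R)
  (X : R -> Omega -> R) (f : R -> R).
Notation leb := (@lebesgue_measure R).
Hypotheses (Lf : L1 leb f) (f0 : forall l, 0 <= f l)
  (GX : centred_gaussian_process P X (cov_fun f)).

(** The covariance is the Fourier transform of [f >= 0], so the variance of a combination is the
    integral of a squared modulus: it is nonnegative, and dominated convergence applies to it. *)
Lemma cov_quad n (t c : 'I_n -> R) :
  \sum_i \sum_k c i * c k * cov_fun f (t i - t k) =
  Int leb (fun l => ((\sum_i c i * cos (l * t i)) ^+ 2 + (\sum_i c i * sin (l * t i)) ^+ 2) * f l).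
Proof.
have L i k : L1 leb (fun l => cos (l * (t i - t k)) * f l).
  by apply: (@L1Mb _ _ R leb 1) => //; [mfun|move=> l; exact: cos_max].
transitivity (Int leb (fun l => \sum_i \sum_k c i * c k * (cos (l * (t i - t k)) * f l))).
  rewrite Int_sum => [|i _]; last by apply: L1_sum => k _; exact: L1Z.
  apply: eq_bigr => i _; rewrite Int_sum => [|k _]; last exact: L1Z.
  by apply: eq_bigr => k _; rewrite IntZ.
apply: eq_Int => l; rewrite !expr2 !mulr_suml -big_split/= mulr_suml.
apply: eq_bigr => i _; rewrite !mulr_sumr -big_split/= mulr_suml.
by apply: eq_bigr => k _; rewrite mulrBr cosB; ring.
Qed.

Lemma process_lin n (t c : 'I_n -> R) : let v := \sum_i \sum_k c i * c k * cov_fun f (t i - t k) in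
  Lall P (fun w => \sum_i c i * X (t i) w) /\
  forall th, Int P (fun w => cos (\sum_i c i * X (t i) w + th)) = cos th * expR (- (2^-1 * v)).
Proof.
move=> v; have v0 : 0 <= v.
  rewrite /v cov_quad; apply: Int_ge0 => l.
  by rewrite mulr_ge0// addr_ge0// sqr_ge0.
have [N [NE [LN _ HN]]] := gauss_law v0.
have [mY PN] := GX t c.
have {}PN V : measurable V -> P ((fun w => \sum_(i < n) c i * X (t i) w) @^-1` V) = N V.
  by move=> mV; rewrite NE; exact: PN.
split.
  split=> // k.
  have mk : measurable_fun setT (fun x : R => `|x| ^+ k) by mfun.
  by have [] := Int_law mY PN mk ((LN ord0).2 k).
move=> th; have := HN (fun=> 1) th.
rewrite !big_ord1 mxE eqxx mulr1n !mul1r => <-.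
have mc : measurable_fun setT (fun x : R => cos (x + th)) by mfun.
have Lc : L1 N (fun x : R => cos (x + th)).
  by apply: (@L1_bdd _ _ _ _ 1) => // x; exact: cos_max.
have [_ ->] := Int_law mY PN mc Lc.
by apply: eq_Int => x; rewrite big_ord1 mul1r.
Qed.

Lemma process_Lall t : Lall P (X t).
Proof.
have [H _] := @process_lin 1 (fun=> t) (fun=> 1).
rewrite (_ : X t = fun w => \sum_(i < 1) 1 * X t w)//.
by apply/funext => w; rewrite big_ord1 mul1r.
Qed.

(** Stationarity: the variance of [X t] is [cov_fun f 0] for every [t]. The bound uniform in [t] is
    what Fubini's theorem needs for the paths. *)
Lemma process_moment k t : Int P (fun w => `|X t w| ^+ k) = Int P (fun w => `|X 0 w| ^+ k).
Proof.
have v0 : 0 <= cov_fun f 0.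
  have := cov_quad (fun _ : 'I_1 => 0) (fun=> 1); rewrite !big_ord1 !mul1r subrr => ->.
  by apply: Int_ge0 => l; rewrite mulr_ge0// addr_ge0// sqr_ge0.
have [N [NE [LN _ _]]] := gauss_law v0.
have H s : Int P (fun w => `|X s w| ^+ k) = Int N (fun x => `|x| ^+ k).
  have [mY] := GX (fun _ : 'I_1 => s) (fun=> 1).
  rewrite !big_ord1 !mul1r subrr.
  have -> : (fun w => \sum_(i < 1) 1 * X s w) = X s.
    by apply/funext => w; rewrite big_ord1 mul1r.
  move=> PN; have mX := Lall_meas (process_Lall s).
  have {}PN V : measurable V -> P (X s @^-1` V) = N V.
    by move=> mV; rewrite NE; exact: PN.
  have mk : measurable_fun setT (fun x : R => `|x| ^+ k) by mfun.
  by have [_ ->] := Int_law mX PN mk ((LN ord0).2 k).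
by rewrite !H.
Qed.

End process.

(** * Almost sure domination and Fubini's theorem for paths *)

Section ae.
Context d (T : measurableType d) (R : realType) (mu : {measure set T -> \bar R}).

Lemma L1_le_ae (g f : T -> R) : measurable_fun setT f ->
  {ae mu, forall x, `|f x| <= g x} -> L1 mu g -> L1 mu f.
Proof.
move=> mf fg Lg; have mg := L1_meas Lg.
apply/integrableP; split; first exact/measurable_EFinP.
have /integrableP[_] := Lg; apply: le_lt_trans.
apply: ae_ge0_le_integral => //.
- by apply/measurable_EFinP; mfun.
- by apply/measurable_EFinP; mfun.
- by apply: filterS fg => x /= H _; rewrite lee_fin (le_trans H)// ler_norm.
Qed.

Lemma Int_abs_le_ae (f g : T -> R) : measurable_fun setT f -> L1 mu g ->
  {ae mu, forall x, `|f x| <= g x} -> `|Int mu f| <= Int mu g.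
Proof.
move=> mf Lg fg; have Lf := L1_le_ae mf fg Lg.
apply: (le_trans (Int_abs Lf)); rewrite -lee_fin !Int_EFin//; last exact: L1_abs.
have mg := L1_meas Lg.
have -> : (\int[mu]_x (g x)%:E = \int[mu]_x (`|g x|)%:E)%E.
  apply: ae_eq_integral => //; [by apply/measurable_EFinP|by apply/measurable_EFinP; mfun|].
  by apply: filterS fg => x /= H _; rewrite ger0_norm// (le_trans _ H).
apply: ae_ge0_le_integral => //.
- by apply/measurable_EFinP; mfun.
- by apply/measurable_EFinP; mfun.
- by apply: filterS fg => x /= H _; rewrite lee_fin (le_trans H)// ler_norm.
Qed.

End ae.

Section paths.
Context {R : realType} d (Omega : measurableType d) (P : probability Omega R).
Notation leb := (@lebesgue_measure R).

(** A bound on [E |W t|] uniform in [t] replaces pointwise domination. Paths are integrable only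
    almost surely; the value of [Rintegral] on the exceptional null set does not affect
    expectations. *)
Lemma path_fubini (W : R -> Omega -> R) (p : R -> R) (M : R) :
  measurable_fun setT (fun q : R * Omega => W q.1 q.2) ->
  L1 leb p -> (forall t, L1 P (W t)) -> (forall t, Int P (fun w => `|W t w|) <= M) ->
  [/\ {ae P, forall w, L1 leb (fun t => p t * W t w)},
     L1 P (fun w => Int leb (fun t => p t * W t w)),
     L1 leb (fun t => p t * Int P (W t)) &
     Int P (fun w => Int leb (fun t => p t * W t w)) = Int leb (fun t => p t * Int P (W t))].
Proof.
move=> mW Lp LW WM.
pose F (q : (measurableTypeR R) * Omega) : \bar R := (p q.1 * W q.1 q.2)%:E.
have mp1 : measurable_fun setT (fun q : (measurableTypeR R) * Omega => p q.1).
  exact: measurableT_comp (L1_meas Lp) measurable_fst.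
have mW' : measurable_fun setT (fun q : (measurableTypeR R) * Omega => W q.1 q.2) by exact: mW.
have mF : measurable_fun setT F by apply/measurable_EFinP; mfun.
have mF2 w : measurable_fun setT (fun t => p t * W t w).
  apply: measurable_funM; first exact: L1_meas Lp.
  exact: (measurableT_comp mW' (measurable_pair2 w)).
have E1 t : (\int[P]_w F (t, w) = (p t * Int P (W t))%:E)%E.
  rewrite /F /= -IntZ// Int_EFin//; exact: L1Z.
have iF : (leb \x P)%E.-integrable setT F.
  apply/(integrable12ltyP leb P mF) => /=.
  have E t : (\int[P]_w `|F (t, w)| = (`|p t| * Int P (fun w => `|W t w|))%:E)%E.
    rewrite -IntZ; last exact: L1_abs.
    rewrite Int_EFin; last exact/L1Z/L1_abs.
    by apply: eq_integral => w _; rewrite /F /= normrM.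
  have mE : measurable_fun setT (fun t => (`|p t| * Int P (fun w => `|W t w|))).
    apply/measurable_EFinP; rewrite [X in measurable_fun _ X](_ : _ = fubini_F P (fun q => `|F q|%E)).
      by apply: measurable_fun_fubini_tonelli_F => //; exact: measurableT_comp.
    by apply/funext => t /=; rewrite -E.
  under eq_integral => t _ do rewrite E.
  have L : L1 leb (fun t => `|p t| * Int P (fun w => `|W t w|)).
    apply: (@L1_le _ _ _ leb (fun t => M * `|p t|)) => //; last exact/L1Z/L1_abs.
    move=> t; rewrite normrM normr_id mulrC ler_wpM2r// ger0_norm//.
    exact: Int_ge0.
  by apply: integrable_lty; [exact: measurableT|exact: L].
have ae1 : {ae P, forall w, L1 leb (fun t => p t * W t w)}.
  by have := ae_integrable2 iF; apply: filterS => w.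
have mG : measurable_fun setT (fun w => Int leb (fun t => p t * W t w)).
  by apply: measurableT_comp => //; exact: (measurable_fubini_G iF).
have aeE : ae_eq P setT (EFin \o (fun w => Int leb (fun t => p t * W t w)))
    (fun w => \int[leb]_t F (t, w))%E.
  by apply: filterS ae1 => w Lw _ /=; rewrite Int_EFin.
have L2 : L1 P (fun w => Int leb (fun t => p t * W t w)).
  apply/integrableP; split; first exact/measurable_EFinP.
  have iG := (integrable21ltyP leb P mF).1 iF.
  apply: le_lt_trans iG; apply: ae_ge0_le_integral => //.
  - by apply/measurable_EFinP; mfun.
  - by move=> w _; exact: integral_ge0.
  - apply: (@measurable_fun_fubini_tonelli_G _ _ _ _ _ leb (fun q => `|F q|%E)) => //.
    exact: measurableT_comp.
  - apply: filterS ae1 => w Lw _ /=; rewrite EFin_normr_Rintegral//.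
    by apply: le_abse_integral => //; apply/measurable_EFinP; exact: mF2.
have L3 : L1 leb (fun t => p t * Int P (W t)).
  have := integrable_fubini_F iF; congr (integrable leb setT _).
  by apply/funext => t; rewrite /fubini_F E1.
split=> //.
rewrite /Rintegral; congr fine.
transitivity (\int[P]_w \int[leb]_t F (t, w))%E.
  apply: ae_eq_integral => //; first exact/measurable_EFinP.
  exact: (measurable_fubini_G iF).
rewrite -(Fubini iF); apply: eq_integral => t _; exact: E1.
Qed.

End paths.

(** * Step-function approximation on a grid *)

Section grid.
Context {R : realType}.

(** Mesh [1 / (N + 1)] and range [[-(N + 1), N + 1[] are refined together, hence the [2 (N + 1)^2]
    cells of [gridsum]. *)
Definition gridpt (N i : nat) : R := i%:R / N.+1%:R - N.+1%:R.
Definition gridcell N i : set R := `[gridpt N i, gridpt N i + N.+1%:R^-1[%classic.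
Definition gridsum N (a : R -> R) (t : R) : R :=
  \sum_(i < (N.+1 * N.+1).*2) \1_(gridcell N i) t * a (gridpt N i).

Lemma gridsumP N t :
  (exists2 v, `|t - v| <= N.+1%:R^-1 & forall a, gridsum N a t = a v) \/
  (N.+1%:R <= `|t| /\ forall a, gridsum N a t = 0).
Proof.
set n := N.+1; have n0 : 0 < n%:R :> R by rewrite ltr0n.
have cellE i : (t \in gridcell N i) = (i%:R <= (t + n%:R) * n%:R < i.+1%:R).
  apply/idP/idP.
    rewrite inE /gridcell /= in_itv/= /gridpt -/n => /andP[h1 h2]; apply/andP; split.
      by rewrite -ler_pdivrMr//; lra.
    by rewrite -natr1 -ltr_pdivlMr// mulrDl mul1r; lra.
  move=> /andP[h1 h2]; rewrite inE /gridcell /= in_itv/= /gridpt -/n; apply/andP; split.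
    by rewrite -ler_pdivrMr// in h1; lra.
  by rewrite -natr1 -ltr_pdivlMr// mulrDl mul1r in h2; lra.
have [tn|tn] := boolP (- n%:R <= t < n%:R); last first.
  right; split.
    rewrite real_ler_normr ?num_real//; move: tn; rewrite negb_and -!ltNge -!leNgt.
    by move=> /orP[tn|tn]; apply/orP; [right; lra|left].
  move=> a; rewrite /gridsum big1// => i _; rewrite indicE cellE.
  case: andP => [[h1 h2]|_]; last by rewrite mul0r.
  move: tn; rewrite negb_and -!ltNge -!leNgt => /orP[tn|tn].
    have : (t + n%:R) * n%:R < 0 by rewrite pmulr_llt0//; lra.
    by move=> h; have := le_lt_trans h1 h; rewrite ltrn0.
  have : (n * n).*2%:R <= (t + n%:R) * n%:R.
    by rewrite -addnn natrD !natrM -mulrDl ler_wpM2r//; lra.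
  move=> h; have := le_lt_trans h h2; rewrite ltr_nat ltnS => h3.
  by have := leq_trans (ltn_ord i) h3; rewrite ltnn.
left; case/andP: tn => tn1 tn2.
have y0 : 0 <= (t + n%:R) * n%:R by rewrite mulr_ge0//; lra.
have /andP[k1 k2] := truncn_itv y0.
set k := Num.truncn _ in k1 k2.
have kn : (k < (n * n).*2)%N.
  rewrite -(ltr_nat R) (le_lt_trans k1)// -addnn natrD !natrM -mulrDl ltr_pM2r//.
  lra.
exists (gridpt N k).
  rewrite /gridpt -/n ler_norml; move: k1 k2; rewrite -ler_pdivrMr// -natr1 -ltr_pdivlMr// mulrDl mul1r.
  have ni0 : 0 < n%:R^-1 :> R by rewrite invr_gt0.
  move=> k1 k2; apply/andP; split; lra.
move=> a; rewrite /gridsum (bigD1 (Ordinal kn))//= big1 ?addr0 => [|i ik].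
  by rewrite indicE cellE k1 k2 mul1r.
rewrite indicE cellE; case: andP => [[h1 h2]|_]; last by rewrite mul0r.
have := le_lt_trans h1 k2; have := le_lt_trans k1 h2.
rewrite !ltr_nat !ltnS => a1 a2; case/negP: ik; apply/eqP/val_inj => /=.
by apply/eqP; rewrite eqn_leq a1 a2.
Qed.

Lemma gridsum_cvg (a : R -> R) t : {for t, continuous a} -> gridsum N a t @[N --> \oo] --> a t.
Proof.
move=> ca; apply/cvgrPdist_le => /= e e0.
have /cvgrPdist_le/(_ _ e0) := ca; move=> /nbhs_ballP[r /= r0 H].
near=> N; have [[v tv ->]|[tn _]] := gridsumP N t.
  apply: H; rewrite /ball/= (le_lt_trans tv)//.
  rewrite invf_plt ?posrE ?ltr0n//.
  near: N; exists (Num.truncn r^-1) => // i /= hi.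
  by rewrite (lt_le_trans (truncnS_gt _))// ler_nat.
exfalso; move: tn; apply/negP; rewrite -ltNge.
near: N; exists (Num.truncn `|t|) => // i /= hi.
by rewrite (lt_le_trans (truncnS_gt _))// ler_nat.
Unshelve. all: by end_near. Qed.

End grid.

(** * Fourier transforms of integrable functions *)

Section fourier.
Context {R : realType}.
Notation leb := (@lebesgue_measure R).

Lemma L1_trig (phi : R -> R) (l : R) : L1 leb phi ->
  L1 leb (fun t => cos (l * t) * phi t) /\ L1 leb (fun t => sin (l * t) * phi t).
Proof.
move=> Lp; split.
  by apply: (@L1Mb _ _ R leb 1) => //; [mfun|move=> t; exact: cos_max].
by apply: (@L1Mb _ _ R leb 1) => //; [mfun|move=> t; exact: sin_max].
Qed.

Lemma FT_re_continuous (phi : R -> R) : L1 leb phi -> continuous (FT_re phi).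
Proof.
move=> Lp l.
have H := @continuity_under_integral R _ _ leb (fun l t => cos (l * t) * phi t) setT measurableT
  (l - 1) (l + 1) (fun l _ => (L1_trig l Lp).1) _ (fun t => `|phi t|) (L1_abs Lp) _.
apply: H.
- apply: aeW => t _ x _; apply: cvgM; last exact: cvg_cst.
  apply: (cvg_comp (fun l => l * t) cos); last exact: continuous_cos.
  by apply: cvgM; [exact: cvg_id|exact: cvg_cst].
- by move=> x _; apply: aeW => t _; rewrite normrM ler_piMl// cos_max.
- by apply/mem_set; rewrite /= in_itv/=; apply/andP; split; lra.
Qed.

Lemma FT_im_continuous (phi : R -> R) : L1 leb phi -> continuous (FT_im phi).
Proof.
move=> Lp l; apply: cvgN.
have H := @continuity_under_integral R _ _ leb (fun l t => sin (l * t) * phi t) setT measurableT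
  (l - 1) (l + 1) (fun l _ => (L1_trig l Lp).2) _ (fun t => `|phi t|) (L1_abs Lp) _.
apply: H.
- apply: aeW => t _ x _; apply: cvgM; last exact: cvg_cst.
  apply: (cvg_comp (fun l => l * t) sin); last exact: continuous_sin.
  by apply: cvgM; [exact: cvg_id|exact: cvg_cst].
- by move=> x _; apply: aeW => t _; rewrite normrM ler_piMl// sin_max.
- by apply/mem_set; rewrite /= in_itv/=; apply/andP; split; lra.
Qed.

Lemma FT_bounds (phi : R -> R) l : L1 leb phi ->
  `|FT_re phi l| <= Int leb (fun t => `|phi t|) /\ `|FT_im phi l| <= Int leb (fun t => `|phi t|).
Proof.
move=> Lp; rewrite /FT_im normrN; split; apply: Int_abs_le; try exact: L1_abs.
- exact: L1_meas (L1_trig l Lp).1.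
- by move=> t; rewrite normrM ler_piMl// cos_max.
- exact: L1_meas (L1_trig l Lp).2.
- by move=> t; rewrite normrM ler_piMl// sin_max.
Qed.

End fourier.

(** * Joint Gaussian law of the integrals of the process *)

Section functional.
Context {R : realType} d (Omega : measurableType d) (P : probability Omega R)
  (X : R -> Omega -> R) (f : R -> R).
Notation leb := (@lebesgue_measure R).
Hypotheses (Lf : L1 leb f) (f0 : forall l, 0 <= f l)
  (GX : centred_gaussian_process P X (cov_fun f))
  (mX : measurable_fun setT (fun p : R * Omega => X p.1 p.2))
  (msc : forall t : R, (\int[P]_w ((X s w - X t w) ^+ 2)%:E)%E @[s --> t] --> 0%E).

Definition Yf (phi : R -> R) (w : Omega) : R := Int leb (fun t => phi t * X t w).

Let LX t : Lall P (X t). Proof. exact: (process_Lall Lf f0 GX t). Qed.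
Let M k := Int P (fun w => `|X 0 w| ^+ k).
Let XM t : Int P (fun w => `|X t w|) <= M 1.
Proof.
rewrite le_eqVlt; apply/orP; left; apply/eqP.
by rewrite /M -(process_moment Lf f0 GX 1 t); apply: eq_Int => w; rewrite expr1.
Qed.

Let Yf_path (phi : R -> R) : L1 leb phi ->
  {ae P, forall w, L1 leb (fun t => phi t * X t w)} /\ measurable_fun setT (Yf phi).
Proof.
move=> Lp; have [ae1 L _ _] := path_fubini mX Lp (fun t => Lall_L1 (LX t)) XM.
by split=> //; exact: L1_meas L.
Qed.

Lemma chebyshev_pow (x m : R) k : 0 <= x -> 0 <= m -> 0 <= (x - m) * (x ^+ k - m ^+ k).
Proof.
move=> x0 m0; have [xm|/ltW xm] := leP m x.
  by rewrite mulr_ge0// subr_ge0// lerXn2r.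
by rewrite mulr_le0// subr_le0// lerXn2r.
Qed.

(** Lyapunov's inequality for the weight [p]: with [m] the weighted mean of [|X|], Chebyshev's
    correlation inequality gives [m * a k <= a k.+1], hence [m ^+ n * a0 <= a n], and [a n] is
    integrable by stationarity. *)
Lemma Lall_Yf (phi : R -> R) : L1 leb phi -> Lall P (Yf phi).
Proof.
move=> Lp; have [ae1 mY] := Yf_path Lp; split=> // n.
have LG : L1 leb (@gauss_fun R) by exact: integrableT_gauss.
(* The Gaussian is added so that the total mass [a0] is positive even if [phi] is 0. *)
pose p t := `|phi t| + gauss_fun t.
have p0 t : 0 <= p t by rewrite addr_ge0// gauss_fun_ge0.
have Lpp : L1 leb p by apply: L1D => //; exact: L1_abs.
pose a0 := Int leb p.
have a0p : 0 < a0.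
  apply: (@lt_le_trans _ _ (Num.sqrt pi)); first by rewrite sqrtr_gt0 pi_gt0.
  have -> : Num.sqrt pi = Int leb (@gauss_fun R) by rewrite /Rintegral integralT_gauss.
  by apply: Int_le => // t; rewrite /p lerDr.
have pf k := @path_fubini R _ Omega P (fun t w => `|X t w| ^+ k) p (M k).
have {}pf k : {ae P, forall w, L1 leb (fun t => p t * `|X t w| ^+ k)} /\
    L1 P (fun w => Int leb (fun t => p t * `|X t w| ^+ k)).
  have [] := pf k => //.
  - by mfun.
  - by move=> t; exact: (LX t).2.
  - move=> t; rewrite le_eqVlt; apply/orP; left; apply/eqP.
    rewrite /M -(process_moment Lf f0 GX k t); apply: eq_Int => w.
    by rewrite ger0_norm// exprn_ge0.
pose a k w := Int leb (fun t => p t * `|X t w| ^+ k).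
have aeL : {ae P, forall w, forall k, L1 leb (fun t => p t * `|X t w| ^+ k)}.
  by apply: ae_foralln => k; exact: (pf k).1.
apply: (@L1_le_ae _ _ _ P (fun w => a0 ^+ n / a0 * a n w)).
- by mfun.
- apply: filterS aeL => w Lw.
  have mp : measurable_fun setT p by exact: L1_meas Lpp.
  have Yw : `|Yf phi w| <= a 1%N w.
    apply: (le_trans (@Int_abs_le _ _ _ leb (fun t => phi t * X t w)
      (fun t => p t * `|X t w| ^+ 1) _ (Lw 1%N) _)) => //.
    - apply: measurable_funM; first exact: L1_meas Lp.
      exact: (measurableT_comp mX (measurable_pair2 w)).
    - by move=> t; rewrite normrM expr1 ler_wpM2r// /p lerDl gauss_fun_ge0.
  have a10 : 0 <= a 1%N w by apply: Int_ge0 => t; rewrite mulr_ge0// exprn_ge0.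
  pose m := a 1%N w / a0.
  have m0 : 0 <= m by rewrite divr_ge0// ltW.
  have am : a 1%N w = m * a0 by rewrite /m divfK// gt_eqF.
  (* Subtracting [m ^+ k] is free because the weighted integral of [|X| - m] is 0. *)
  have step k : m * a k w <= a k.+1 w.
    rewrite -subr_ge0.
    have -> : a k.+1 w - m * a k w = Int leb (fun t => p t * ((`|X t w| - m) * (`|X t w| ^+ k - m ^+ k))).
      have -> : (fun t => p t * ((`|X t w| - m) * (`|X t w| ^+ k - m ^+ k))) =
         (fun t => (p t * `|X t w| ^+ k.+1 - m * (p t * `|X t w| ^+ k)) -
            (m ^+ k * (p t * `|X t w| ^+ 1) - m ^+ k.+1 * p t)).
        by apply/funext => t; rewrite !exprS expr0; ring.
      rewrite IntB; [|by apply: L1B => //; exact: L1Z|by apply: L1B; exact: L1Z].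
      rewrite IntB; [|exact: Lw|exact: L1Z].
      rewrite IntB; [|exact: L1Z|exact: L1Z].
      rewrite !IntZ// -/(a k.+1 w) -/(a k w) -/(a 1%N w) -/a0 am exprS; ring.
    by apply: Int_ge0 => t; rewrite mulr_ge0// chebyshev_pow.
  have lyap k : m ^+ k * a0 <= a k w.
    elim: k => [|k IH].
      rewrite expr0 mul1r /a0 /a le_eqVlt; apply/orP; left; apply/eqP.
      by apply: eq_Int => t; rewrite expr0 mulr1.
    rewrite exprS -mulrA; apply: le_trans (step k); exact: ler_wpM2l.
  rewrite ger0_norm ?exprn_ge0//.
  apply: (@le_trans _ _ ((m * a0) ^+ n)).
    by rewrite -am; apply: lerXn2r => //; rewrite nnegrE.
  rewrite exprMn mulrC -mulrA ler_wpM2l ?exprn_ge0 ?(ltW a0p)//.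
  by rewrite mulrC ler_pdivlMr.
- by apply: L1Z; exact: (pf n).2.
Qed.

Let W N t w := X t w - gridsum N (X ^~ w) t.

Let mW N : measurable_fun setT (fun q : R * Omega => W N q.1 q.2).
Proof.
apply: measurable_funB => //; rewrite /gridsum; apply: measurable_sum => i.
apply: measurable_funM.
  apply: (measurableT_comp _ measurable_fst).
  by apply: measurable_indic; exact: measurable_itv.
exact: (measurableT_comp (Lall_meas (LX _)) measurable_snd).
Qed.

Let W_case N t : (exists2 v, `|t - v| <= N.+1%:R^-1 & forall w, W N t w = X t w - X v w) \/
  (N.+1%:R <= `|t| /\ forall w, W N t w = X t w).
Proof.
have [[v tv H]|[tn H]] := gridsumP N t.
  by left; exists v => // w; rewrite /W H.
by right; split=> // w; rewrite /W H subr0.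
Qed.

Let LW N t : L1 P (W N t).
Proof.
have [[v _ /funext ->]|[_ /funext ->]] := W_case N t; last exact: Lall_L1.
by apply: L1B; exact: Lall_L1.
Qed.

Let D N t := Int P (fun w => `|W N t w|).

Let D_le N t : D N t <= 2 * M 1.
Proof.
have M0 : 0 <= M 1 by apply: Int_ge0 => w; rewrite exprn_ge0.
have [[v _ H]|[_ H]] := W_case N t.
  apply: (@le_trans _ _ (Int P (fun w => `|X t w| + `|X v w|))).
    apply: Int_le; [exact/L1_abs/LW|by apply: L1D; exact/L1_abs/Lall_L1|].
    by move=> w; rewrite H ler_normB.
  by rewrite IntD ?mulr_natl ?mulr2n ?lerD//; exact/L1_abs/Lall_L1.
apply: (@le_trans _ _ (M 1)); last by lra.
by apply: le_trans (XM t); rewrite /D; under eq_Int do rewrite H.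
Qed.

Let D_cvg t : D N t @[N --> \oo] --> 0.
Proof.
have ms : Int P (fun w => (X s w - X t w) ^+ 2) @[s --> t] --> 0.
  have H := msc t; have := @fine_cvg R R (nbhs t) _ (fun s => (\int[P]_w ((X s w - X t w) ^+ 2)%:E)%E) 0 H.
  exact.
apply/cvgrPdist_le => /= e e0.
have e4 : 0 < e ^+ 2 / 4 by rewrite divr_gt0// exprn_gt0.
have /cvgrPdist_le/(_ _ e4) := ms; move=> /nbhs_ballP[r /= r0 H].
near=> N; rewrite sub0r normrN ger0_norm; last exact: Int_ge0.
have [[v tv E]|[tn _]] := W_case N t.
  have tvr : ball t r v.
    rewrite /ball/= (le_lt_trans tv)// invf_plt ?posrE ?ltr0n//.
    near: N; exists (Num.truncn r^-1) => // i /= hi.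
    by rewrite (lt_le_trans (truncnS_gt _))// ler_nat.
  have := H v tvr; rewrite sub0r normrN ger0_norm => [Hv|]; last first.
    by apply: Int_ge0 => w; rewrite sqr_ge0.
  have L2 : L1 P (fun w => (X v w - X t w) ^+ 2).
    apply: Lall_L1; apply: LallX; apply: LallD => //.
    rewrite (_ : (fun w => - X t w) = (fun w => -1 * X t w)); first exact: LallZ.
    by apply/funext => w; rewrite mulN1r.
  (* Mean-square convergence yields convergence in mean through [y <= e / 2 + 2 / e * y ^+ 2]. *)
  have -> : e = e / 2 + 2 / e * (e ^+ 2 / 4) by field; lra.
  apply: (@le_trans _ _ (Int P (fun w => e / 2 + 2 / e * (X v w - X t w) ^+ 2))).
    apply: Int_le; [exact/L1_abs/LW|by apply: L1D; [exact: L1_cst|exact: L1Z]|move=> w].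
    rewrite E -sqrrN opprB -real_normK ?num_real//.
    move: `|X t w - X v w| (normr_ge0 (X t w - X v w)) => y y0.
    rewrite -subr_ge0 (_ : _ - y = 2 / e * (y - e / 2) ^+ 2 + y); last by field; lra.
    by rewrite addr_ge0// mulr_ge0 ?sqr_ge0// divr_ge0// ltW.
  rewrite IntD; [|exact: L1_cst|exact: L1Z].
  by rewrite Int_cst IntZ// lerD2l ler_wpM2l// divr_ge0// ltW.
exfalso; move: tn; apply/negP; rewrite -ltNge.
near: N; exists (Num.truncn `|t|) => // i /= hi.
by rewrite (lt_le_trans (truncnS_gt _))// ler_nat.
Unshelve. all: by end_near. Qed.

Lemma cos_lip (x y : R) : `|cos x - cos y| <= `|x - y|.
Proof.
have := cos_taylor 1 y (x - y).
by rewrite subrK big_ord1 /= expr0 fact0 !divr1 mul1r mul0r addr0 expr1.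
Qed.

(* Riemann sums of [X] are Gaussian with an explicit variance, and they converge in
   mean to the integral by mean-square continuity. *)
Lemma Yf_char (phi : R -> R) th : L1 leb phi ->
  Int P (fun w => cos (Yf phi w + th)) =
  cos th * expR (- (2^-1 * Int leb (fun l => FT_abs2 phi l * f l))).
Proof.
move=> Lp; have mp := L1_meas Lp.
(* The weights are integrals of [phi] over the cells, not point values, since [phi] is only
   integrable; the sums are then integrals of [phi] against step functions ([cE]). *)
pose c N (i : 'I_((N.+1 * N.+1).*2)) := Int leb (fun t => \1_(gridcell N i) t * phi t).
have mcell N i : measurable_fun setT (\1_(gridcell N i) : R -> R).
  by apply: measurable_indic; exact: measurable_itv.
have Lcell N i : L1 leb (fun t => \1_(gridcell N i) t * phi t).
  apply: (@L1Mb _ _ R leb 1) => [//||t]; first exact: mcell.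
  by rewrite indicE; case: (_ \in _); rewrite /= ?normr1 ?normr0.
have cE N (a : R -> R) : \sum_i c N i * a (gridpt N i) = Int leb (fun t => phi t * gridsum N a t) /\
    L1 leb (fun t => phi t * gridsum N a t).
  have -> : (fun t => phi t * gridsum N a t) = (fun t => \sum_(i < (N.+1 * N.+1).*2)
      a (gridpt N i) * (\1_(gridcell N i) t * phi t)).
    by apply/funext => t; rewrite /gridsum mulr_sumr; apply: eq_bigr => i _; ring.
  split; last by apply: L1_sum => i _; exact: L1Z.
  rewrite Int_sum => [|i _]; last exact: L1Z.
  by apply: eq_bigr => i _; rewrite IntZ// mulrC.
pose YN N w := \sum_i c N i * X (gridpt N i) w.
have [ae1 mY] := Yf_path Lp.
have YNchar N := process_lin Lf f0 GX (fun i => gridpt N i) (c N).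
have DW N t : Int P (fun w => `| `|W N t w| |) <= 2 * M 1.
  by rewrite (_ : Int P _ = D N t) ?D_le//; apply: eq_Int => w; rewrite normr_id.
have close : Int P (fun w => cos (YN N w + th)) @[N --> \oo] --> Int P (fun w => cos (Yf phi w + th)).
  have LD : Int leb (fun t => `|phi t| * D N t) @[N --> \oo] --> Int leb (fun=> 0).
    have [] := @Int_cvg _ _ R leb (fun N t => `|phi t| * D N t) (fun=> 0)
      (fun t => 2 * M 1 * `|phi t|) => //.
    - move=> N.
      have [_ _ L _] := @path_fubini R _ Omega P (fun t w => `|W N t w|) (fun t => `|phi t|) (2 * M 1)
        (measurableT_comp measurable_normR (mW N)) (L1_abs Lp)
        (fun t => L1_abs (LW N t)) (DW N).
      exact: L1_meas L.
    - exact/L1Z/L1_abs.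
    - move=> N t; rewrite normrM normr_id mulrC ler_wpM2r// ger0_norm//.
      exact: Int_ge0.
    - move=> t; rewrite -(mulr0 `|phi t|); apply: cvgM; [exact: cvg_cst|exact: D_cvg].
  rewrite Int0 in LD.
  apply/cvgrPdist_le => /= e e0; move/cvgrPdist_le : LD => /(_ _ e0).
  apply: filterS => N; rewrite sub0r normrN => /(le_trans (ler_norm _)).
  apply: le_trans.
  have [ae2 L2 _ E2] := @path_fubini R _ Omega P (fun t w => `|W N t w|) (fun t => `|phi t|) (2 * M 1)
    (measurableT_comp measurable_normR (mW N)) (L1_abs Lp)
    (fun t => L1_abs (LW N t)) (DW N).
  have mYN : measurable_fun setT (YN N) by exact: Lall_meas (YNchar N).1.
  rewrite -[X in _ <= X]/(Int leb (fun t => `|phi t| * Int P (fun w => `|W N t w|))) -E2.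
  rewrite -IntB; last 2 first.
  - by apply: (@L1_bdd _ _ _ _ 1) => [|w]; [mfun|exact: cos_max].
  - by apply: (@L1_bdd _ _ _ _ 1) => [|w]; [mfun|exact: cos_max].
  apply: Int_abs_le_ae => //; first by mfun.
  apply: filterS2 ae1 ae2 => w h1 h2.
  apply: (le_trans (cos_lip _ _)).
  have [EN LN] := cE N (X ^~ w).
  rewrite opprD addrACA subrr addr0 /YN EN /Yf -IntB//.
  apply: Int_abs_le => //; first by apply: (@L1_meas _ _ _ leb); exact: L1B.
  by move=> t; rewrite -mulrBr normrM.
(* For each [l] the weighted sums of cosines and sines converge to the Fourier transform, and they
   are bounded by the norm of [phi], so a multiple of [f] dominates. *)
have vcvg : Int leb (fun l => ((\sum_i c N i * cos (l * gridpt N i)) ^+ 2 +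
     (\sum_i c N i * sin (l * gridpt N i)) ^+ 2) * f l) @[N --> \oo] -->
   Int leb (fun l => FT_abs2 phi l * f l).
  have bd N (a : R -> R) : (forall x, `|a x| <= 1) -> `|\sum_i c N i * a (gridpt N i)| <= Int leb (fun t => `|phi t|).
    move=> a1; have [-> L] := cE N a; apply: Int_abs_le; [exact: L1_meas L|exact: L1_abs|move=> t].
    rewrite normrM ler_piMr//.
    by have [[v _ ->]|[_ ->]] := gridsumP N t; rewrite ?normr0.
  have cv (a : R -> R) : continuous a -> (forall x, `|a x| <= 1) ->
      \sum_i c N i * a (gridpt N i) @[N --> \oo] --> Int leb (fun t => phi t * a t).
    move=> ca a1; under eq_fun => N do rewrite (cE N a).1.
    have [] := @Int_cvg _ _ R leb (fun N t => phi t * gridsum N a t) (fun t => phi t * a t) (fun t => `|phi t|) => //.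
    - by move=> N; exact: L1_meas (cE N a).2.
    - exact: L1_abs.
    - move=> N t; rewrite normrM ler_piMr//.
      by have [[v _ ->]|[_ ->]] := gridsumP N t; rewrite ?normr0.
    - by move=> t; apply: cvgM; [exact: cvg_cst|by apply: gridsum_cvg; exact: ca].
  pose B := Int leb (fun t => `|phi t|).
  have ml : measurable_fun setT f by exact: L1_meas Lf.
  have [] := @Int_cvg _ _ R leb (fun N l => ((\sum_i c N i * cos (l * gridpt N i)) ^+ 2 +
     (\sum_i c N i * sin (l * gridpt N i)) ^+ 2) * f l)
     (fun l => FT_abs2 phi l * f l) (fun l => (B ^+ 2 + B ^+ 2) * f l) => //.
  - by move=> N; mfun.
  - exact: L1Z.
  - move=> N l; rewrite normrM (ger0_norm (f0 l)) ler_wpM2r//.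
    rewrite ger0_norm; last by rewrite addr_ge0// sqr_ge0.
    apply: lerD; rewrite -real_normK ?num_real//; apply: lerXn2r; rewrite ?nnegrE//.
    + exact: Int_ge0.
    + by apply: (bd N (fun v => cos (l * v))) => x; exact: cos_max.
    + exact: Int_ge0.
    + by apply: (bd N (fun v => sin (l * v))) => x; exact: sin_max.
  - move=> l; apply: cvgM; last exact: cvg_cst.
    have cl : continuous (fun v : R => l * v).
      by move=> v; apply: cvgM; [exact: cvg_cst|exact: cvg_id].
    have ccos : continuous (fun v : R => cos (l * v)).
      by move=> v; apply: (continuous_comp (g := cos)); [exact: cl|exact: continuous_cos].
    have csin : continuous (fun v : R => sin (l * v)).
      by move=> v; apply: (continuous_comp (g := sin)); [exact: cl|exact: continuous_sin].
    have c1 := cv _ ccos (fun v => cos_max _).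
    have s1 := cv _ csin (fun v => sin_max _).
    rewrite /FT_abs2 /FT_re /FT_im sqrrN.
    under [X in X ^+ 2 + _]eq_Int do rewrite mulrC.
    under [X in _ + X ^+ 2]eq_Int do rewrite mulrC.
    by apply: cvgD; rewrite expr2; under eq_fun do rewrite expr2; apply: cvgM.
have lim2 : Int P (fun w => cos (YN N w + th)) @[N --> \oo] -->
    cos th * expR (- (2^-1 * Int leb (fun l => FT_abs2 phi l * f l))).
  under eq_fun => N do rewrite (YNchar N).2 cov_quad//.
  apply: cvgM; first exact: cvg_cst.
  apply: (cvg_comp (fun N => - (2^-1 * _)) expR); last exact: continuous_expR.
  by apply: cvgN; apply: cvgM; [exact: cvg_cst|exact: vcvg].
exact: (cvg_unique _ close lim2).
Qed.

(** A combination of path integrals is almost surely the path integral of the combination, so the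
    joint law follows from [Yf_char]. The factors [s] will carry the normalisation of the wavelet
    coefficients. *)
Lemma gauss_vec_Yf n (phi : 'I_n -> R -> R) (s : 'I_n -> R) : (forall i, L1 leb (phi i)) ->
  gauss_vec P (fun i w => s i * Yf (phi i) w)
   (\matrix_(i, j) (s i * s j * Int leb (fun l =>
      (FT_re (phi i) l * FT_re (phi j) l + FT_im (phi i) l * FT_im (phi j) l) * f l))).
Proof.
move=> Lp; split.
- by move=> i; apply: LallZ; exact: Lall_Yf.
- move=> i j; rewrite !mxE (mulrC (s i)); congr (_ * _); apply: eq_Int => l; congr ((_ + _) * _); exact: mulrC.
move=> c th; pose Phi t := \sum_i c i * s i * phi i t.
have LPhi : L1 leb Phi by apply: L1_sum => i _; exact: L1Z.
have mphi i : measurable_fun setT (Yf (phi i)) by exact: (Yf_path (Lp i)).2.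
have mPhi : measurable_fun setT (Yf Phi) by exact: (Yf_path LPhi).2.
transitivity (Int P (fun w => cos (Yf Phi w + th))).
  apply: eq_Int_ae; [|by mfun|by mfun].
  have : {ae P, forall w, forall i : 'I_n, L1 leb (fun t => phi i t * X t w)}.
    suff : {ae P, forall w, forall k : nat, forall hk : (k < n)%N, L1 leb (fun t => phi (Ordinal hk) t * X t w)}.
      apply: filterS => w H i; have := H i (ltn_ord i).
      by rewrite (_ : Ordinal _ = i)//; exact/val_inj.
    apply: ae_foralln => k; case: (pselect (k < n)%N) => kn.
      have := (Yf_path (Lp (Ordinal kn))).1; apply: filterS => w H hk.
      by rewrite (_ : Ordinal hk = Ordinal kn)//; exact/val_inj.
    by apply: aeW => w hk; case: (kn hk).
  apply: filterS => w Lw; congr (cos (_ + _)).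
  have -> : Yf Phi w = Int leb (fun t => \sum_i (c i * s i) * (phi i t * X t w)).
    by apply: eq_Int => t; rewrite /Phi mulr_suml; apply: eq_bigr => i _; rewrite mulrA.
  rewrite Int_sum => [|i _]; last exact: L1Z.
  by apply: eq_bigr => i _; rewrite IntZ// mulrA.
rewrite Yf_char//; congr (_ * expR (- (_ * _))).
have Lc i l := (L1_trig l (Lp i)).1.
have Ls i l := (L1_trig l (Lp i)).2.
have reE l : FT_re Phi l = \sum_i c i * s i * FT_re (phi i) l.
  rewrite /FT_re; under eq_Int => t do rewrite mulr_sumr.
  under eq_Int => t do under eq_bigr => i _ do rewrite mulrCA.
  rewrite Int_sum => [|i _]; last exact: L1Z.
  by apply: eq_bigr => i _; rewrite IntZ.
have imE l : FT_im Phi l = \sum_i c i * s i * FT_im (phi i) l.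
  rewrite /FT_im; under eq_Int => t do rewrite mulr_sumr.
  under eq_Int => t do under eq_bigr => i _ do rewrite mulrCA.
  rewrite Int_sum => [|i _]; last exact: L1Z.
  by rewrite -sumrN; apply: eq_bigr => i _; rewrite IntZ// mulrN.
have LL i j : L1 leb (fun l => (FT_re (phi i) l * FT_re (phi j) l + FT_im (phi i) l * FT_im (phi j) l) * f l).
  pose B i := Int leb (fun t => `|phi i t|).
  have mre i' : measurable_fun setT (FT_re (phi i')).
    exact: continuous_measurable_fun (FT_re_continuous (Lp i')).
  have mim i' : measurable_fun setT (FT_im (phi i')).
    exact: continuous_measurable_fun (FT_im_continuous (Lp i')).
  apply: (@L1Mb _ _ R leb (B i * B j + B i * B j)) => //; first by mfun.
  move=> l; have [h1 h2] := FT_bounds l (Lp i); have [h3 h4] := FT_bounds l (Lp j).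
  by rewrite (le_trans (ler_normD _ _))// lerD// normrM ler_pM.
transitivity (Int leb (fun l => \sum_i \sum_j c i * c j * (s i * s j) *
  ((FT_re (phi i) l * FT_re (phi j) l + FT_im (phi i) l * FT_im (phi j) l) * f l))).
  apply: eq_Int => l; rewrite /FT_abs2 reE imE !expr2 !mulr_suml -big_split/= mulr_suml.
  apply: eq_bigr => i _; rewrite !mulr_sumr -big_split/= mulr_suml.
  by apply: eq_bigr => j _; ring.
rewrite Int_sum => [|i _]; last by apply: L1_sum => j _; exact: L1Z.
apply: eq_bigr => i _; rewrite Int_sum => [|j _]; last exact: L1Z.
apply: eq_bigr => j _; rewrite IntZ; last exact: LL.
by rewrite mxE; ring.
Qed.

End functional.

(** * The spectral density *)

Section spectral.
Context {R : realType}.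
Notation leb := (@lebesgue_measure R).

Lemma powR_ler (a b p : R) : 0 < a -> a <= b -> 0 <= p -> b `^ (- p) <= a `^ (- p).
Proof.
move=> a0 ab p0; have b0 : 0 < b by exact: lt_le_trans ab.
rewrite /powR !gt_eqF// ler_expR !mulNr lerN2 ler_wpM2l// ler_ln//.
Qed.

(** Monotone limit of the integrals over [[T / (n + 2), T]], bounded by the value of the primitive
    at [T]; [n.+2] keeps the lower end below [T]. *)
Lemma L1_powR_at0 (q T : R) : 0 < q < 1 -> 0 < T ->
  L1 leb (fun u => \1_(`]0, T]%classic) u * u `^ (- q)).
Proof.
move=> /andP[q0 q1] T0.
pose g u := \1_(`]0, T]%classic) u * u `^ (- q) : R.
have mg : measurable_fun setT g.
  apply: measurable_funM; last exact: measurable_powR.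
  by apply: measurable_indic; exact: measurable_itv.
pose gn n u := \1_(`[T / n.+2%:R, T]%classic) u * u `^ (- q) : R.
have mgn n : measurable_fun setT (gn n).
  apply: measurable_funM; last exact: measurable_powR.
  by apply: measurable_indic; exact: measurable_itv.
have g0 u : 0 <= g u by rewrite mulr_ge0 ?powR_ge0// indicE.
have gn0 n u : 0 <= gn n u by rewrite mulr_ge0 ?powR_ge0// indicE.
pose F u := (1 - q)^-1 * u `^ (1 - q) : R.
have q10 : 0 < 1 - q by lra.
have dF (u : R) : 0 < u -> is_derive u 1 F (u `^ (- q)).
  move=> u0; have H := is_deriveZ (1 - q)^-1 (@is_derive1_powR R (1 - q) u u0).
  apply: (is_derive_eq H); rewrite /GRing.scale/= mulrA mulVf ?mul1r ?gt_eqF//.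
  by congr (_ `^ _); ring.
have cF (u : R) : 0 < u -> {for u, continuous F}.
  move=> u0; apply: differentiable_continuous; apply/derivable1_diffP.
  by have := dF u u0 => /@ex_derive.
have cq (u : R) : 0 < u -> {for u, continuous (fun u : R => u `^ (- q))}.
  move=> u0; apply: differentiable_continuous; apply/derivable1_diffP.
  by have := @is_derive1_powR R (- q) u u0 => /@ex_derive.
have F0 u : 0 <= F u by rewrite mulr_ge0 ?powR_ge0// invr_ge0 ltW.
apply: (@L1_ge0P _ _ R leb g mg g0).
have gnE n : (\int[leb]_u (gn n u)%:E <= (F T)%:E)%E.
  have a0 : 0 < T / n.+2%:R by rewrite divr_gt0.
  have -> : (\int[leb]_u (gn n u)%:E = \int[leb]_(u in `[(T / n.+2%:R)%R, T]) (u `^ (- q))%:E)%E.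
    rewrite [RHS]integral_mkcond; apply: eq_integral => u _ /=.
    by rewrite patchE /gn indicE; case: (_ \in _); rewrite ?mul1r ?mul0r.
  have aT : T / n.+2%:R < T by rewrite ltr_pdivrMr// ltr_pMr// ltr1n.
  rewrite (@continuous_FTC2 _ _ F)//.
  - by rewrite -EFinD lee_fin lerBlDr lerDl.
  - apply: continuous_in_subspaceT => u; rewrite inE /= in_itv/= => /andP[au _].
    by apply: cq; exact: lt_le_trans au.
  - split.
    + move=> u; rewrite in_itv/= => /andP[au _].
      by have := dF u (lt_trans a0 au) => /@ex_derive.
    + exact/cvg_at_right_filter/cF.
    + exact/cvg_at_left_filter/cF.
  - move=> u; rewrite in_itv/= => /andP[au _]; rewrite derive1E.
    by have := dF u (lt_trans a0 au) => /@derive_val.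
have -> : (\int[leb]_u (g u)%:E = \int[leb]_u (limn (fun n => (gn n u)%:E)))%E.
  apply: eq_integral => u _; apply/esym/cvg_lim => //.
  apply: cvg_near_cst; near=> n; rewrite /gn /g !indicE; congr ((_)%:R * _)%:E.
  have [/andP[u0 uT]|] := boolP (0 < u <= T); last first.
    move=> H; have Hn : ~ `[T / n.+2%:R, T]%classic u.
      rewrite /= in_itv/=; apply/negP; apply: contra H => /andP[h1 ->].
      by rewrite andbT (lt_le_trans _ h1)// divr_gt0.
    have H0 : ~ `]0, T]%classic u by rewrite /= in_itv/=; exact/negP.
    by rewrite (memNset Hn) (memNset H0).
  rewrite !mem_set//= in_itv/= ?u0 ?uT// andbT ler_pdivrMr// -ler_pdivrMl//.
  near: n; exists (Num.truncn (u^-1 * T)) => // i /= hi.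
  by rewrite (le_trans (ltW (truncnS_gt _)))// ler_nat ltnS (leq_trans hi).
have cv : (\int[leb]_u (gn n u)%:E @[n --> \oo] --> \int[leb]_u (limn (fun n => (gn n u)%:E)))%E.
  apply: cvg_monotone_convergence => //.
  - by move=> n; apply/measurable_EFinP; exact: mgn.
  - by move=> n u _; rewrite lee_fin.
  - move=> u _ a b ab; rewrite lee_fin /gn ler_wpM2r ?powR_ge0//.
    rewrite !indicE ler_nat leq_eqVlt; apply/orP.
    have [h|h] := boolP (u \in `[T / a.+2%:R, T]%classic); last first.
      by case: (u \in _); [right|left].
    left; rewrite mem_set//; move: h; rewrite inE /= !in_itv/= => /andP[h ->].
    rewrite andbT (le_trans _ h)// ler_pM2l// lef_pV2 ?posrE ?ltr0n// ler_nat.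
    by rewrite !ltnS.
apply: le_lt_trans (ltry (F T)).
rewrite -(cvg_lim _ cv)//; apply: lime_le.
  by apply/cvg_ex; eexists; exact: cv.
exact: nearW.
Unshelve. all: by end_near. Qed.

Lemma L1_powR_abs (q T b : R) : 0 < q < 1 -> 0 < T ->
  L1 leb (fun u => \1_(`[- T, T]%classic) (u + b) * `|u + b| `^ (- q)).
Proof.
move=> q01 T0; have L0 := L1_powR_at0 q01 T0.
have q0 : - q != 0 by lra.
have L : L1 leb (fun u => \1_(`[- T, T]%classic) u * `|u| `^ (- q)).
  have E : (fun u => \1_(`[- T, T]%classic) u * `|u| `^ (- q)) =
    (fun u => \1_(`]0, T]%classic) u * u `^ (- q) + \1_(`]0, T]%classic) (- u) * (- u) `^ (- q)) :> (R -> R).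
    apply/funext => u.
    have [u0|u0|->] := ltrgtP u 0.
    - have -> : \1_(`]0, T]%classic) u = 0 :> R.
        by rewrite indicE memNset//= in_itv/= => /andP[]; rewrite ltNge (ltW u0).
      rewrite mul0r add0r (ltr0_norm u0) !indicE; congr ((nat_of_bool _)%:R * _).
      by apply/idP/idP; rewrite !inE /= !in_itv/= => /andP[? ?]; apply/andP; split; lra.
    - have -> : \1_(`]0, T]%classic) (- u) = 0 :> R.
        by rewrite indicE memNset//= in_itv/= => /andP[]; rewrite oppr_gt0 ltNge (ltW u0).
      rewrite mul0r addr0 (gtr0_norm u0) !indicE; congr ((nat_of_bool _)%:R * _).
      by apply/idP/idP; rewrite !inE /= !in_itv/= => /andP[? ?]; apply/andP; split; lra.
    - by rewrite normr0 oppr0 powR0// !mulr0 addr0.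
  by rewrite E; apply: L1D => //; exact: (Int_opp L0).1.
have [H _] := Int_affine b (oner_neq0 R) L.
by move: H; under eq_fun do rewrite mul1r.
Qed.

Variables (h : R -> R) (s0 alpha : R).
Hypotheses (s1 : 1 < s0) (al : 0 < alpha < 2^-1).
Hypotheses (h0 : forall l, 0 <= h l) (hK : exists K, forall l, h l <= K) (hC4 : C4 h)
  (hd : forall i, (1 <= i <= 4)%N -> derive1n i h 0 = 0) (h1 : h 0 = 1)
  (hint : forall eps, 0 < eps ->
     leb.-integrable setT (fun l => (h l * (1 + `|l|) `^ (- eps))%:E)).

Let f := spec_dens h s0 alpha.

Lemma spec_dens_ge0 l : 0 <= f l.
Proof. by rewrite /f /spec_dens divr_ge0// powR_ge0. Qed.

Let h_cont : continuous h.
Proof.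
move=> x; apply: differentiable_continuous; apply/derivable1_diffP.
exact: (hC4.1 0%N).
Qed.

Lemma spec_dens_meas : measurable_fun setT f.
Proof.
rewrite /f /spec_dens (_ : (fun l => _) = (fun l => h l * `|l ^+ 2 - s0 ^+ 2| `^ (- (2 * alpha)))).
  have mh : measurable_fun setT h by exact: continuous_measurable_fun.
  apply: measurable_funM => //.
  by apply: (measurableT_comp (@measurable_powR R (- (2 * alpha)))); mfun.
by apply/funext => l; rewrite powRN.
Qed.

(** For [|l| >= 2 * s0] the denominator is at least a constant times a positive power of [1 + |l|],
    and [hint] applies. Otherwise one of [|l - s0|], [|l + s0|] is at least 1, and the other leaves
    an integrable singularity since [2 * alpha < 1]. *)
Lemma spec_dens_L1 : L1 leb f.
Proof.
have [K HK] := hK; case/andP: al => al0 al2; have s1' : 1 < s0 := s1.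
have q01 : 0 < 2 * alpha < 1 by apply/andP; split; lra.
have K0 : 0 <= K by exact: le_trans (h0 0) (HK 0).
have T0 : 0 < 3 * s0 by rewrite mulr_gt0//; exact: lt_trans s1.
have e0 : 0 < 4 * alpha by lra.
have L1' := hint e0.
have L2 := L1_powR_abs (- s0) q01 T0; have L3 := L1_powR_abs s0 q01 T0.
have p0 : 0 <= 2 * alpha by lra.
apply: (@L1_le _ _ _ leb (fun l => 3 * (h l * (1 + `|l|) `^ (- (4 * alpha))) +
  K * (\1_(`[- (3 * s0), 3 * s0]%classic) (l + - s0) * `|l + - s0| `^ (- (2 * alpha)) +
       \1_(`[- (3 * s0), 3 * s0]%classic) (l + s0) * `|l + s0| `^ (- (2 * alpha))))).
- exact: spec_dens_meas.
- move=> l; rewrite ger0_norm ?spec_dens_ge0// /f /spec_dens -powRN.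
  have [l2|l2] := leP (2 * s0) `|l|.
    apply: (@le_trans _ _ (3 * (h l * (1 + `|l|) `^ (- (4 * alpha))))); last first.
      by rewrite lerDl mulr_ge0// addr_ge0// mulr_ge0 ?powR_ge0// indicE.
    rewrite mulrCA ler_wpM2l//.
    have -> : l ^+ 2 = `|l| ^+ 2 by rewrite real_normK ?num_real.
    move: `|l| l2 => y y2.
    (* From [y >= 2 * s0 > 2]: [y ^+ 2 - s0 ^+ 2 >= 3 / 4 * y ^+ 2] and [1 + y <= 3 / 2 * y]. *)
    have d3 : (1 + y) ^+ 2 / 3 <= `|y ^+ 2 - s0 ^+ 2|.
      have ys : (2 * s0) ^+ 2 <= y ^+ 2 by rewrite lerXn2r ?nnegrE; lra.
      have y1 : (1 + y) ^+ 2 <= (3 / 2 * y) ^+ 2 by rewrite lerXn2r ?nnegrE; lra.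
      have s02 := sqr_ge0 s0.
      move: ys y1; rewrite !exprMn => ys y1.
      by rewrite ger0_norm; lra.
    apply: (le_trans (powR_ler _ d3 p0)); first by rewrite divr_gt0// exprn_gt0; lra.
    rewrite powRM ?sqr_ge0// mulrC.
    have -> : ((1 + y) ^+ 2) `^ (- (2 * alpha)) = (1 + y) `^ (- (4 * alpha)).
      rewrite -powR_mulrn; last by lra.
      by rewrite -powRrM; congr (_ `^ _); ring.
    rewrite ler_wpM2r ?powR_ge0//.
    rewrite /powR gt_eqF// lnV ?posrE// mulrNN.
    have -> : 3 = expR (ln 3) :> R by rewrite lnK ?posrE.
    rewrite ler_expR expRK; have := @ln_ge0 R 3; nra.
  apply: (@le_trans _ _ (K * (\1_(`[- (3 * s0), 3 * s0]%classic) (l + - s0) * `|l + - s0| `^ (- (2 * alpha)) +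
       \1_(`[- (3 * s0), 3 * s0]%classic) (l + s0) * `|l + s0| `^ (- (2 * alpha))))); last first.
    by rewrite lerDr mulr_ge0// mulr_ge0 ?powR_ge0.
  apply: ler_pM => //.
  move: l2; rewrite ltr_norml => /andP[la lb].
  rewrite !indicE !mem_set ?mul1r/= ?in_itv/=; [|by apply/andP; split; lra|by apply/andP; split; lra].
  have -> : l ^+ 2 - s0 ^+ 2 = (l + - s0) * (l + s0) by ring.
  rewrite normrM powRM//.
  have P1 (x : R) : 1 <= `|x| -> `|x| `^ (- (2 * alpha)) <= 1.
    by move=> x1; apply: le_trans (powR_ler ltr01 x1 p0) _; rewrite powR1.
  have [l0|l0] := leP 0 l.
    apply: (@le_trans _ _ (`|l + - s0| `^ (- (2 * alpha)))).
      by rewrite ler_piMr ?powR_ge0// P1// ger0_norm; lra.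
    by rewrite lerDl powR_ge0.
  apply: (@le_trans _ _ (`|l + s0| `^ (- (2 * alpha)))).
    by rewrite ler_piMl ?powR_ge0// P1// ltr0_norm; lra.
  by rewrite lerDr powR_ge0.
- by apply: L1D; apply: L1Z => //; exact: L1D.
Qed.

(** By the mean value theorem each step gains a power of [|x|] with the same [K]. *)
Lemma taylor_step (g : R -> R) (K : R) (n : nat) : (forall x, derivable g x 1) -> g 0 = 0 ->
  (forall x : R, `|x| <= 1 -> `|derive1 g x| <= K * `|x| ^+ n) ->
  forall x : R, `|x| <= 1 -> `|g x| <= K * `|x| ^+ n.+1.
Proof.
move=> dg g0 Hg x x1.
have dg' (y : R) : is_derive y 1 g (derive1 g y) by rewrite derive1E; exact: derivableP.
have cg a b : {within `[a, b], continuous g} by apply: derivable_within_continuous.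
have key y : `|y| <= `|x| -> `|derive1 g y * x| <= K * `|x| ^+ n.+1.
  move=> yx; have K0 : 0 <= K.
    by have := Hg 1; rewrite normr1 expr1n mulr1 => /(_ (lexx _)); exact: le_trans.
  rewrite normrM exprSr mulrA ler_wpM2r// (le_trans (Hg y _)) ?(le_trans yx)//.
  by rewrite ler_wpM2l// lerXn2r ?nnegrE.
have [x0|x0] := leP 0 x.
  have [c] := MVT_segment x0 (fun y _ => dg' y) (cg 0 x).
  rewrite in_itv/= => /andP[c0 cx]; rewrite g0 !subr0 => ->; apply: key.
  by rewrite !ger0_norm.
have [c] := MVT_segment (ltW x0) (fun y _ => dg' y) (cg x 0).
rewrite in_itv/= => /andP[c0 cx]; rewrite g0 sub0r => /eqP; rewrite eqr_oppLR => /eqP ->.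
rewrite sub0r mulrN opprK; apply: key.
by rewrite !ler0_norm ?lerN2// ltW.
Qed.

Lemma between_norm (p q z : R) : q <= z -> z <= p -> `|z| <= `|p| + `|q|.
Proof.
move=> qz zp; rewrite ler_norml; have := ler_norm p; have := ler_norm (- q); rewrite normrN.
by have := normr_ge0 p; have := normr_ge0 q => *; apply/andP; split; lra.
Qed.

Lemma h_taylor : exists2 K, 0 <= K & forall x, `|x| <= 1 -> `|h x - 1| <= K * `|x| ^+ 4.
Proof.
have [dh c4] := hC4.
have cw : {within `[-1, 1], continuous (derive1n 4 h)} by exact: continuous_subspaceT.
have N1 : (-1 : R) <= 1 by lra.
have [c1 _ H1] := EVT_max N1 cw; have [c2 _ H2] := EVT_min N1 cw.
pose K := `|derive1n 4 h c1| + `|derive1n 4 h c2|.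
have B4 x : `|x| <= 1 -> `|derive1n 4 h x| <= K * `|x| ^+ 0.
  move=> x1; have xi : x \in `[-1, 1] by rewrite in_itv/= -ler_norml.
  rewrite expr0 mulr1 /K; have := H1 x xi; have := H2 x xi.
  move: (derive1n 4 h c1) (derive1n 4 h c2) (derive1n 4 h x) => p q z.
  exact: between_norm.
have B3 := taylor_step (dh 3 isT) (@hd 3 isT) B4.
have B2 := taylor_step (dh 2 isT) (@hd 2 isT) B3.
have B1 := taylor_step (dh 1 isT) (@hd 1 isT) B2.
exists K; first by rewrite addr_ge0.
have dh0 x : derivable (fun x => h x - 1) x 1.
  by apply: derivableB; [exact: (dh 0%N isT)|exact: derivable_cst].
apply: (taylor_step dh0); first by rewrite h1 subrr.
move=> x x1; have := B1 x x1; congr (`|_| <= _).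
rewrite /= !derive1E deriveB ?derive_cst ?subr0//; exact: (dh 0%N isT).
Qed.

(** With [y = - ln (1 - x)] the power is [expR (p * y)], and [x <= y <= x + 2 x^2]. The constant 7
    rounds up [2 + 2 (3 / 2)^2]. *)
Lemma powR_taylor (p x : R) : 0 < p < 1 -> 0 <= x <= 4^-1 ->
  0 <= (1 - x) `^ (- p) - (1 + p * x) <= 7 * x ^+ 2 /\ (1 - x) `^ (- p) <= 2.
Proof.
move=> /andP[p0 p1] /andP[x0 x4].
have y0 : 0 < 1 - x by lra.
rewrite /powR gt_eqF// mulNr -mulrN; set y := - ln (1 - x).
have yx : x <= y by rewrite /y; have := @le_ln1Dx R (- x); lra.
have yx2 : y <= x + 2 * x ^+ 2.
  rewrite /y -lnV ?posrE// -[(1 - x)^-1](_ : 1 + x / (1 - x) = _); last by field; lra.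
  apply: (@le_trans _ _ (x / (1 - x))).
    by apply: le_ln1Dx; apply: (@lt_le_trans _ _ 0); [lra|rewrite divr_ge0// ltW].
  by rewrite ler_pdivrMr//; nra.
have u0 : 0 <= p * y by rewrite mulr_ge0; lra.
have uy : p * y <= y by rewrite ler_piMl; lra.
have u3 : p * y <= 3 / 8 by nra.
have eu : expR (p * y) <= 1 + p * y + 2 * (p * y) ^+ 2.
  have h2 : 1 - p * y <= expR (- (p * y)) by exact: expR_ge1Dx.
  have h3 := expRxMexpNx_1 (p * y).
  have h4 := expR_gt0 (p * y).
  move: (expR (p * y)) (expR (- (p * y))) h2 h3 h4 => E E' h2 h3 h4.
  have h5 : E * (1 - p * y) <= 1 by rewrite -[leRHS]h3 ler_wpM2l// ltW.
  have h6 : E * (1 - p * y) <= (1 + p * y + 2 * (p * y) ^+ 2) * (1 - p * y) by nra.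
  by move: h6; rewrite ler_pM2r//; lra.
have el : 1 + p * y <= expR (p * y) by exact: expR_ge1Dx.
have yb : y <= 3 / 2 * x by nra.
have sq : (p * y) ^+ 2 <= (3 / 2 * x) ^+ 2 by rewrite lerXn2r ?nnegrE//; nra.
split; last by nra.
have px : p * x <= p * y by rewrite ler_wpM2l// ltW.
have x20 : 0 <= 2 * x ^+ 2 by rewrite mulr_ge0// sqr_ge0.
have py : p * y <= p * x + 2 * x ^+ 2.
  apply: (@le_trans _ _ (p * (x + 2 * x ^+ 2))); first by rewrite ler_wpM2l// ltW.
  by rewrite mulrDr lerD2l ler_piMl// ltW.
have s2 : (3 / 2 * x) ^+ 2 = 9 / 4 * x ^+ 2 by field.
by apply/andP; split; lra.
Qed.

(** Since [h - 1] is of order 4 at 0, the quadratic term comes from the singular factor alone, a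
    power of [1 - x] with [x = l^2 / s0^2]; the radius [1 / 2] keeps [x] below [1 / 4]. *)
Lemma spec_taylor : exists K r, [/\ 0 <= K, 0 < r & forall l, `|l| <= r ->
  `|f l - (s0 `^ (- 4 * alpha) + 2 * alpha * s0 `^ (- 4 * alpha - 2) * l ^+ 2)| <= K * l ^+ 4].
Proof.
have [Kh Kh0 hT] := h_taylor; case/andP: al => al0 al2; have s1' : 1 < s0 := s1.
have s00 : 0 < s0 by lra.
pose A := s0 `^ (- 4 * alpha).
have A0 : 0 <= A by exact: powR_ge0.
have p01 : 0 < 2 * alpha < 1 by apply/andP; split; lra.
exists (A * (2 * Kh + 7)), 2^-1; split.
- by rewrite mulr_ge0//; lra.
- by lra.
move=> l l2.
have E2 : s0 `^ (- 4 * alpha - 2) = A / s0 ^+ 2.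
  by rewrite powRD ?powR_invn ?(ltW s00)//; apply/implyP => _; rewrite gt_eqF.
pose x := l ^+ 2 / s0 ^+ 2.
have l24 : l ^+ 2 <= 4^-1.
  by rewrite -real_normK ?num_real//; have := normr_ge0 l; nra.
have xl : x <= l ^+ 2.
  by rewrite /x ler_pdivrMr ?exprn_gt0// ler_peMr ?sqr_ge0//; nra.
have x0 : 0 <= x by rewrite divr_ge0// sqr_ge0.
have x14 : 0 <= x <= 4^-1 by rewrite x0 (le_trans xl).
have [/andP[T1 T2] T3] := powR_taylor p01 x14.
have fE : f l = A * (h l * (1 - x) `^ (- (2 * alpha))).
  rewrite /f /spec_dens -powRN ler0_norm; last first.
    by rewrite subr_le0; nra.
  have -> : - (l ^+ 2 - s0 ^+ 2) = s0 ^+ 2 * (1 - x) by rewrite /x; field; lra.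
  rewrite powRM ?sqr_ge0//; last by case/andP: x14; lra.
  have -> : (s0 ^+ 2) `^ (- (2 * alpha)) = A.
    rewrite -powR_mulrn ?(ltW s00)// -powRrM; congr (_ `^ _); ring.
  ring.
rewrite fE E2.
have -> : A * (h l * (1 - x) `^ (- (2 * alpha))) - (A + 2 * alpha * (A / s0 ^+ 2) * l ^+ 2) =
   A * ((h l - 1) * (1 - x) `^ (- (2 * alpha)) + ((1 - x) `^ (- (2 * alpha)) - (1 + 2 * alpha * x))).
  by rewrite /x; field; lra.
rewrite normrM (ger0_norm A0) -[leRHS]mulrA ler_wpM2l//.
apply: (le_trans (ler_normD _ _)); rewrite [leRHS]mulrDl; apply: lerD.
  rewrite normrM (ger0_norm (powR_ge0 _ _)).
  have hl : `|h l - 1| <= Kh * `|l| ^+ 4 by apply: hT; apply: le_trans l2 _; lra.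
  have -> : l ^+ 4 = `|l| ^+ 4.
    by rewrite -[4%N]/(2 * 2)%N !exprM real_normK ?num_real.
  rewrite [leRHS](_ : _ = Kh * `|l| ^+ 4 * 2); last by ring.
  by apply: ler_pM => //; exact: powR_ge0.
rewrite ger0_norm//; apply: (le_trans T2); rewrite ler_wpM2l//.
by rewrite -[4%N]/(2 * 2)%N exprM lerXn2r ?nnegrE// sqr_ge0.
Qed.

End spectral.

(** * Toeplitz forms *)

Section toeplitz.
Context {R : realType}.
Notation leb := (@lebesgue_measure R).

(** The sum of products is an iterated integral of the kernel, so no product measure is involved. *)
Lemma sep_ge0 (I : finType) (p q : I -> R -> R) :
  (forall i, L1 leb (p i)) -> (forall i, L1 leb (q i)) ->
  (forall x y, 0 <= \sum_i p i x * q i y) -> 0 <= \sum_i Int leb (p i) * Int leb (q i).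
Proof.
move=> Lp Lq pq.
rewrite [leRHS](_ : _ = Int leb (fun x => Int leb (fun y => \sum_i p i x * q i y))).
  by apply: Int_ge0 => x; apply: Int_ge0.
have E x : Int leb (fun y => \sum_i p i x * q i y) = \sum_i p i x * Int leb (q i).
  by rewrite Int_sum => [|i _]; [apply: eq_bigr => i _; rewrite IntZ|exact: L1Z].
rewrite (@eq_Int _ _ R leb _ _ E) Int_sum => [|i _].
  by apply: eq_bigr => i _; rewrite IntZr.
rewrite (_ : (fun x => _) = (fun x => Int leb (q i) * p i x)); first exact: L1Z.
by apply/funext => x; rewrite mulrC.
Qed.

Definition trig (b : bool) (x : R) : R := if b then cos x else sin x.

Lemma trig_le1 b x : `|trig b x| <= 1.
Proof. by case: b; [exact: cos_max|exact: sin_max]. Qed.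

Lemma measurable_trig b (k : R) : measurable_fun setT (fun x => trig b (k * x)).
Proof. by case: b; rewrite /trig; mfun. Qed.

Lemma L1_trigM b k (g : R -> R) : L1 leb g -> L1 leb (fun x => trig b (k * x) * g x).
Proof. by move=> Lg; apply: (@L1Mb _ _ R leb 1) => [//||x]; [exact: measurable_trig|exact: trig_le1]. Qed.

Variable c : R.

(** The integral runs over the whole line although the frequencies share the period [2 c pi]: these
    are the coefficients of the folded function, as [coef_persum] shows. *)
Definition coef (b : bool) (z : int) (g : R -> R) : R :=
  Int leb (fun x => trig b (z%:~R / c * x) * g x).

(* [toep M g g'] is the integral of [g x * g' y] against the Fejer kernel at
   [(x - y) / c]; for an even [g] it is the squared Frobenius norm, divided by [M], of
   the [M]-th Toeplitz matrix of symbol [g]. *)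
Definition toep (M : nat) (g g' : R -> R) : R :=
  M%:R^-1 * \sum_(p : 'I_M * 'I_M * bool)
    coef p.2 ((p.1.1 : nat)%:Z - (p.1.2 : nat)%:Z) g * coef p.2 ((p.1.1 : nat)%:Z - (p.1.2 : nat)%:Z) g'.

Lemma toepE M g g' : toep M g g' = M%:R^-1 * \sum_(k < M) \sum_(l < M)
  (coef true ((k : nat)%:Z - (l : nat)%:Z) g * coef true ((k : nat)%:Z - (l : nat)%:Z) g' +
   coef false ((k : nat)%:Z - (l : nat)%:Z) g * coef false ((k : nat)%:Z - (l : nat)%:Z) g').
Proof.
pose z (p : 'I_M * 'I_M) := (p.1 : nat)%:Z - (p.2 : nat)%:Z.
congr (_ * _); rewrite pair_bigA/=.
rewrite -(pair_bigA _ (fun (p : 'I_M * 'I_M) (b : bool) => coef b (z p) g * coef b (z p) g')) /=.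
by apply: eq_bigr => p _; rewrite big_bool.
Qed.

Lemma eq_toep M g g' : (forall b z, coef b z g = coef b z g') -> toep M g g = toep M g' g'.
Proof. by move=> E; congr (_ * _); apply: eq_bigr => p _; rewrite !E. Qed.

(** With [t = (x - y) / c], the double sum is the squared modulus of the sum of [exp (i k t)] over
    [k < M]. *)
Lemma dirichlet_ge0 M (x y : R) : 0 <= \sum_(p : 'I_M * 'I_M * bool)
   trig p.2 (((p.1.1 : nat)%:Z - (p.1.2 : nat)%:Z)%:~R / c * x) *
   trig p.2 (((p.1.1 : nat)%:Z - (p.1.2 : nat)%:Z)%:~R / c * y).
Proof.
pose z (k l : 'I_M) : R := ((k : nat)%:Z - (l : nat)%:Z)%:~R / c.
rewrite -(pair_bigA _ (fun (p : 'I_M * 'I_M) (b : bool) => trig b (z p.1 p.2 * x) * trig b (z p.1 p.2 * y))) /=.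
rewrite -(pair_bigA _ (fun k l : 'I_M => \sum_b trig b (z k l * x) * trig b (z k l * y))) /=.
pose t := (x - y) / c.
rewrite [leRHS](_ : _ = (\sum_(k < M) cos (k%:R * t)) ^+ 2 + (\sum_(k < M) sin (k%:R * t)) ^+ 2).
  by rewrite addr_ge0// sqr_ge0.
rewrite !expr2 !big_distrl/= -big_split/=; apply: eq_bigr => k _.
rewrite !big_distrr/= -big_split/=; apply: eq_bigr => l _.
rewrite big_bool /= -cosB -cosB; congr cos; rewrite /z rmorphB/= -!pmulrn /t; ring.
Qed.

(* Nonnegativity of the Fejer kernel, for kernels of finite rank. *)
Lemma toep_kern_ge0 M n (a b : 'I_n -> R -> R) :
  (forall i, L1 leb (a i)) -> (forall i, L1 leb (b i)) ->
  (forall x y, 0 <= \sum_i a i x * b i y) -> 0 <= \sum_i toep M (a i) (b i).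
Proof.
move=> La Lb ab.
rewrite -big_distrr/= mulr_ge0// pair_bigA/=.
pose z (p : 'I_M * 'I_M * bool) : R := ((p.1.1 : nat)%:Z - (p.1.2 : nat)%:Z)%:~R / c.
apply: (@sep_ge0 _ (fun q x => trig q.2.2 (z q.2 * x) * a q.1 x)
  (fun q x => trig q.2.2 (z q.2 * x) * b q.1 x)).
- by move=> q; exact: L1_trigM.
- by move=> q; exact: L1_trigM.
move=> x y.
rewrite -(pair_bigA _ (fun i p => trig p.2 (z p * x) * a i x * (trig p.2 (z p * y) * b i y)))/=.
rewrite [leRHS](_ : _ = (\sum_i a i x * b i y) * (\sum_p trig p.2 (z p * x) * trig p.2 (z p * y))).
  by rewrite mulr_ge0// dirichlet_ge0.
rewrite big_distrl/=; apply: eq_bigr => i _; rewrite big_distrr/=; apply: eq_bigr => p _; ring.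
Qed.

Lemma Int_FTC (F f : R -> R) (x y : R) : x < y -> continuous f ->
  (forall t : R, is_derive t 1 F (f t)) ->
  Int leb (fun t => \1_(`[x, y[%classic) t * f t) = F y - F x.
Proof.
move=> xy cf dF.
have cF : continuous F.
  by move=> t; apply: differentiable_continuous; apply/derivable1_diffP; have := dF t => /@ex_derive.
have cw : {within `[x, y], continuous f} by exact: continuous_subspaceT.
have Li : leb.-integrable `[x, y] (EFin \o f).
  by apply: continuous_compact_integrable => //; exact: segment_compact.
rewrite [LHS](_ : _ = (\int[leb]_(t in `[x, y[) f t)%R); last first.
  rewrite [RHS]Rintegral_mkcond; apply: eq_Int => t.
  by rewrite patchE indicE; case: (_ \in _); rewrite ?mul1r ?mul0r.
rewrite Rintegral_itv_bndo_bndc; last first.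
  apply: integrableS Li => //; apply: subset_itvl; rewrite bnd_simp//.
rewrite /Rintegral (@continuous_FTC2 _ _ F)//.
- split.
  + by move=> t _; have := dF t => /@ex_derive.
  + exact/cvg_at_right_filter/cF.
  + exact/cvg_at_left_filter/cF.
- by move=> t _; rewrite derive1E; have := dF t => /@derive_val.
Qed.

(** Half-open, so that its translates by multiples of [2 T] tile the line exactly. *)
Definition box (T : R) (x : R) : R := \1_(`[- T, T[%classic) x.

Lemma boxE T x : box T x = (- T <= x < T)%R%:R.
Proof.
rewrite /box indicE; congr (nat_of_bool _)%:R.
by apply/idP/idP; rewrite inE /= in_itv.
Qed.

Lemma box_ge0 T x : 0 <= box T x. Proof. by rewrite boxE. Qed.

Lemma L1_box T : L1 leb (box T).
Proof. exact: integrable_indic_itv. Qed.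

Lemma sin_intpi (z : int) : sin (z%:~R * pi) = 0 :> R.
Proof.
have H n : sin (n%:R * pi) = 0 :> R.
  elim: n => [|n IH]; first by rewrite mul0r sin0.
  by rewrite -natr1 mulrDl mul1r sinDpi IH oppr0.
case: z => n; first by rewrite -pmulrn.
by rewrite NegzE rmorphN /= mulNr sinN -pmulrn H oppr0.
Qed.

Lemma trig_period b (z : int) (x : R) : trig b (x + z%:~R * (2 * pi)) = trig b x.
Proof.
have H n y : trig b (y + n%:R * (2 * pi)) = trig b y.
  elim: n y => [|n IH] y; first by rewrite mul0r addr0.
  rewrite -natr1 mulrDl mul1r addrA; case: b IH => /= IH.
    by rewrite [X in cos (_ + X)](mulr_natl pi 2) cosD2pi IH.
  by rewrite [X in sin (_ + X)](mulr_natl pi 2) sinD2pi IH.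
case: z => n; first by rewrite -pmulrn.
by rewrite NegzE rmorphN /= mulNr -pmulrn -[in RHS](subrK (n.+1%:R * (2 * pi)) x) H.
Qed.

Hypothesis c0 : 0 < c.

(** The box covers [N] whole periods, over which every nonconstant mode integrates to 0. *)
Lemma coef_box b (z : int) (N : nat) : (0 < N)%N ->
  coef b z (box (N%:R * (c * pi))) = (b && (z == 0))%:R * (2 * (N%:R * (c * pi))).
Proof.
move=> N0; set T := N%:R * (c * pi).
have T0 : 0 < T by rewrite !mulr_gt0 ?ltr0n ?pi_gt0.
have T2 : - T < T by lra.
rewrite /coef (@eq_Int _ _ R leb _ (fun x => \1_(`[- T, T[%classic) x * trig b (z%:~R / c * x))); last first.
  by move=> x; rewrite mulrC.
have [->|z0] := eqVneq z 0.
  rewrite mul0r; case: b => /=; last first.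
    rewrite mul0r -[RHS](Int0 leb); apply: eq_Int => x.
    by rewrite mul0r sin0 mulr0.
  rewrite (@eq_Int _ _ R leb _ (fun x => \1_(`[- T, T[%classic) x * 1)); last first.
    by move=> x; rewrite mul0r cos0.
  rewrite (@Int_FTC id)//; first by ring.
  by move=> t; exact: cst_continuous.
rewrite andbF mul0r.
pose k := z%:~R / c.
have k0 : k != 0 by rewrite mulf_neq0 ?invr_eq0 ?intr_eq0// gt_eqF.
have kT : k * T = (z * N%:Z)%:~R * pi.
  by rewrite /k /T rmorphM /= -[N%:Z%:~R]pmulrn; field; rewrite gt_eqF.
have dk (t : R) : is_derive t 1 (fun t : R => k * t) k.
  have H := is_deriveZ k (is_derive_id t (1 : R)).
  by apply: (is_derive_eq H); rewrite /GRing.scale/= mulr1.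
have ck : continuous (fun t : R => k * t) by move=> t; apply: cvgM; [exact: cvg_cst|exact: cvg_id].
case: b => /=.
  have dF (t : R) : is_derive t 1 (fun t => k^-1 * sin (k * t)) (cos (k * t)).
    have H := is_deriveZ k^-1 (@is_derive1_comp _ sin (fun t => k * t) t _ _ (is_derive_sin (k * t)) (dk t)).
    by apply: (is_derive_eq H); rewrite /GRing.scale/=; field.
  rewrite (Int_FTC T2 _ dF); first by rewrite mulrN sinN kT sin_intpi; ring.
  by move=> t; apply: continuous_comp; [exact: ck|exact: continuous_cos].
have dF (t : R) : is_derive t 1 (fun t => - k^-1 * cos (k * t)) (sin (k * t)).
  have H := is_deriveZ (- k^-1) (@is_derive1_comp _ cos (fun t => k * t) t _ _ (is_derive_cos (k * t)) (dk t)).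
  by apply: (is_derive_eq H); rewrite /GRing.scale/=; field.
rewrite (Int_FTC T2 _ dF); first by rewrite mulrN cosN; ring.
by move=> t; apply: continuous_comp; [exact: ck|exact: continuous_sin].
Qed.

Lemma toep_box M N : (0 < M)%N -> (0 < N)%N ->
  toep M (box (N%:R * (c * pi))) (box (N%:R * (c * pi))) = (2 * (N%:R * (c * pi))) ^+ 2.
Proof.
move=> M0 N0; rewrite toepE.
under eq_bigr => k _ do under eq_bigr => l _ do rewrite !coef_box//.
rewrite (eq_bigr (fun=> (2 * (N%:R * (c * pi))) ^+ 2)) => [|k _].
  by rewrite sumr_const card_ord -[X in _ * X](mulr_natl _ M) mulKf// pnatr_eq0 -lt0n.
rewrite (bigD1 k)//= big1 => [|l lk]; first by rewrite subrr eqxx /=; ring.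
rewrite subr_eq0 [_ == _](_ : _ = false) /=; first by ring.
by apply/negbTE; rewrite eqz_nat eq_sym.
Qed.

(** Only the terms [k = l] survive: the integral of the Fejer kernel over a period in one variable
    is constant in the other. *)
Lemma toep_box_r M g : (0 < M)%N -> L1 leb g ->
  toep M g (box (c * pi)) = 2 * (c * pi) * Int leb g.
Proof.
move=> M0 Lg; rewrite toepE.
have E b z := @coef_box b z 1 isT; rewrite !mul1r in E.
under eq_bigr => k _ do under eq_bigr => l _ do rewrite !E.
have C0 : coef true 0 g = Int leb g.
  by apply: eq_Int => x; rewrite !mul0r /= cos0 mul1r.
rewrite (eq_bigr (fun=> 2 * (c * pi) * Int leb g)) => [|k _].
  by rewrite sumr_const card_ord -[X in _ * X](mulr_natl _ M) mulKf// pnatr_eq0 -lt0n.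
rewrite (bigD1 k)//= big1 => [|l lk]; first by rewrite subrr eqxx C0 /=; ring.
rewrite subr_eq0 [_ == _](_ : _ = false) /=; first by ring.
by apply/negbTE; rewrite eqz_nat eq_sym.
Qed.

End toeplitz.

(** * Bilinear bounds and the Korovkin test functions *)

Section toeplitz_limit.
Context {R : realType}.
Notation leb := (@lebesgue_measure R).
Variable c : R.

Lemma coefZ b z k (g : R -> R) : L1 leb g -> coef c b z (fun x => k * g x) = k * coef c b z g.
Proof.
by move=> Lg; rewrite /coef -IntZ; [apply: eq_Int => x; rewrite mulrCA|exact: L1_trigM].
Qed.

Lemma coefD b z (g g' : R -> R) : L1 leb g -> L1 leb g' ->
  coef c b z (fun x => g x + g' x) = coef c b z g + coef c b z g'.
Proof.
move=> Lg Lg'; rewrite /coef -IntD; [|exact: L1_trigM|exact: L1_trigM].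
by apply: eq_Int => x; rewrite mulrDr.
Qed.

Lemma coefB b z (g g' : R -> R) : L1 leb g -> L1 leb g' ->
  coef c b z (fun x => g x - g' x) = coef c b z g - coef c b z g'.
Proof.
move=> Lg Lg'; rewrite /coef -IntB; [|exact: L1_trigM|exact: L1_trigM].
by apply: eq_Int => x; rewrite mulrBr.
Qed.

Lemma toepC M g g' : toep c M g g' = toep c M g' g.
Proof. by congr (_ * _); apply: eq_bigr => p _; rewrite mulrC. Qed.

Lemma toepZ M k (g g' : R -> R) : L1 leb g -> toep c M (fun x => k * g x) g' = k * toep c M g g'.
Proof.
move=> Lg; rewrite /toep mulrCA; congr (_ * _); rewrite big_distrr/=.
by apply: eq_bigr => p _; rewrite coefZ// mulrA.
Qed.

Lemma toep_sqrB M (g g' : R -> R) : L1 leb g -> L1 leb g' ->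
  toep c M g g - toep c M g' g' = toep c M (fun x => g x - g' x) (fun x => g x + g' x).
Proof.
move=> Lg Lg'; rewrite /toep -mulrBr; congr (_ * _); rewrite -sumrB.
by apply: eq_bigr => p _; rewrite coefB// coefD//; ring.
Qed.

Hypothesis c0 : 0 < c.

(** The Fejer kernel is tested on the two nonnegative kernels of rank two
    [s s' D(x) D(y) + g(x) g'(y)] and [s s' D(x) D(y) - g(x) g'(y)], with [D] the box. *)
Lemma toep_bound M N (g g' : R -> R) (s s' : R) : (0 < M)%N -> (0 < N)%N ->
  L1 leb g -> L1 leb g' ->
  (forall x, `|g x| <= s * box (N%:R * (c * pi)) x) ->
  (forall x, `|g' x| <= s' * box (N%:R * (c * pi)) x) ->
  `|toep c M g g'| <= s * s' * (2 * (N%:R * (c * pi))) ^+ 2.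
Proof.
move=> M0 N0 Lg Lg' gs gs'; set D := box _ in gs gs' *.
have LD : L1 leb D by exact: L1_box.
have key (e : R) : `|e| = 1 -> 0 <= s * s' * (2 * (N%:R * (c * pi))) ^+ 2 + e * toep c M g g'.
  move=> e1.
  have := @toep_kern_ge0 R c M 2 (fun i : 'I_2 => nth (fun=> 0) [:: fun x => s * D x; fun x => e * g x] i)
    (fun i : 'I_2 => nth (fun=> 0) [:: fun x => s' * D x; g'] i).
  rewrite !big_ord_recl !big_ord0 /= addr0 !toepZ// [toep c M D _]toepC !toepZ// toep_box// mulrA.
  apply.
  - by case=> [[|[|]]]//= _; exact: L1Z.
  - by case=> [[|[|]]]//= _; exact: L1Z.
  - move=> x y; rewrite !big_ord_recl !big_ord0 /= addr0.
    have : `|e * g x * g' y| <= s * D x * (s' * D y).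
      by rewrite !normrM e1 mul1r; apply: ler_pM.
    by rewrite ler_norml => /andP[+ _]; lra.
have := key 1 (normr1 _); have := key (-1); rewrite normrN normr1 => /(_ erefl).
by rewrite mul1r mulN1r ler_norml => *; apply/andP; split; lra.
Qed.

Lemma count_diff1 M : \sum_(k < M.+1) \sum_(l < M.+1)
  ((k : nat)%:Z - (l : nat)%:Z == 1)%:R = M%:R :> R.
Proof.
rewrite big_ord_recl big1 ?add0r => [|l _]; last first.
  by case: l => -[|l] ?.
rewrite (eq_bigr (fun=> 1)) => [|k _]; first by rewrite sumr_const card_ord.
rewrite (bigD1 (widen_ord (leqnSn M) k))//= big1 => [|l lk].
  by rewrite addr0 subr_eq /bump/= addrC -[_ + 1]/((k + 1)%N : int) addn1 eqxx.
rewrite subr_eq addrC -[_ + 1]/((l + 1)%N : int) addn1 /bump/= eqz_nat eqSS.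
case: eqP => // kl; case/eqP: lk; apply: val_inj => /=; exact/esym.
Qed.

(* The Korovkin test functions: the Fejer average of [1 - cos ((x - y) / c)] is [O(1/M)]. *)
Lemma toep_cos_sin M : (0 < M)%N ->
  (2 * (c * pi)) ^+ 2 * (1 - M%:R^-1) <=
  toep c M (fun x => cos (x / c) * box (c * pi) x) (fun x => cos (x / c) * box (c * pi) x) +
  toep c M (fun x => sin (x / c) * box (c * pi) x) (fun x => sin (x / c) * box (c * pi) x).
Proof.
case: M => // M _; set L := c * pi.
have LD := @L1_box R L.
have E b z := @coef_box R c c0 b z 1 isT; rewrite !mul1r -/L in E.
have C z : coef c true z (fun x => cos (x / c) * box L x) = L * ((z == -1)%:R + (z == 1)%:R).
  rewrite [LHS](_ : _ = 2^-1 * (coef c true (z + 1) (box L) + coef c true (z - 1) (box L))).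
    rewrite !E (addr_eq0 z 1) (subr_eq0 z 1) /=; by field.
  rewrite /coef -IntD; [|exact: L1_trigM|exact: L1_trigM].
  rewrite -IntZ; last by apply: L1D; exact: L1_trigM.
  apply: eq_Int => x; rewrite /= !intrD mulrN1z !mulrDl !mulNr !mul1r [c^-1 * x]mulrC (cosB (z%:~R / c * x)) (cosD (z%:~R / c * x)).
  by field.
have S z : coef c false z (fun x => sin (x / c) * box L x) = L * ((z == 1)%:R - (z == -1)%:R).
  rewrite [LHS](_ : _ = 2^-1 * (coef c true (z - 1) (box L) - coef c true (z + 1) (box L))).
    rewrite !E (addr_eq0 z 1) (subr_eq0 z 1) /=; by field.
  rewrite /coef -IntB; [|exact: L1_trigM|exact: L1_trigM].
  rewrite -IntZ; last by apply: L1B; exact: L1_trigM.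
  apply: eq_Int => x; rewrite /= !intrD mulrN1z !mulrDl !mulNr !mul1r [c^-1 * x]mulrC (cosB (z%:~R / c * x)) (cosD (z%:~R / c * x)).
  by field.
rewrite !toepE -mulrDr -big_split/=.
rewrite [leLHS](_ : _ = M.+1%:R^-1 * ((2 * L ^+ 2) * (M%:R + M%:R))); last first.
  have M1 : M%:R + 1 != 0 :> R by rewrite natr1 pnatr_eq0.
  by rewrite -natr1; field.
have -> : M%:R + M%:R = \sum_(k < M.+1) \sum_(l < M.+1)
  (((k : nat)%:Z - (l : nat)%:Z == 1)%:R + ((l : nat)%:Z - (k : nat)%:Z == 1)%:R) :> R.
  under eq_bigr do rewrite big_split/=.
  by rewrite big_split/= count_diff1 exchange_big/= count_diff1.
rewrite ler_wpM2l// big_distrr/=.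
apply: ler_sum => k _; rewrite -!big_split/= big_distrr/=; apply: ler_sum => l _.
rewrite !C !S.
have -> : ((l : nat)%:Z - (k : nat)%:Z == 1) = ((k : nat)%:Z - (l : nat)%:Z == -1).
  by rewrite -eqr_oppLR opprB.
(* The coefficients [u] and [v] of the other parity are left uncomputed: their squares only increase
   the right-hand side. *)
set z := _ - _; set u := coef c false z _; set v := coef c true z _.
have u0 := sqr_ge0 u; have v0 := sqr_ge0 v.
have := sqr_ge0 L.
case: (z == 1); case: (z == -1); rewrite /=; nra.
Qed.

End toeplitz_limit.

Section fejer.
Context {R : realType}.
Notation leb := (@lebesgue_measure R).
Variable c : R.
Hypothesis c0 : 0 < c.
Let L := c * pi.
Let D := @box R L.

(** Two nonnegative kernels of finite rank are averaged: [(H x - H y)^2], which gives the upper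
    bound ([U]), and [e + K (1 - cos ((x - y) / c))] minus it, which gives the lower bound ([V])
    since the average of the cosine is known up to [1 / M]. *)
Lemma toep_fejer M (H : R -> R) (S e K : R) : (0 < M)%N -> measurable_fun setT H ->
  (forall x, `|H x| <= S) -> 0 <= K ->
  (forall x y, - L <= x < L -> - L <= y < L -> (H x - H y) ^+ 2 <= e + K * (1 - cos ((x - y) / c))) ->
  `|toep c M (fun x => H x * D x) (fun x => H x * D x) - 2 * L * Int leb (fun x => H x ^+ 2 * D x)|
    <= (2 * L) ^+ 2 * (e + K * M%:R^-1).
Proof.
move=> M0 mH HS K0 He.
have LD : L1 leb D by exact: L1_box.
have D01 x : D x = 0 \/ (D x = 1 /\ - L <= x < L).
  by rewrite /D boxE; have [h|h] := boolP (- L <= x < L); [right|left].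
have LH : L1 leb (fun x => H x * D x) by apply: (@L1Mb _ _ R leb S) => [//||x]; [exact: mH|exact: HS].
have LH2 : L1 leb (fun x => H x ^+ 2 * D x).
  apply: (@L1Mb _ _ R leb (S ^+ 2)) => [//||x]; first by mfun.
  by rewrite normrX lerXn2r ?nnegrE// (le_trans (normr_ge0 _) (HS x)).
have LC : L1 leb (fun x => cos (x / c) * D x).
  by apply: (@L1Mb _ _ R leb 1) => [//||x]; [mfun|exact: cos_max].
have LS : L1 leb (fun x => sin (x / c) * D x).
  by apply: (@L1Mb _ _ R leb 1) => [//||x]; [mfun|exact: sin_max].
have TD : toep c M D D = (2 * L) ^+ 2.
  by have := @toep_box R c c0 M 1 M0 isT; rewrite mul1r.
have TH : toep c M (fun x => H x ^+ 2 * D x) D = 2 * L * Int leb (fun x => H x ^+ 2 * D x).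
  exact: toep_box_r.
have TH' : toep c M D (fun x => H x ^+ 2 * D x) = 2 * L * Int leb (fun x => H x ^+ 2 * D x).
  by rewrite toepC.
have TCS := toep_cos_sin c0 M0; rewrite -/L -/D in TCS.
set I := Int leb _ in TH TH' *; set t := toep c M _ _.
have U : 0 <= 2 * L * I + (- 2 * t + 2 * L * I).
  have := @toep_kern_ge0 R c M 3
    (fun i => nth (fun=> 0) [:: fun x => H x ^+ 2 * D x; fun x => - 2 * (H x * D x); D] i)
    (fun i => nth (fun=> 0) [:: D; fun x => H x * D x; fun x => H x ^+ 2 * D x] i).
  rewrite !big_ord_recl !big_ord0 /= addr0 TH TH' toepZ// -/t; apply.
  - by case=> [[|[|[|]]]]//= _; exact: L1Z.
  - by case=> [[|[|[|[|]]]]].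
  - move=> x y; rewrite !big_ord_recl !big_ord0 /= addr0.
    have [->|[-> _]] := D01 x; have [->|[-> _]] := D01 y; rewrite ?mulr0 ?mul0r ?addr0 ?mul0r//.
    by rewrite !mulr1 mul1r; have := sqr_ge0 (H x - H y); nra.
have V : 0 <= (e + K) * (2 * L) ^+ 2 + (- K * toep c M (fun x => cos (x / c) * D x) (fun x => cos (x / c) * D x) +
    (- K * toep c M (fun x => sin (x / c) * D x) (fun x => sin (x / c) * D x) +
    (- 1 * (2 * L * I) + (2 * t + - 1 * (2 * L * I))))).
  have := @toep_kern_ge0 R c M 6
    (fun i => nth (fun=> 0) [:: fun x => (e + K) * D x; fun x => - K * (cos (x / c) * D x);
       fun x => - K * (sin (x / c) * D x);
       fun x => - 1 * (H x ^+ 2 * D x); fun x => 2 * (H x * D x); fun x => - 1 * D x] i)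
    (fun i => nth (fun=> 0) [:: D; fun x => cos (x / c) * D x; fun x => sin (x / c) * D x; D;
       fun x => H x * D x; fun x => H x ^+ 2 * D x] i).
  rewrite !big_ord_recl !big_ord0 /= addr0 !toepZ// TH TH' TD -/t; apply.
  - by case=> [[|[|[|[|[|[|[|]]]]]]]]//= _; exact: L1Z.
  - by case=> [[|[|[|[|[|[|[|]]]]]]]].
  - move=> x y; rewrite !big_ord_recl !big_ord0 /= addr0.
    have [->|[-> hx]] := D01 x; have [->|[-> hy]] := D01 y; rewrite ?mulr0 ?mul0r ?addr0 ?mulr0 ?mul0r//.
    have := He x y hx hy; rewrite mulrBl cosB; lra.
have KM : 0 <= K * ((2 * L) ^+ 2 * M%:R^-1) by apply: mulr_ge0 => //; apply: mulr_ge0; [exact: sqr_ge0|rewrite invr_ge0].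
have eL : 0 <= (2 * L) ^+ 2 * (e + K / M%:R).
  have := ler_wpM2l K0 TCS; lra.
have := ler_wpM2l K0 TCS.
rewrite ler_norml => TK; apply/andP; split; lra.
Qed.

Lemma toep_cvg_box (H : R -> R) (S : R) (M : nat -> nat) : measurable_fun setT H ->
  (forall x, `|H x| <= S) ->
  (forall e, 0 < e -> exists2 K, 0 <= K & forall x y, - L <= x < L -> - L <= y < L ->
     (H x - H y) ^+ 2 <= e + K * (1 - cos ((x - y) / c))) ->
  ((M j)%:R : R) @[j --> \oo] --> +oo ->
  toep c (M j) (fun x => H x * D x) (fun x => H x * D x) @[j --> \oo] -->
    2 * L * Int leb (fun x => H x ^+ 2 * D x).
Proof.
move=> mH HS osc Moo; have L0 : 0 < L by rewrite mulr_gt0 ?pi_gt0.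
have L2 : 0 < (2 * L) ^+ 2 by apply: exprn_gt0; apply: mulr_gt0.
apply/cvgrPdist_le => e e0.
pose e' := e / (2 * L) ^+ 2 / 2.
have e'0 : 0 < e' by rewrite !divr_gt0.
have [K K0 HK] := osc e' e'0.
near=> j; rewrite distrC.
have Mj : (K + 1) / e' <= (M j)%:R by near: j; move/cvgryPge: Moo; exact.
have Mj0 : (0 < (M j)%:R :> R).
  by apply: lt_le_trans Mj; rewrite divr_gt0//; lra.
apply: (le_trans (toep_fejer _ mH HS K0 HK)); first by rewrite -(ltr0n R).
apply: (@le_trans _ _ ((2 * L) ^+ 2 * (e' + e'))); last first.
  by rewrite le_eqVlt; apply/orP; left; apply/eqP; rewrite /e'; field; rewrite gt_eqF.
rewrite ler_wpM2l// ?(ltW L2)// lerD2l ler_pdivrMr//.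
by move: Mj; rewrite ler_pdivrMr// mulrC; lra.
Unshelve. all: by end_near. Qed.

(** The quadratic form is the integral of [h] against [V], the squared modulus of the trigonometric
    polynomial with coefficients [u]; the majorant of [h] is constant on [N] periods and keeps only
    the diagonal. *)
Lemma toep_opbound M N (h : R -> R) (S : R) (u : 'I_M -> R) : (0 < N)%N -> L1 leb h ->
  (forall x, 0 <= h x <= S * box (N%:R * L) x) ->
  0 <= \sum_k \sum_l u k * u l * coef c true ((k : nat)%:Z - (l : nat)%:Z) h <=
    S * (2 * (N%:R * L)) * \sum_k u k ^+ 2.
Proof.
move=> N0 Lh hS.
have LB : L1 leb (box (N%:R * L)) by exact: L1_box.
pose V x := (\sum_k u k * cos ((k : nat)%:R / c * x)) ^+ 2 + (\sum_k u k * sin ((k : nat)%:R / c * x)) ^+ 2.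
have V0 x : 0 <= V x by rewrite addr_ge0// sqr_ge0.
have VE g : L1 leb g -> L1 leb (fun x => V x * g x) /\
    \sum_k \sum_l u k * u l * coef c true ((k : nat)%:Z - (l : nat)%:Z) g = Int leb (fun x => V x * g x).
  move=> Lg.
  have E x : V x * g x = \sum_k \sum_l u k * u l *
      (trig true (((k : nat)%:Z - (l : nat)%:Z)%:~R / c * x) * g x).
    rewrite /V !expr2 !big_distrl/= -big_split/= big_distrl/=; apply: eq_bigr => k _.
    rewrite !big_distrr/= -big_split/= big_distrl/=; apply: eq_bigr => l _.
    rewrite mulrA rmorphB/= -!pmulrn !mulrBl cosB; ring.
  have Li k l : L1 leb (fun x => u k * u l * (trig true (((k : nat)%:Z - (l : nat)%:Z)%:~R / c * x) * g x)).
    by apply: L1Z; exact: L1_trigM.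
  have -> : (fun x => V x * g x) = (fun x => \sum_k \sum_l u k * u l *
      (trig true (((k : nat)%:Z - (l : nat)%:Z)%:~R / c * x) * g x)) by apply/funext.
  split; first by do 2 (apply: L1_sum => ? _).
  rewrite Int_sum => [|k _]; last by apply: L1_sum.
  apply: eq_bigr => k _; rewrite Int_sum//; apply: eq_bigr => l _.
  by rewrite IntZ//; exact: L1_trigM.
have [L1h ->] := VE h Lh.
have [L1b Eb] := VE _ (L1Z S LB).
apply/andP; split.
  by apply: Int_ge0 => x; rewrite mulr_ge0//; case/andP: (hS x).
apply: (@le_trans _ _ (Int leb (fun x => V x * (S * box (N%:R * L) x)))).
  by apply: Int_le => // x; rewrite ler_wpM2l//; case/andP: (hS x).
rewrite -Eb le_eqVlt; apply/orP; left; apply/eqP; rewrite big_distrr/=; apply: eq_bigr => k _.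
rewrite (bigD1 k)//= big1 => [|l lk].
  by rewrite addr0 coefZ// coef_box// subrr eqxx /= /L; ring.
rewrite coefZ// coef_box// subr_eq0 [_ == _](_ : _ = false) /= ; first by rewrite /L; ring.
by apply/negbTE; rewrite eqz_nat eq_sym.
Qed.

End fejer.

(** * Folding onto one period *)

Section periodization.
Context {R : realType}.
Notation leb := (@lebesgue_measure R).
Variable c : R.
Hypothesis c0 : 0 < c.
Let L := c * pi.
Let L0 : 0 < L. Proof. by rewrite mulr_gt0 ?pi_gt0. Qed.

(** The translates by [2 k c pi] for [k] from [- N] to [N - 1], paired as in [periodized]; this
    asymmetric window accounts for the condition [A < (2 * N%:R - 1) * L]. *)
Definition persum (w : R -> R) (N : nat) (x : R) : R :=
  \sum_(0 <= n < N) (w (x + 2 * n%:R * c * pi) + w (x - 2 * n.+1%:R * c * pi)).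

Lemma box_shift s x : box L (x - s) = (s - L <= x)%R%:R - (s + L <= x)%R%:R.
Proof.
have l0 := L0; rewrite boxE.
have -> : (- L <= x - s) = (s - L <= x) by apply/idP/idP; lra.
have -> : (x - s < L) = ~~ (s + L <= x) by rewrite -ltNge; apply/idP/idP; lra.
have [h1|h1] := leP (s - L) x; have [h2|h2] := leP (s + L) x => /=; rewrite ?subrr ?subr0//.
by exfalso; lra.
Qed.

Lemma box_tile N x :
  \sum_(0 <= n < N) (box L (x - 2 * n%:R * c * pi) + box L (x + 2 * n.+1%:R * c * pi)) =
  (- ((2 * N%:R + 1) * L) <= x)%R%:R - ((2 * N%:R - 1) * L <= x)%R%:R.
Proof.
elim: N => [|N IH].
  by rewrite big_nil mulr0 !add0r mul1r mulN1r subrr.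
rewrite big_nat_recr//= IH.
have -> : x + 2 * N.+1%:R * c * pi = x - - (2 * N.+1%:R * c * pi) by rewrite opprK.
rewrite !box_shift.
have -> : 2 * N%:R * c * pi - L = (2 * N%:R - 1) * L by rewrite /L; ring.
have -> : 2 * N%:R * c * pi + L = (2 * N.+1%:R - 1) * L by rewrite -natr1 /L; ring.
have -> : - (2 * N.+1%:R * c * pi) - L = - ((2 * N.+1%:R + 1) * L) by rewrite /L; ring.
have -> : - (2 * N.+1%:R * c * pi) + L = - ((2 * N%:R + 1) * L) by rewrite -natr1 /L; ring.
ring.
Qed.

(** From [- L] to [L] the window of translates moves by one place, so the difference telescopes to
    two values of [w] outside its support. The folded function thus closes up on the circle. *)
Lemma persum_ends w N A : (forall x, A < `|x| -> w x = 0) -> A < (2 * N%:R - 1) * L ->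
  persum w N L = persum w N (- L).
Proof.
move=> wA AN; have l0 := L0.
have H k : persum w k L - persum w k (- L) = w ((2 * k%:R - 1) * L) - w (- ((2 * k%:R + 1) * L)).
  rewrite /persum; elim: k => [|k IH].
    by rewrite !big_nil mulr0 !add0r oppr0 mul1r mulN1r subrr.
  rewrite !big_nat_recr//=.
  have -> : - L + 2 * k%:R * c * pi = (2 * k%:R - 1) * L by rewrite /L; ring.
  have -> : L + 2 * k%:R * c * pi = (2 * k.+1%:R - 1) * L by rewrite -natr1 /L; ring.
  have -> : - L - 2 * k.+1%:R * c * pi = - ((2 * k.+1%:R + 1) * L) by rewrite /L; ring.
  have -> : L - 2 * k.+1%:R * c * pi = - ((2 * k%:R + 1) * L) by rewrite -natr1 /L; ring.
  move: IH; lra.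
apply/eqP; rewrite -subr_eq0 H !wA ?subrr//.
  have h : (2 * N%:R - 1) * L <= (2 * N%:R + 1) * L by rewrite ler_pM2r//; lra.
  by rewrite normrN (lt_le_trans AN)// (le_trans h)// ler_norm.
by apply: (lt_le_trans AN); exact: ler_norm.
Qed.

(** Each tile of the line is moved onto the central period, a translation that leaves
    [trig b (z / c * x)] unchanged. *)
Lemma coef_persum b z (w : R -> R) N A : L1 leb w ->
  (forall x, A < `|x| -> w x = 0) -> A < (2 * N%:R - 1) * L ->
  coef c b z w = coef c b z (fun x => persum w N x * box L x).
Proof.
move=> Lw wA AN; have l0 := L0; set k := z%:~R / c.
have Lb (s : R) : L1 leb (fun x => box L (x + s) * (trig b (k * x) * w x)).
  apply: (@L1Mb _ _ R leb 1) => [||x].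
  - exact: L1_trigM.
  - apply: (measurable_comp (F := setT)) => //; last by mfun.
    by apply: measurable_indic; exact: measurable_itv.
  - by rewrite boxE; case: (_ <= _ < _) => /=; rewrite ?normr1 ?normr0.
have shift (s : R) (m : int) : s = m%:~R * (2 * c * pi) ->
    Int leb (fun x => box L (x - s) * (trig b (k * x) * w x)) =
    Int leb (fun x => trig b (k * x) * (w (x + s) * box L x)) /\
    L1 leb (fun x => trig b (k * x) * (w (x + s) * box L x)).
  move=> sm; have [H1 H2] := Int_affine s (oner_neq0 R) (Lb (- s)).
  have E : (fun x => box L (1 * x + s - s) * (trig b (k * (1 * x + s)) * w (1 * x + s))) =
           (fun x => trig b (k * x) * (w (x + s) * box L x)).
    apply/funext => x; rewrite mul1r addrK.
    have -> : k * (x + s) = k * x + (z * m)%:~R * (2 * pi).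
      by rewrite sm /k rmorphM/=; field; rewrite gt_eqF.
    by rewrite trig_period; ring.
  by rewrite E in H1 H2; rewrite H2 normr1 invr1 mul1r.
rewrite /coef -/k.
rewrite (@eq_Int _ _ R leb _ (fun x => \sum_(0 <= n < N)
   (box L (x - 2 * n%:R * c * pi) * (trig b (k * x) * w x) +
    box L (x - - (2 * n.+1%:R * c * pi)) * (trig b (k * x) * w x)))); last first.
  move=> x; have [wx|wx] := eqVneq (w x) 0.
    by rewrite wx !mulr0 big1// => n _; rewrite !mulr0 addr0.
  under eq_bigr do rewrite opprK -mulrDl.
  rewrite -big_distrl/= box_tile.
  have : `|x| <= A by rewrite leNgt; apply/negP => /wA/eqP; apply/negP.
  rewrite ler_norml => /andP[h1 h2].
  have -> : - ((2 * N%:R + 1) * L) <= x by lra.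
  by rewrite leNgt (le_lt_trans h2 AN) /= subr0 mul1r.
rewrite Int_sum => [|n _]; last by apply: L1D; exact: Lb.
rewrite [in RHS](@eq_Int _ _ R leb _ (fun x => \sum_(0 <= n < N)
   (trig b (k * x) * (w (x + 2 * n%:R * c * pi) * box L x) +
    trig b (k * x) * (w (x - 2 * n.+1%:R * c * pi) * box L x)))); last first.
  by move=> x; rewrite /persum big_distrl/= big_distrr/=; apply: eq_bigr => n _; ring.
have E1 n : 2 * n%:R * c * pi = (n%:Z)%:~R * (2 * c * pi) by rewrite -pmulrn; ring.
have E2 n : - (2 * n.+1%:R * c * pi) = (- n.+1%:Z)%:~R * (2 * c * pi).
  by rewrite rmorphN/= -pmulrn; ring.
rewrite Int_sum => [|n _].
  apply: eq_bigr => n _; have [e1 l1] := shift _ _ (E1 n); have [e2 l2] := shift _ _ (E2 n).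
  by rewrite IntD// IntD// e1 e2.
by apply: L1D; [exact: (shift _ _ (E1 n)).2|exact: (shift _ _ (E2 n)).2].
Qed.

(* Either [x - y] is small, or [x] and [y] are close to opposite ends of the period, or
   [1 - cos ((x - y) / c)] is bounded away from 0. *)
Lemma persum_osc w N A : (forall x, A < `|x| -> w x = 0) -> A < (2 * N%:R - 1) * L ->
  (forall e, 0 < e -> exists2 K, 0 <= K & forall x y : R, `|w x - w y| <= e + K * `|x - y|) ->
  (exists S, forall x, `|w x| <= S) ->
  forall e, 0 < e -> exists2 K, 0 <= K & forall x y, - L <= x < L -> - L <= y < L ->
     (persum w N x - persum w N y) ^+ 2 <= e + K * (1 - cos ((x - y) / c)).
Proof.
move=> wA AN lipw [S HS] e e0; have l0 := L0.
have pS x : `|persum w N x| <= \sum_(0 <= n < N) (S + S).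
  by apply: (le_trans (ler_norm_sum _ _ _)); apply: ler_sum => n _;
     apply: (le_trans (ler_normD _ _)); exact: lerD.
set S' := \sum_(0 <= n < N) (S + S) in pS.
have lipp e1 : 0 < e1 -> exists2 r, 0 < r & forall x y : R, `|x - y| <= r ->
    `|persum w N x - persum w N y| <= e1.
  move=> e10; pose q := 4 * N.+1%:R : R; have q0 : 0 < q by rewrite mulr_gt0.
  have [K K0 HK] := lipw (e1 / q) (divr_gt0 e10 q0).
  exists (e1 / q / (K + 1)); first by rewrite !divr_gt0//; lra.
  move=> x y xy; rewrite /persum -sumrB.
  apply: (le_trans (ler_norm_sum _ _ _)).
  apply: (@le_trans _ _ (\sum_(0 <= n < N) (4 * (e1 / q)))).
    apply: ler_sum => n _; rewrite opprD addrACA.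
    have B u v : u - v = x - y -> `|w u - w v| <= 2 * (e1 / q).
      move=> uv; apply: (le_trans (HK u v)); rewrite uv.
      have : K * `|x - y| <= (K + 1) * (e1 / q / (K + 1)).
        by apply: ler_pM => //; lra.
      by rewrite [X in _ <= X -> _]mulrC divfK ?gt_eqF//; lra.
    have h1 := B (x + 2 * n%:R * c * pi) (y + 2 * n%:R * c * pi).
    have h2 := B (x - 2 * n.+1%:R * c * pi) (y - 2 * n.+1%:R * c * pi).
    apply: (le_trans (ler_normD _ _)).
    have := h1 _; have := h2 _; rewrite !opprD !addrA.
    have -> : 4 * (e1 / q) = 2 * (e1 / q) + 2 * (e1 / q) by ring.
    by move=> H2 H1; apply: lerD; [apply: H1|apply: H2]; ring.
  rewrite big_const_nat subn0 iter_addr_0 -mulr_natr.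
  rewrite [leLHS](_ : _ = e1 * (N%:R / N.+1%:R)).
    by rewrite ler_piMr ?(ltW e10)// ler_pdivrMr// mul1r ler_nat.
  by rewrite /q; field; rewrite ?natr1 ?nat1r pnatr_eq0.
pose m := Num.min 1 e.
have m0 : 0 < m by rewrite /m lt_min ltr01 e0.
have m20 : 0 < m / 2 by rewrite divr_gt0.
have me : m ^+ 2 <= e.
  have : m <= 1 by rewrite /m ge_min lexx.
  have : m <= e by rewrite /m ge_min lexx orbT.
  by nra.
have [r1 r10 Hr1] := lipp (m / 2) m20.
pose r := Num.min r1 L.
have r0 : 0 < r by rewrite /r lt_min r10.
have rr1 : r <= r1 by rewrite /r ge_min lexx.
have rL : r <= L by rewrite /r ge_min lexx orbT.
have LcE : L / c = pi by rewrite /L mulrC mulKf// gt_eqF.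
have rc0 : 0 < r / c by rewrite divr_gt0.
have rcpi : r / c <= pi by rewrite -LcE ler_pM2r// invr_gt0.
have d0 : 0 < 1 - cos (r / c).
  by rewrite subr_gt0 -cos0 ltr_cos// in_itv/= ?lexx ?pi_ge0// rcpi ltW.
have cosmon t : r / c <= t -> t <= pi -> cos t <= cos (r / c).
  move=> t1 t2; have := @ltr_cos R t (r / c).
  rewrite !in_itv/= (ltW rc0) rcpi t2 (le_trans (ltW rc0) t1) => /(_ isT isT) H.
  by rewrite leNgt H -leNgt.
(* When the cosine is at most [cos (r / c)], this choice makes the second term alone reach the crude
   bound [(S' + S') ^+ 2]. *)
exists ((S' + S') ^+ 2 / (1 - cos (r / c))); first by rewrite divr_ge0 ?sqr_ge0// ltW.
set K := _ / _.
have K0 : 0 <= K by rewrite divr_ge0 ?sqr_ge0// ltW.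
move=> x y; wlog xy : x y / y <= x => [H|].
  move=> hx hy; have [yx|/ltW xy] := leP y x; first exact: H.
  by rewrite -sqrrN opprB -[cos _]cosN -mulNr opprB; exact: H.
move=> /andP[x1 x2] /andP[y1 y2].
have C0 : 0 <= K * (1 - cos ((x - y) / c)) by rewrite mulr_ge0// subr_ge0 cos_le1.
have small : `|persum w N x - persum w N y| <= m ->
    (persum w N x - persum w N y) ^+ 2 <= e + K * (1 - cos ((x - y) / c)).
  move=> h; apply: (@le_trans _ _ e); last by rewrite lerDl.
  apply: le_trans me; rewrite -real_normK ?num_real// lerXn2r ?nnegrE//; exact: ltW.
have [h1|h1] := leP (x - y) r.
  apply: small; apply: (@le_trans _ _ (m / 2)); last by lra.
  by apply: Hr1; rewrite ger0_norm ?subr_ge0// (le_trans h1).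
have [h2|h2] := leP (2 * L - r) (x - y).
  apply: small.
  have -> : persum w N x - persum w N y = (persum w N x - persum w N L) + (persum w N (- L) - persum w N y).
    by rewrite (persum_ends wA AN) addrA subrK.
  rewrite [leRHS](_ : _ = m / 2 + m / 2); last by field.
  apply: (le_trans (ler_normD _ _)); apply: lerD; apply: Hr1; rewrite ler0_norm; lra.
have cm : cos ((x - y) / c) <= cos (r / c).
  have t1 : r / c <= (x - y) / c by rewrite ler_pM2r ?invr_gt0// ltW.
  have t2 : (x - y) / c <= 2 * pi - r / c.
    by rewrite -LcE mulrA -mulrBl ler_pM2r ?invr_gt0// ltW.
  have [h|h] := leP ((x - y) / c) pi; first exact: cosmon.
  have -> : cos ((x - y) / c) = cos (pi *+ 2 - (x - y) / c).
    by rewrite -[in LHS]cosN -(cosD2pi (- _)) addrC.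
  by apply: cosmon; rewrite -mulr_natl; lra.
apply: (@le_trans _ _ ((S' + S') ^+ 2)).
  rewrite -real_normK ?num_real// lerXn2r ?nnegrE//.
    by have := le_trans (normr_ge0 _) (pS 0) => h; exact: addr_ge0.
  by apply: (le_trans (ler_normB _ _)); exact: lerD.
apply: (@le_trans _ _ (K * (1 - cos (r / c)))).
  by rewrite /K divfK// gt_eqF.
apply: (@le_trans _ _ (K * (1 - cos ((x - y) / c)))); last by rewrite lerDr ltW.
by rewrite ler_wpM2l// lerB.
Qed.

Lemma periodizedE psi N A x : (forall x, A < `|x| -> FT_abs2 psi x = 0) -> A < (2 * N%:R - 1) * L ->
  `|x| <= L -> periodized psi c x = persum (FT_abs2 psi) N x.
Proof.
move=> wA AN; have l0 := L0; rewrite ler_norml => /andP[x1 x2].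
rewrite /periodized; apply/cvg_lim => //; apply: cvg_near_cst.
exists N => // n /= Nn; rewrite -/(persum _ n x) /persum (big_cat_nat (leq0n N) Nn)/=.
rewrite [X in _ + X](_ : _ = 0) ?addr0// big_nat_cond big1// => i /andP[/andP[Ni _] _].
have h : (2 * N%:R - 1) * L <= (2 * i%:R - 1) * L.
  by rewrite ler_pM2r// lerB// ler_wpM2l// ler_nat.
have E1 : 2 * i%:R * c * pi = (2 * i%:R) * L by rewrite /L; ring.
have E2 : 2 * i.+1%:R * c * pi = (2 * i%:R + 2) * L by rewrite -natr1 /L; ring.
rewrite E1 E2 !wA ?addr0//.
- rewrite -normrN; apply: lt_le_trans (ler_norm _); lra.
- apply: lt_le_trans (ler_norm _); lra.
Qed.

End periodization.

(* [mu] is integrated over the default Borel structure of [R], which is not convertible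
   to [measurableTypeR R]: the pushforward by the identity relates the two. *)
Lemma integral_law (R : realType) (N : probability (measurableTypeR R) R)
  (mu : set R -> \bar R) (g : R -> R) : (N : set _ -> \bar R) = mu ->
  measurable_fun setT g -> L1 N g -> (\int[mu]_x (g x)%:E)%E = (Int N g)%:E.
Proof.
move=> <- mg Lg; rewrite Int_EFin//.
have mid : measurable_fun setT (fun x : measurableTypeR R => x : R) by exact: measurable_id.
have := @integral_pushforward _ _ (measurableTypeR R) R R _ mid N setT (EFin \o g).
have -> : pushforward N (fun x : measurableTypeR R => x : R) = N :> (set R -> \bar R).
  by apply/funext => A.
by apply => //; exact/measurable_EFinP.
Qed.

(** * Central limit theorem for quadratic forms *)

Section clt.
Context d (T : measurableType d) (R : realType) (P : probability T R).
Variables (n : nat -> nat) (Y : forall j, 'I_(n j) -> T -> R)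
  (S A : forall j, 'M[R]_(n j)) (v : R) (e : nat -> R) (Z : nat -> T -> R).
Arguments Y : clear implicits.

(** The deterministic shift [e j] disappears on characteristic functions because the cosine is
    1-Lipschitz. Equality with the quadratic form is asked only eventually, as the scales are
    separated only from some index on. *)
Lemma quad_cvg_in_law : 0 <= v -> (forall j, gauss_vec P (Y j) (S j)) ->
  (forall j i k, A j i k = A j k i) ->
  2 * \tr (mxpw (A j *m S j) 2) @[j --> \oo] --> v ->
  (forall k, \tr (mxpw (A j *m S j) k.+3) @[j --> \oo] --> 0) ->
  e j @[j --> \oo] --> 0 ->
  (\forall j \near \oo, forall w, Z j w = quad (Y j) (S j) (A j) w + e j) ->
  cvg_in_law P Z (centred_gauss_law v).
Proof.
move=> v0 GV symA tr2 tr3 e0 ZE g cg [C gC].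
have [N [NE GN]] := gauss_law v0.
have LQ j : Lall P (quad (Y j) (S j) (A j)) by apply: Lall_quad; exact: GV.
have mQ j := Lall_meas (LQ j).
have mg : measurable_fun setT g by exact: continuous_measurable_fun.
have Qcf u t : Int P (fun w => cos (u * quad (Y j) (S j) (A j) w + t)) @[j --> \oo] -->
    Int N (fun x => cos (u * x + t)).
  apply: (@moment_charfun R _ _ P (fun j => quad (Y j) (S j) (A j)) _ _ N id v) => //.
  - by case: GN => L _ _; exact: (L ord0).
  - by move=> p; exact: (quad_mom_cvg GV symA tr2 tr3).
  - by move=> p; exact: (gauss_mom GN).
have mQe j : measurable_fun setT (fun w => quad (Y j) (S j) (A j) w + e j) by mfun.
have cf u t : Int P (fun w => cos (u * (quad (Y j) (S j) (A j) w + e j) + t)) @[j --> \oo] -->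
    Int N (fun x => cos (u * x + t)).
  have D : (Int P (fun w => cos (u * (quad (Y j) (S j) (A j) w + e j) + t)) -
      Int P (fun w => cos (u * quad (Y j) (S j) (A j) w + t))) @[j --> \oo] --> 0.
    apply/norm_cvg0P; apply: (@squeeze_cvgr _ _ _ _ (fun=> 0) (fun j => `|u| * `|e j|)).
    - apply: nearW => j; rewrite normr_ge0/=.
      rewrite -IntB.
      + rewrite -[leRHS](Int_cst P); apply: Int_abs_le; first by mfun.
          exact: L1_cst.
        move=> w; apply: (le_trans (cos_lip _ _)).
        by rewrite -normrM le_eqVlt; apply/orP; left; apply/eqP; congr `|_|; ring.
      + by apply: (@L1_bdd _ _ _ P 1) => [|w]; [mfun|exact: cos_max].
      + by apply: (@L1_bdd _ _ _ P 1) => [|w]; [mfun|exact: cos_max].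
    - exact: cvg_cst.
    - by rewrite -(mulr0 `|u|); apply: cvgMr; rewrite -(@normr0 _ R); exact: cvg_norm.
  have H := cvgD D (Qcf u t); rewrite add0r in H; apply: (cvg_trans _ (H _)); apply: near_eq_cvg.
  by apply: nearW => j /=; rewrite subrK.
have H := levy mQe cf cg gC.
have Lg : L1 N g by apply: (@L1_bdd _ _ _ N C) => //.
have H' : (Int P (fun w => g (quad (Y j) (S j) (A j) w + e j)))%:E @[j --> \oo] --> (Int N g)%:E.
  by apply/cvg_EFin; [exact: nearW|exact: H].
rewrite (integral_law NE mg Lg).
apply: (cvg_trans _ H'); apply: near_eq_cvg; apply: filterS ZE => j ZE.
rewrite Int_EFin; last first.
  by apply: (@L1_bdd _ _ _ P C) => [|w]; [exact: (measurableT_comp mg (mQe j))|exact: gC].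
by apply: eq_integral => w _; rewrite ZE.
Qed.

End clt.

(** * Traces of the powers of a bounded positive matrix *)

Section trace_powers.
Context {R : realType}.

Lemma mxpwD n (S : 'M[R]_n) a b : mxpw S (a + b) = mxpw S a *m mxpw S b.
Proof.
elim: b => [|b IH]; first by rewrite addn0 /= mulmx1.
by rewrite addnS /= IH mulmxA.
Qed.

Lemma mxpw_tr n (S : 'M[R]_n) k : S^T = S -> (mxpw S k)^T = mxpw S k.
Proof.
move=> ST; elim: k => [|k IH] /=; first by rewrite trmx1.
rewrite trmx_mul IH ST; have := mxpwD S 1 k.
by rewrite add1n /= mul1mx.
Qed.

Lemma mxpwZ n (S : 'M[R]_n) a k : mxpw (a *: S) k = a ^+ k *: mxpw S k.
Proof.
elim: k => [|k IH] /=; first by rewrite scale1r.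
by rewrite IH -scalemxAl -scalemxAr scalerA exprSr.
Qed.

Lemma mxpw_block n1 n2 (S1 : 'M[R]_n1) (S2 : 'M[R]_n2) k :
  mxpw (block_mx S1 0 0 S2) k = block_mx (mxpw S1 k) 0 0 (mxpw S2 k).
Proof.
elim: k => [|k IH] /=; first by rewrite scalar_mx_block.
by rewrite IH mulmx_block !(mul0mx, mulmx0, addr0, add0r).
Qed.

Lemma tr_sym2 n (S : 'M[R]_n) : S^T = S -> \tr (mxpw S 2) = \sum_i \sum_j S i j ^+ 2.
Proof.
move=> ST; rewrite /mxtrace; apply: eq_bigr => i _; rewrite /= mul1mx mxE; apply: eq_bigr => j _.
by rewrite -{2}ST mxE expr2.
Qed.

Variables (n : nat) (S : 'M[R]_n) (b : R).
Hypotheses (ST : S^T = S) (b0 : 0 < b).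
Hypothesis Sb : forall u : 'I_n -> R,
  0 <= \sum_k \sum_l u k * u l * S k l <= b * \sum_k u k ^+ 2.

(** Summed over the columns of [W], the bound on the quadratic form becomes a trace inequality; with
    [W] a polynomial in [S] it does the work of eigenvalues. *)
Let trW (W : 'M[R]_n) : 0 <= \tr (W^T *m S *m W) <= b * \tr (W^T *m W).
Proof.
have -> : \tr (W^T *m S *m W) = \sum_j \sum_k \sum_l W k j * W l j * S k l.
  rewrite /mxtrace; apply: eq_bigr => j _; rewrite mxE exchange_big; apply: eq_bigr => k _.
  rewrite mxE big_distrl; apply: eq_bigr => l _; rewrite mxE /=; ring.
have -> : \tr (W^T *m W) = \sum_j \sum_k W k j ^+ 2.
  by rewrite /mxtrace; apply: eq_bigr => j _; rewrite mxE; apply: eq_bigr => k _; rewrite mxE expr2.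
apply/andP; split; first by apply: sumr_ge0 => j _; case/andP: (Sb (fun k => W k j)).
by rewrite big_distrr; apply: ler_sum => j _; case/andP: (Sb (fun k => W k j)).
Qed.

(* The step [m.*2.+1 -> m.*2.+2] comes from [0 <= tr (W^T S W)] with
   [W = b S^m - S^(m+1)]. *)
Lemma tr_mxpw_bound k : 0 <= \tr (mxpw S k) /\ \tr (mxpw S k.+1) <= b * \tr (mxpw S k).
Proof.
have sS m : mxpw S m *m S = mxpw S m.+1 by [].
have ev m : \tr ((mxpw S m)^T *m mxpw S m) = \tr (mxpw S m.*2) by rewrite mxpw_tr// -mxpwD addnn.
have od m : \tr ((mxpw S m)^T *m S *m mxpw S m) = \tr (mxpw S m.*2.+1).
  by rewrite mxpw_tr// sS -mxpwD addSn addnn.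
have H m : 0 <= \tr (mxpw S m.*2.+1) <= b * \tr (mxpw S m.*2) by rewrite -od -ev.
have H2 m : 0 <= \tr (mxpw S m.*2).
  by rewrite -ev /mxtrace; apply: sumr_ge0 => i _; rewrite mxE; apply: sumr_ge0 => j _;
     rewrite mxE -expr2 sqr_ge0.
have H3 m : \tr (mxpw S m.*2.+2) <= b * \tr (mxpw S m.*2.+1).
  have := trW (b *: mxpw S m - mxpw S m.+1) => /andP[+ _].
  have -> : (b *: mxpw S m - mxpw S m.+1)^T = b *: mxpw S m - mxpw S m.+1.
    have := mxpw_tr m ST; have := mxpw_tr m.+1 ST.
    by move: (mxpw S m) (mxpw S m.+1) => W V VT WT; rewrite raddfB /= linearZ /= VT WT.
  rewrite [_ *m S]mulmxBl -scalemxAl !sS.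
  rewrite mulmxBl !mulmxBr -!scalemxAl -!scalemxAr -!mxpwD.
  rewrite !addSn !addnS addnn !(raddfB, mxtraceZ) /= !mxtraceZ.
  have /andP[_ h3] := H m.+1; rewrite doubleS in h3.
  move: (\tr (mxpw S m.*2.+1)) (\tr (mxpw S m.*2.+2)) (\tr (mxpw S m.*2.+3)) h3 => x y z h3 h.
  have : 0 <= b * (b * x - y) by lra.
  by rewrite pmulr_rge0//; lra.
rewrite -(odd_double_half k); case: (odd k); rewrite ?add0n ?add1n.
  by split; [case/andP: (H k./2)|exact: H3].
by split; [exact: H2|case/andP: (H k./2)].
Qed.

(** The comparison starts from the second power, whose trace has a limit after scaling; each further
    factor costs at most [b]. *)
Lemma tr_mxpw_geom k : 0 <= \tr (mxpw S k.+2) <= b ^+ k * \tr (mxpw S 2).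
Proof.
elim: k => [|k /andP[h1 h2]].
  by rewrite expr0 mul1r lexx andbT; case: (tr_mxpw_bound 2).
have [h3 h4] := tr_mxpw_bound k.+3; have [h5 h6] := tr_mxpw_bound k.+2.
rewrite h3 (le_trans h6)// exprS -mulrA ler_wpM2l//; exact: ltW.
Qed.

End trace_powers.

(** * Symbols of the wavelet coefficients *)

Section scaling.
Context {R : realType}.
Notation leb := (@lebesgue_measure R).

(** A boundary point is the limit of [x (1 + 1 / (n + 1))]. The boundary matters because the
    spectral supports of two scales touch when their ratio is exactly [A / B]. *)
Lemma continuous_zero_le (g : R -> R) (A : R) : continuous g -> 0 < A ->
  (forall x, A < `|x| -> g x = 0) -> forall x, A <= `|x| -> g x = 0.
Proof.
move=> cg A0 gA x Ax.
have E n : g (x * (1 + n.+1%:R^-1)) = 0.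
  apply: gA; rewrite normrM (@ger0_norm _ (1 + _)) ?addr_ge0//.
  by apply: (le_lt_trans Ax); rewrite ltr_pMr ?ltrDl ?invr_gt0 ?ltr0n// (lt_le_trans A0).
have c1 : x * (1 + n.+1%:R^-1) @[n --> \oo] --> x.
  have H : 1 + n.+1%:R^-1 @[n --> \oo] --> (1 + 0 : R).
    by apply: cvgD; [exact: cvg_cst|exact: cvg_harmonic].
  by rewrite -[X in _ --> X]mulr1 -[X in _ * X]addr0; apply: cvgM => //; exact: cvg_cst.
have c2 : g (x * (1 + n.+1%:R^-1)) @[n --> \oo] --> g x by apply: (cvg_comp _ _ c1); exact: cg.
have c3 : g (x * (1 + n.+1%:R^-1)) @[n --> \oo] --> (0 : R).
  by apply: cvg_near_cst; apply: nearW => n; exact: E.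
exact: (cvg_unique _ c2 c3).
Qed.

Variable psi : R -> R.
Hypothesis Lpsi : L1 leb psi.

Lemma L1_wavelet (a b : R) : 0 < a -> L1 leb (fun t => psi ((t - b) / a)).
Proof.
move=> a0; have k0 : a^-1 != 0 by rewrite invr_eq0 gt_eqF.
have [H _] := Int_affine (- b / a) k0 Lpsi.
rewrite (_ : (fun t => _) = (fun x => psi (a^-1 * x + - b / a)))//.
by apply/funext => t; rewrite mulrDl [a^-1 * _]mulrC.
Qed.

Lemma FT_wavelet (a b l : R) : 0 < a ->
  FT_re (fun t => psi ((t - b) / a)) l =
    a * (cos (l * b) * FT_re psi (l * a) + sin (l * b) * FT_im psi (l * a)) /\
  FT_im (fun t => psi ((t - b) / a)) l =
    a * (cos (l * b) * FT_im psi (l * a) - sin (l * b) * FT_re psi (l * a)).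
Proof.
move=> a0; have k0 : a^-1 != 0 by rewrite invr_eq0 gt_eqF.
have [Lc Ls] := L1_trig (l * a) Lpsi.
have E t : l * t = l * a * (a^-1 * t + - b / a) + l * b by field; rewrite gt_eqF.
have E2 t : (t - b) / a = a^-1 * t + - b / a by rewrite mulrDl [a^-1 * _]mulrC.
have aN : `|a^-1|^-1 = a by rewrite gtr0_norm ?invr_gt0// invrK.
split.
  have L : L1 leb (fun u => cos (l * b) * (cos (l * a * u) * psi u) - sin (l * b) * (sin (l * a * u) * psi u)).
    by apply: L1B; exact: L1Z.
  have [_ H] := Int_affine (- b / a) k0 L; rewrite aN in H.
  rewrite [X in _ = a * X]IntB in H; [|by apply: L1Z|by apply: L1Z]; rewrite [X in _ = a * (X - _)]IntZ// [X in _ = a * (_ - X)]IntZ// in H.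
  rewrite /FT_im mulrN /FT_re -H; apply: eq_Int => t; rewrite E2 [in LHS]E cosD; ring.
have L : L1 leb (fun u => - cos (l * b) * (sin (l * a * u) * psi u) - sin (l * b) * (cos (l * a * u) * psi u)).
  by apply: L1B; exact: L1Z.
have [_ H] := Int_affine (- b / a) k0 L; rewrite aN in H.
rewrite [X in _ = a * X]IntB in H; [|by apply: L1Z|by apply: L1Z]; rewrite [X in _ = a * (X - _)]IntZ// [X in _ = a * (_ - X)]IntZ// in H.
have -> : FT_im (fun t => psi ((t - b) / a)) l = Int leb (fun t => - (sin (l * t) * psi ((t - b) / a))).
  by rewrite /FT_im IntN//; exact: (L1_trig l (L1_wavelet b a0)).2.
rewrite /FT_im mulrN -mulNr /FT_re -H; apply: eq_Int => t; rewrite E2 [in LHS]E sinD; ring.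
Qed.

Lemma FT_abs2_even l : FT_abs2 psi (- l) = FT_abs2 psi l.
Proof.
rewrite /FT_abs2; congr (_ + _).
  by congr (_ ^+ 2); apply: eq_Int => t; rewrite mulNr cosN.
rewrite /FT_im !sqrrN; set I := Int _ _; have -> : I = - Int leb (fun t => sin (l * t) * psi t).
  by rewrite -IntN; [apply: eq_Int => t; rewrite mulNr sinN mulNr|exact: (L1_trig l Lpsi).2].
by rewrite sqrrN.
Qed.

Lemma FT_abs2_ge0 l : 0 <= FT_abs2 psi l.
Proof. by rewrite addr_ge0// sqr_ge0. Qed.

Lemma FT_abs2_continuous : continuous (FT_abs2 psi).
Proof.
move=> x; apply: cvgD; rewrite expr2.
  by apply: cvgM; exact: FT_re_continuous.
by apply: cvgM; exact: FT_im_continuous.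
Qed.

Lemma FT_abs2_bounded : exists2 S, 0 < S & forall l, FT_abs2 psi l <= S.
Proof.
pose s := Int leb (fun t => `|psi t|).
exists (s ^+ 2 + s ^+ 2 + 1) => [|l]; first by rewrite ltr_wpDl// addr_ge0// sqr_ge0.
have [h1 h2] := FT_bounds l Lpsi; rewrite -/s in h1 h2.
have sq x : `|x| <= s -> x ^+ 2 <= s ^+ 2.
  by move=> xs; rewrite -real_normK ?num_real// lerXn2r ?nnegrE// (le_trans _ xs).
by rewrite /FT_abs2; have := sq _ h1; have := sq _ h2; lra.
Qed.

Lemma meas_FT_abs2 : measurable_fun setT (FT_abs2 psi).
Proof. exact: continuous_measurable_fun FT_abs2_continuous. Qed.

Variables (f : R -> R) (c : R).
Hypotheses (Lf : L1 leb f) (f0 : forall l, 0 <= f l) (c0 : 0 < c).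

(* With [l = eta / (c * g)], the covariance of two coefficients of scale [a] at
   distance [g * z] is the [z]-th Fourier coefficient of [symbol a g]. *)
Definition symbol (a g x : R) : R := a / (c * g) * (f (x / (c * g)) * FT_abs2 psi (a / (c * g) * x)).

Let LF (a : R) : L1 leb (fun l => a * (FT_abs2 psi (l * a) * f l)).
Proof.
have [S S0 HS] := FT_abs2_bounded; apply: L1Z.
apply: (@L1Mb _ _ R leb S) => [//||l]; last by rewrite ger0_norm ?FT_abs2_ge0.
by apply: (measurableT_comp meas_FT_abs2); mfun.
Qed.

Lemma L1_symbol (a g : R) : 0 < g -> L1 leb (symbol a g).
Proof.
move=> g0; have k0 : (c * g)^-1 != 0 by rewrite invr_eq0 mulf_neq0// gt_eqF.
have [H _] := Int_affine 0 k0 (LF a).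
have := L1Z (c * g)^-1 H; congr (L1 _ _); apply/funext => x.
rewrite /symbol addr0 [_ ^-1 * x]mulrC; have -> : x / (c * g) * a = a / (c * g) * x by field; rewrite !gt_eqF.
by field; rewrite !gt_eqF.
Qed.

Lemma coef_symbol (a g : R) (z : int) : 0 < a -> 0 < g ->
  coef c true z (symbol a g) = a * Int leb (fun l => cos (l * (g * z%:~R)) * FT_abs2 psi (l * a) * f l).
Proof.
move=> a0 g0; have k0 : (c * g)^-1 != 0 by rewrite invr_eq0 mulf_neq0// gt_eqF.
have L : L1 leb (fun l => cos ((g * z%:~R) * l) * (a * (FT_abs2 psi (l * a) * f l))).
  exact: (@L1_trigM R true).
have [_ H] := Int_affine 0 k0 L.
have e : `|(c * g)^-1|^-1 = c * g by rewrite gtr0_norm ?invr_gt0 ?mulr_gt0// invrK.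
rewrite e in H.
have E x : trig true (z%:~R / c * x) * symbol a g x = (c * g)^-1 *
    (cos (g * z%:~R * ((c * g)^-1 * x + 0)) * (a * (FT_abs2 psi (((c * g)^-1 * x + 0) * a) * f ((c * g)^-1 * x + 0)))).
  rewrite /symbol addr0 /=.
  have -> : g * z%:~R * ((c * g)^-1 * x) = z%:~R / c * x by field; rewrite !gt_eqF.
  have -> : (c * g)^-1 * x * a = a / (c * g) * x by field; rewrite !gt_eqF.
  by rewrite [_ ^-1 * x]mulrC; field; rewrite !gt_eqF.
rewrite /coef (@eq_Int _ _ R leb _ _ E) IntZ; last by exact: (Int_affine 0 k0 L).1.
rewrite H mulKf ?mulf_neq0 ?gt_eqF// -IntZ.
  by apply: eq_Int => l; rewrite [l * (_ * _)]mulrC; ring.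
have [S S0 HS] := FT_abs2_bounded.
apply: (@L1Mb _ _ R leb S) => [//||l].
  apply: measurable_funM; first by mfun.
  by apply: (measurableT_comp meas_FT_abs2); mfun.
rewrite normrM (@ger0_norm _ (FT_abs2 _ _)) ?FT_abs2_ge0//.
apply: le_trans (HS (l * a)); rewrite ler_piMl ?FT_abs2_ge0//; exact: cos_max.
Qed.

Lemma coef_symbol0 (a g : R) : 0 < a -> 0 < g ->
  coef c true 0 (symbol a g) = Int leb (fun x => FT_abs2 psi x * f (x / a)).
Proof.
move=> a0 g0; rewrite coef_symbol//.
have k0 : a^-1 != 0 by rewrite invr_eq0 gt_eqF.
have e : `|a^-1|^-1 = a by rewrite gtr0_norm ?invr_gt0// invrK.
have Lw : L1 leb (fun l => FT_abs2 psi (l * a) * f l).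
  have := L1Z a^-1 (LF a); congr (L1 _ _); apply/funext => x.
  by rewrite mulKf// gt_eqF.
have [_ H] := Int_affine 0 k0 Lw; rewrite e in H.
rewrite [X in a * X](_ : _ = Int leb (fun l => FT_abs2 psi (l * a) * f l)); last first.
  by apply: eq_Int => l; rewrite mulr0 mulr0 cos0 mul1r.
by rewrite -H; apply: eq_Int => x; rewrite addr0 [a^-1 * x]mulrC divfK// gt_eqF.
Qed.

(** The symbol is even, [f] being even and [psi] real; hence [toep] of the symbol is a Frobenius
    norm. *)
Lemma coef_symbol_sin (a g : R) (z : int) : (forall l, f (- l) = f l) -> 0 < g ->
  coef c false z (symbol a g) = 0.
Proof.
move=> fe g0; have L := L1_trigM false (z%:~R / c) (L1_symbol a g0).
have [_ H] := Int_opp L.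
have : coef c false z (symbol a g) = - coef c false z (symbol a g).
  rewrite /coef -[in LHS]H -IntN//; apply: eq_Int => x.
  by rewrite /symbol (mulNr x) (mulrN (a / (c * g))) (mulrN (z%:~R / c)) /= sinN fe FT_abs2_even mulNr.
by move/eqP; rewrite -addr_eq0 -mulr2n mulrn_eq0/= => /eqP.
Qed.

End scaling.

(** * Limits of the symbol and of its Toeplitz forms *)

Section level.
Context {R : realType}.
Notation leb := (@lebesgue_measure R).
Variables (psi f : R -> R) (c A p q K r : R).
Hypotheses (Lpsi : L1 leb psi) (Lf : L1 leb f) (f0 : forall l, 0 <= f l) (fe : forall l, f (- l) = f l)
  (c0 : 0 < c) (A0 : 0 < A) (p0 : 0 <= p) (K0 : 0 <= K) (r0 : 0 < r).
Hypothesis wA : forall x, A < `|x| -> FT_abs2 psi x = 0.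
Hypothesis fT : forall l, `|l| <= r -> `|f l - (p + q * l ^+ 2)| <= K * l ^+ 4.
Let w := FT_abs2 psi.
Let L := c * pi.

Let cw : continuous w. Proof. exact: FT_abs2_continuous. Qed.

Lemma L1_pow_FT k : L1 leb (fun x => x ^+ k * w x).
Proof.
apply: (@L1_cont_supp R _ A) => [|x /wA]; last by rewrite /w => ->; rewrite mulr0.
by move=> x; apply: cvgM; [exact: exprn_continuous|exact: cw].
Qed.

(** On the support of the transform, [x / a] lies in the range of the Taylor expansion as soon as
    [a >= A / r]. *)
Lemma mean_expand : exists C a0, [/\ 0 <= C, 0 < a0 & forall a, a0 <= a ->
  `|Int leb (fun x => w x * f (x / a)) - (p * Int leb w + q * a ^- 2 * Int leb (fun x => x ^+ 2 * w x))|
    <= C * a ^- 4].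
Proof.
have w0 x : 0 <= w x by exact: FT_abs2_ge0.
exists (K * Int leb (fun x => x ^+ 4 * w x)), (A / r).
split.
- by rewrite mulr_ge0// Int_ge0// => x; rewrite mulr_ge0// (exprn_even_ge0 x (n := 4)).
- by rewrite divr_gt0.
move=> a aA; have a0 : 0 < a by apply: lt_le_trans aA; rewrite divr_gt0.
have Lw : L1 leb w.
  by have := L1_pow_FT 0; congr (L1 _ _); apply/funext => x; rewrite expr0 mul1r.
have B x : `|w x * f (x / a) - (p * w x + q * a ^- 2 * (x ^+ 2 * w x))| <= K * a ^- 4 * (x ^+ 4 * w x).
  have [xA|xA] := leP `|x| A; last by rewrite /w wA// !(mulr0, mul0r, addr0) subr0 normr0.
  have h := @fT (x / a) _.
  have -> : w x * f (x / a) - (p * w x + q * a ^- 2 * (x ^+ 2 * w x)) =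
    (f (x / a) - (p + q * (x / a) ^+ 2)) * w x by field; rewrite gt_eqF.
  have -> : K * a ^- 4 * (x ^+ 4 * w x) = K * (x / a) ^+ 4 * w x by field; rewrite gt_eqF.
  rewrite normrM (ger0_norm (w0 x)) ler_wpM2r// h//.
  rewrite normrM normfV (gtr0_norm a0) ler_pdivrMr//.
  by move: aA; rewrite ler_pdivrMr// mulrC; exact: le_trans.
have L2 := L1_pow_FT 2; have L4 := L1_pow_FT 4.
have mw : measurable_fun setT w by exact: meas_FT_abs2.
have mf : measurable_fun setT (fun x : R => f (x / a)).
  by apply: (measurableT_comp (L1_meas Lf)); mfun.
have Lm : L1 leb (fun x => p * w x + q * a ^- 2 * (x ^+ 2 * w x)) by apply: L1D; exact: L1Z.
have LB : L1 leb (fun x => w x * f (x / a) - (p * w x + q * a ^- 2 * (x ^+ 2 * w x))).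
  apply: (@L1_le _ _ R leb _ _ _ B); last exact: L1Z.
  by mfun.
have LWf : L1 leb (fun x => w x * f (x / a)).
  by have := L1D LB Lm; congr (L1 _ _); apply/funext => x; rewrite subrK.
have <- : Int leb (fun x => p * w x + q * a ^- 2 * (x ^+ 2 * w x)) =
    p * Int leb w + q * a ^- 2 * Int leb (fun x => x ^+ 2 * w x).
  by rewrite IntD ?IntZ//; exact: L1Z.
rewrite -IntB//.
have -> : K * Int leb (fun x => x ^+ 4 * w x) * a ^- 4 = Int leb (fun x => K * a ^- 4 * (x ^+ 4 * w x)).
  by rewrite IntZ//; ring.
by apply: Int_abs_le => //; [exact: L1_meas LB|exact: L1Z].
Qed.

Variables (S : R) (N : nat).
Hypotheses (S0 : 0 < S) (wS : forall l, FT_abs2 psi l <= S) (N0 : (0 < N)%N) (AN : 2 * A < N%:R * L).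
Let T := N%:R * L.

Variables (a g : nat -> R) (M : nat -> nat).
Hypotheses (a0 : forall j, 0 < a j) (g0 : forall j, 0 < g j)
  (aoo : a j @[j --> \oo] --> +oo) (ag : a j / g j @[j --> \oo] --> c).

(** With [s = a / (c g) --> 1], the error splits into the variation of [f] near 0, of order [1 / a],
    the factor [s - 1], and the modulus of continuity of [w]. Since [s >= 1 / 2], the symbol lives
    in [[-2 A, 2 A]], which [AN] places inside the box. *)
Lemma symbol_close e : 0 < e -> \forall j \near \oo, forall x,
  `|symbol psi f c (a j) (g j) x - p * w x| <= e * box T x.
Proof.
move=> e0.
have w0 x : 0 <= w x by exact: FT_abs2_ge0.
have L0 : 0 < L by rewrite mulr_gt0 ?pi_gt0.
have T0 : 0 < T by rewrite mulr_gt0 ?ltr0n.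
have e1 : 0 < e / 4 / (p + 1) by rewrite !divr_gt0// ltr_wpDl.
have [K1 K10 H1] := unif_lip cw wA e1.
have cr : a j / (c * g j) @[j --> \oo] --> (1 : R).
  rewrite (_ : (fun j => a j / (c * g j)) = (fun j => c^-1 * (a j / g j))); last first.
    by apply/funext => j; field; rewrite !gt_eqF.
  rewrite -(@mulVf _ c) ?gt_eqF//; apply: cvgM => //; exact: cvg_cst.
pose Cf := `|q| + K.
have Cf0 : 0 <= Cf by rewrite addr_ge0.
have fC l : `|l| <= Num.min r 1 -> `|f l - p| <= Cf * `|l|.
  rewrite le_min => /andP[lr l1]; have := fT lr.
  have l2 : l ^+ 2 <= `|l|.
    by rewrite -real_normK ?num_real// expr2 ler_piMl.
  have l4 : l ^+ 4 <= `|l|.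
    rewrite -[4%N]/(2 * 2)%N exprM; apply: (le_trans _ l2).
    rewrite expr2 ler_piMl ?sqr_ge0//; exact: le_trans l2 l1.
  move=> h; rewrite [f l - p](_ : _ = (f l - (p + q * l ^+ 2)) + q * l ^+ 2); last by ring.
  apply: (le_trans (ler_normD _ _)); rewrite /Cf mulrDl addrC; apply: lerD.
    by rewrite normrM ler_wpM2l// ger0_norm ?sqr_ge0.
  by apply: (le_trans h); rewrite ler_wpM2l.
(* The bound [1 / 2] keeps [s] between [1 / 2] and 2; the other two make the errors proportional to
   [s - 1] at most [e / 4] each. *)
pose d := Num.min (1 / 2) (Num.min (e / 4 / (p * K1 * T + 1)) (e / 4 / (S * p + 1))).
have q1 : 0 < p * K1 * T + 1 by rewrite ltr_wpDl//; apply: mulr_ge0; [exact: mulr_ge0|exact: ltW].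
have q2 : 0 < S * p + 1 by rewrite ltr_wpDl// mulr_ge0// ltW.
have d0 : 0 < d by rewrite /d !lt_min !divr_gt0.
pose m := Num.min r 1; have m0 : 0 < m by rewrite /m lt_min r0 ltr01.
near=> j.
have rd : `|1 - a j / (c * g j)| <= d by near: j; move/cvgrPdist_le: cr; exact.
have aB1 : 2 * T / m <= a j by near: j; move/cvgryPge: aoo; exact.
have aB2 : S * 2 * Cf * T * 2 / (e / 4) <= a j by near: j; move/cvgryPge: aoo; exact.
move=> x; rewrite /symbol.
have [s sE] : exists s, s = a j / (c * g j) by exists (a j / (c * g j)).
rewrite -sE in rd *.
have [d1 d2 d3] : [/\ d <= 1 / 2, d <= e / 4 / (p * K1 * T + 1) & d <= e / 4 / (S * p + 1)].
  by rewrite /d !ge_min !lexx !orbT.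
have [s1 s2] : 1 / 2 <= s /\ s <= 2 by move: rd; rewrite ler_norml => /andP[? ?]; split; lra.
have s0 : 0 < s by lra.
rewrite boxE; have [/andP[x1 x2]|xT] := boolP (- T <= x < T); last first.
  have xA : 2 * A < `|x|.
    apply: (lt_le_trans AN); rewrite leNgt; apply: contra xT; rewrite -/T ltr_norml => /andP[h1 ->].
    by rewrite (ltW h1).
  have A0' : 0 < A := A0.
  have wx : w x = 0 by apply: wA; lra.
  have ws : FT_abs2 psi (s * x) = 0.
    apply: wA; rewrite normrM gtr0_norm//; apply: (@lt_le_trans _ _ (1 / 2 * `|x|)); last by rewrite ler_wpM2r.
    by move: xA; lra.
  by rewrite wx ws !mulr0 subr0 normr0.
rewrite mulr1.
have xT : `|x| <= T by rewrite ler_norml x1 ltW.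
have xg : `|x / (c * g j)| <= T * 2 / a j.
  have -> : x / (c * g j) = x * s / a j by rewrite sE; field; rewrite !gt_eqF.
  rewrite !normrM normfV (gtr0_norm (a0 j)) (gtr0_norm s0) ler_pM2r ?invr_gt0//.
  by apply: ler_pM => //; exact: ltW.
have xm : `|x / (c * g j)| <= m.
  apply: (le_trans xg); rewrite ler_pdivrMr//; move: aB1; rewrite ler_pdivrMr//.
  by rewrite [T * 2]mulrC [m * _]mulrC.
have hf := fC _ xm.
set y := f _ in hf *.
rewrite -/w [X in `|X|](_ : _ = s * (y - p) * w (s * x) + (s - 1) * p * w (s * x) + p * (w (s * x) - w x)); last by ring.
have b1 : `|s * (y - p) * w (s * x)| <= e / 4.
  rewrite !normrM (gtr0_norm s0) (ger0_norm (w0 _)).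
  apply: (@le_trans _ _ (2 * (Cf * (T * 2 / a j)) * S)).
    apply: ler_pM; [by rewrite mulr_ge0// ltW|exact: w0| |exact: wS].
    apply: ler_pM => //; first exact: ltW.
    by apply: (le_trans hf); rewrite ler_wpM2l.
  move: aB2; rewrite ler_pdivrMr ?divr_gt0// => aB2.
  rewrite [leLHS](_ : _ = S * 2 * Cf * T * 2 / a j); last by ring.
  by rewrite ler_pdivrMr// [e / 4 * _]mulrC.
have rd' : `|s - 1| <= d by rewrite distrC.
have b2 : `|(s - 1) * p * w (s * x)| <= e / 4.
  rewrite !normrM (ger0_norm p0) (ger0_norm (w0 _)).
  apply: (@le_trans _ _ (d * p * S)).
    by apply: ler_pM; [rewrite mulr_ge0|exact: w0|rewrite ler_wpM2r|exact: wS].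
  move: d3; rewrite ler_pdivlMr// => d3; rewrite -mulrA [p * S]mulrC.
  by apply: le_trans d3; rewrite ler_wpM2l ?(ltW d0)//; lra.
have b3 : `|p * (w (s * x) - w x)| <= e / 4 + e / 4.
  rewrite normrM (ger0_norm p0).
  have h := H1 (s * x) x.
  have h2 : `|s * x - x| <= d * T.
    by rewrite -{2}[x]mul1r -mulrBl normrM; apply: ler_pM.
  apply: (@le_trans _ _ (p * (e / 4 / (p + 1)) + p * K1 * T * d)).
    have -> : p * K1 * T * d = p * (K1 * (d * T)) by ring.
    by rewrite -mulrDr ler_wpM2l// (le_trans h)// lerD2l ler_wpM2l.
  apply: lerD.
    rewrite mulrA ler_pdivrMr ?ltr_wpDl//.
    by rewrite mulrDr mulr1 mulrC lerDl divr_ge0// ltW.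
  move: d2; rewrite ler_pdivlMr// => d2; rewrite mulrC.
  by apply: le_trans d2; rewrite ler_wpM2l ?(ltW d0)//; lra.
apply: (le_trans (ler_normD _ _)).
have := ler_normD (s * (y - p) * w (s * x)) ((s - 1) * p * w (s * x)).
lra.
Unshelve. all: by end_near. Qed.

Let L0 : 0 < L. Proof. by rewrite mulr_gt0 ?pi_gt0. Qed.
Let T0 : 0 < T. Proof. by apply: mulr_gt0 => //; rewrite ltr0n. Qed.

Let AN' : A < (2 * N%:R - 1) * L.
Proof.
have N1 : 1 <= N%:R :> R by rewrite ler1n.
have : N%:R * L <= (2 * N%:R - 1) * L by rewrite ler_pM2r//; lra.
by have A0' := A0; move: AN; lra.
Qed.

Let w_box x : `|p * w x| <= p * S * box T x.
Proof.
have w0 : 0 <= w x by exact: FT_abs2_ge0.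
rewrite normrM (ger0_norm p0) (ger0_norm w0) boxE.
have [xT|xT] := boolP (- T <= x < T); first by rewrite mulr1 ler_wpM2l.
rewrite /w wA ?mulr0//.
have : N%:R * L <= `|x|.
  rewrite leNgt; apply: contra xT; rewrite -/T ltr_norml => /andP[h1 ->].
  by rewrite (ltW h1).
by have A0' := A0; move: AN; lra.
Qed.

Lemma symbol_opbound : \forall j \near \oo, forall m (u : 'I_m -> R),
  0 <= \sum_k \sum_l u k * u l * coef c true ((k : nat)%:Z - (l : nat)%:Z) (symbol psi f c (a j) (g j)) <=
    (1 + p * S) * (2 * T) * \sum_k u k ^+ 2.
Proof.
apply: filterS (symbol_close ltr01) => j H m u.
apply: toep_opbound => //; first exact: L1_symbol.
move=> x; apply/andP; split.
  by rewrite /symbol mulr_ge0 ?divr_ge0 ?mulr_ge0 ?FT_abs2_ge0// ltW.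
have := H x; rewrite mul1r ler_distl => /andP[_ h]; apply: (le_trans h).
rewrite mulrDl mul1r addrC lerD2l; apply: le_trans (w_box x); exact: ler_norm.
Qed.

Hypothesis Moo : ((M j)%:R : R) @[j --> \oo] --> +oo.

(** By uniform closeness the symbol may be replaced by [p * w]; [toep] sees only Fourier
    coefficients, so [p * w] may be folded, and the Fejer average of the folded function
    converges. *)
Lemma toep_symbol_cvg :
  toep c (M j) (symbol psi f c (a j) (g j)) (symbol psi f c (a j) (g j)) @[j --> \oo] -->
  2 * L * (p ^+ 2 * Int leb (fun x => persum c w N x ^+ 2 * box L x)).
Proof.
have Lw : L1 leb w.
  by have := L1_pow_FT 0; congr (L1 _ _); apply/funext => x; rewrite expr0 mul1r.
have Lpw : L1 leb (fun x => p * w x) by exact: L1Z.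
pose H x := p * persum c w N x.
have mw : measurable_fun setT w by exact: meas_FT_abs2.
have mpers : measurable_fun setT (persum c w N).
  rewrite /persum; apply: measurable_sum => n.
  by apply: measurable_funD; apply: (measurableT_comp mw); mfun.
have mH : measurable_fun setT H by rewrite /H; mfun.
have wS' l : `|w l| <= S by rewrite ger0_norm ?FT_abs2_ge0// wS.
have pS x : `|persum c w N x| <= \sum_(0 <= n < N) (S + S).
  by apply: (le_trans (ler_norm_sum _ _ _)); apply: ler_sum => n _;
     apply: (le_trans (ler_normD _ _)); exact: lerD.
have HS x : `|H x| <= p * \sum_(0 <= n < N) (S + S).
  by rewrite normrM (ger0_norm p0) ler_wpM2l.
have osc e : 0 < e -> exists2 K, 0 <= K & forall x y, - L <= x < L -> - L <= y < L ->
     (H x - H y) ^+ 2 <= e + K * (1 - cos ((x - y) / c)).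
  move=> e0; have e1 : 0 < e / (p ^+ 2 + 1) by rewrite divr_gt0// ltr_wpDl// sqr_ge0.
  have [K1 K10 HK] := persum_osc c0 wA AN' (fun e => unif_lip cw wA) (ex_intro _ S wS') e1.
  exists (p ^+ 2 * K1) => [|x y hx hy]; first by rewrite mulr_ge0// sqr_ge0.
  rewrite /H -mulrBr exprMn; apply: (le_trans (ler_wpM2l (sqr_ge0 p) (HK x y hx hy))).
  rewrite mulrDr -[p ^+ 2 * K1 * _]mulrA lerD2r mulrCA -[leRHS]mulr1 ler_wpM2l ?(ltW e0)//.
  by rewrite ler_pdivrMr ?ltr_wpDl ?sqr_ge0// mul1r lerDl.
have C1 := toep_cvg_box c0 mH HS osc Moo.
rewrite [X in _ --> X](_ : _ = 2 * L * Int leb (fun x => H x ^+ 2 * box (c * pi) x)); last first.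
  congr (_ * _); rewrite -IntZ.
    by apply: eq_Int => x; rewrite /H -/L; ring.
  apply: (@L1Mb _ _ R leb ((\sum_(0 <= n < N) (S + S)) ^+ 2)) => [||x].
  - exact: L1_box.
  - by mfun.
  - by rewrite normrX lerXn2r ?nnegrE// (le_trans (normr_ge0 _) (pS x)).
have EQ j : toep c (M j) (fun x => H x * box (c * pi) x) (fun x => H x * box (c * pi) x) =
    toep c (M j) (fun x => p * w x) (fun x => p * w x).
  apply: eq_toep => b z.
  have LH : L1 leb (fun x => persum c w N x * box (c * pi) x).
    by apply: (@L1Mb _ _ R leb (\sum_(0 <= n < N) (S + S))) => [//||x]; [exact: L1_box|exact: mpers|exact: pS].
  rewrite coefZ// (coef_persum c0 _ _ Lw wA AN') -coefZ//.
  by apply: eq_Int => x; rewrite /H; ring.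
rewrite (eq_cvg _ _ EQ) in C1.
apply/cvgrPdist_le => e e0.
have Moo' := Moo.
(* A perturbation of the symbol of size [e1 <= 1] changes [toep] by at most [e1 * B], a difference
   of squares being factored. *)
pose B := (1 + 2 * (p * S)) * (2 * T) ^+ 2 + 1.
have pS0 : 0 <= p * S by rewrite mulr_ge0// ltW.
have T2 : 0 <= (2 * T) ^+ 2 by exact: sqr_ge0.
have B0 : 0 < B by rewrite /B ltr_wpDl// mulr_ge0//; lra.
pose e1 := Num.min 1 (e / 2 / B).
have e10 : 0 < e1 by rewrite /e1 lt_min ltr01 !divr_gt0.
have e11 : e1 <= 1 by rewrite /e1 ge_min lexx.
have e12 : e1 * B <= e / 2.
  by rewrite -ler_pdivlMr// /e1 ge_min lexx orbT.
near=> j.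
have h1 : `|2 * L * Int leb (fun x => H x ^+ 2 * box (c * pi) x) - toep c (M j) (fun x => p * w x) (fun x => p * w x)| <= e / 2.
  by near: j; move/cvgrPdist_le: C1; apply; rewrite divr_gt0.
have h2 : forall x, `|symbol psi f c (a j) (g j) x - p * w x| <= e1 * box T x.
  by near: j; exact: symbol_close.
have M1 : (0 < M j)%N.
  rewrite -(ltr0n R); apply: (@lt_le_trans _ _ 1) => //.
  by near: j; move/cvgryPge: Moo'; exact.
have Ls : L1 leb (symbol psi f c (a j) (g j)) by exact: L1_symbol.
have h3 : `|toep c (M j) (symbol psi f c (a j) (g j)) (symbol psi f c (a j) (g j)) -
     toep c (M j) (fun x => p * w x) (fun x => p * w x)| <= e / 2.
  rewrite toep_sqrB//.
  apply: (@le_trans _ _ (e1 * (e1 + 2 * (p * S)) * (2 * T) ^+ 2)).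
    apply: toep_bound => //; [exact: L1B|exact: L1D|].
    move=> x.
    rewrite (_ : _ + _ = (symbol psi f c (a j) (g j) x - p * w x) + 2 * (p * w x)); last by ring.
    apply: (le_trans (ler_normD _ _)); rewrite [leRHS]mulrDl; apply: lerD; first exact: h2.
    by rewrite normrM -mulrA (ger0_norm (_ : 0 <= 2))// ler_wpM2l.
  apply: le_trans e12; rewrite -mulrA ler_wpM2l ?(ltW e10)// /B.
  apply: (@le_trans _ _ ((1 + 2 * (p * S)) * (2 * T) ^+ 2)); last by rewrite lerDl.
  by rewrite ler_wpM2r// lerD2r.
rewrite (_ : _ - _ = (2 * L * Int leb (fun x => H x ^+ 2 * box (c * pi) x) - toep c (M j) (fun x => p * w x) (fun x => p * w x))
  - (toep c (M j) (symbol psi f c (a j) (g j)) (symbol psi f c (a j) (g j)) -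
     toep c (M j) (fun x => p * w x) (fun x => p * w x))); last by ring.
by apply: (le_trans (ler_normB _ _)); lra.
Unshelve. all: by end_near. Qed.

End level.

(** * Growth of the scales, size of the window, and bias *)

Section truncation.
Context {R : realType}.

Lemma truncn_cvgy (x : nat -> R) : x j @[j --> \oo] --> +oo ->
  ((Num.truncn (x j))%:R : R) @[j --> \oo] --> +oo.
Proof.
move=> xoo; apply/cvgryPge => B; move/cvgryPge: xoo => /(_ (B + 1)).
apply: filterS => j h; have := truncnS_gt (x j); rewrite -natr1; lra.
Qed.

(** The integer part changes [x] by less than 1, negligible in ratio; this disposes of the rounding
    in [M_j]. *)
Lemma truncn_ratio (x : nat -> R) : x j @[j --> \oo] --> +oo ->
  x j / (Num.truncn (x j))%:R @[j --> \oo] --> (1 : R).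
Proof.
move=> xoo; apply/cvgrPdist_le => e e0.
move/cvgryPge: (truncn_cvgy xoo) => /(_ (1 + e^-1)).
apply: filterS => j h; have ei : 0 < e^-1 by rewrite invr_gt0.
set k : R := (Num.truncn (x j))%:R in h *.
have k0 : 0 < k by lra.
have x0 : 0 <= x j.
  by rewrite -truncn_le; move: k0; rewrite /k ltr0n => k0; move: (k0); rewrite truncn_gt0 => x1;
    rewrite truncn_le (le_trans _ x1).
have h1 : k <= x j by rewrite truncn_le.
have h2 : x j < k + 1 by rewrite natr1 truncnS_gt.
have h3 : 1 <= e * k.
  by rewrite -ler_pdivrMl// mulr1; lra.
have -> : 1 - x j / k = - ((x j - k) / k) by field; rewrite gt_eqF.
rewrite normrN ger0_norm ?divr_ge0 ?subr_ge0 ?(ltW k0)// ler_pdivrMr//; lra.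
Qed.

End truncation.

Section scales.
Context {R : realType}.
Variables (a : nat -> R) (m : nat -> nat) (rho : R).
Hypotheses (a0 : forall j, 0 < a j) (aoo : a j @[j --> \oo] --> +oo)
  (ai : forall j, a j < a j.+1) (rho1 : 1 < rho)
  (ar : \forall j \near \oo, rho <= a j.+1 / a j)
  (m0 : forall j, (0 < m j)%N) (ma : (m j)%:R / a j ^+ 4 @[j --> \oo] --> (0 : R)).

Definition gap (j : nat) : R := a j.+1 ^- 2 - a j.+2 ^- 2.

Lemma gap_gt0 j : 0 < gap j.
Proof.
rewrite subr_gt0 ltf_pV2 ?posrE ?exprn_gt0//.
by rewrite ltrXn2r ?nnegrE ?ltW.
Qed.

Lemma gap_le j : gap j <= a j.+1 ^- 2.
Proof. by rewrite lerBlDr lerDl invr_ge0 exprn_ge0// ltW. Qed.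

(** Geometric growth of the scales makes the gap comparable to [a j.+1 ^- 2]. *)
Lemma gap_ge : \forall j \near \oo, (1 - rho ^- 2) * a j.+1 ^- 2 <= gap j.
Proof.
have ar' : \forall j \near \oo, rho <= a j.+2 / a j.+1.
  by case: ar => n _ Hn; exists n => // j nj; apply: Hn; exact: leqW.
apply: filterS ar' => j h; rewrite mulrBl mul1r lerD2l lerN2.
have r0 : 0 < rho by exact: lt_trans rho1.
rewrite -invfM -exprMn lef_pV2 ?posrE ?exprn_gt0 ?mulr_gt0//.
move: h; rewrite ler_pdivlMr// => h.
by rewrite lerXn2r ?nnegrE ?mulr_ge0// ltW.
Qed.

Lemma window_cvgy : (m j)%:R / gap j ^+ 2 @[j --> \oo] --> +oo.
Proof.
apply/cvgryPge => B; move/cvgryPge: aoo => /(_ (Num.max 1 B)) [n _ Hn].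
exists n => // j nj /=; have := Hn j.+1 (leqW nj); rewrite /= ge_max => /andP[a1 aB].
apply: (le_trans aB); rewrite ler_pdivlMr ?exprn_gt0 ?gap_gt0//.
have g1 := gap_le j; have g0 := gap_gt0 j; have aj := a0 j.+1.
have m1 : 1 <= (m j)%:R :> R by rewrite ler1n.
apply: le_trans m1.
(* For [a >= 1] and a gap at most [a ^- 2], the product [a * gap ^+ 2] is at most
   [a ^- 3 <= 1 <= m]. *)
apply: (@le_trans _ _ (a j.+1 * (a j.+1 ^- 2) ^+ 2)).
  by rewrite ler_wpM2l ?(ltW aj)// lerXn2r ?nnegrE ?(ltW g0)// (le_trans (ltW g0)).
rewrite -exprVn -exprM -[leRHS](@expr1n _ 3).
have -> : a j.+1 * (a j.+1)^-1 ^+ (2 * 2) = (a j.+1)^-1 ^+ 3 by field; rewrite gt_eqF.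
by rewrite lerXn2r ?nnegrE ?invr_ge0 ?(ltW aj)// invf_le1.
Qed.

(** The constant [p] cancels, the quadratic terms give exactly [q], and the remainders of order
    [a ^- 4], divided by a gap of order [a ^- 2], leave a multiple of the square root of
    [m / a ^+ 4]. *)
Lemma bias_cvg0 (V1 V2 : nat -> R) (p q C : R) : 0 <= C ->
  (\forall j \near \oo, `|V1 j - (p + q * a j.+1 ^- 2)| <= C * a j.+1 ^- 4) ->
  (\forall j \near \oo, `|V2 j - (p + q * a j.+2 ^- 2)| <= C * a j.+2 ^- 4) ->
  Num.sqrt (m j)%:R * ((V1 j - V2 j) / gap j - q) @[j --> \oo] --> (0 : R).
Proof.
move=> C0 H1 H2; have r0 : 0 < rho by exact: lt_trans rho1.
pose th : R := 1 - rho ^- 2.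
have th0 : 0 < th by rewrite subr_gt0 invf_lt1 ?exprn_gt0// exprn_egt1.
have sq : Num.sqrt ((m j)%:R / a j ^+ 4) @[j --> \oo] --> (0 : R).
  by rewrite -[X in _ --> X](@sqrtr0 R); apply: (cvg_comp _ _ ma); exact: sqrt_continuous.
apply/norm_cvg0P.
have up : 2 * C / th * Num.sqrt ((m j)%:R / a j ^+ 4) @[j --> \oo] --> (0 : R).
  by rewrite -(mulr0 (2 * C / th)); apply: cvgM => //; exact: cvg_cst.
apply: (squeeze_cvgr _ (@cvg_cst _ _ _ _ _) up).
near=> j; rewrite normr_ge0/=.
have h1 : `|V1 j - (p + q * a j.+1 ^- 2)| <= C * a j.+1 ^- 4 by near: j.
have h2 : `|V2 j - (p + q * a j.+2 ^- 2)| <= C * a j.+2 ^- 4 by near: j.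
have h3 : (1 - rho ^- 2) * a j.+1 ^- 2 <= gap j by near: j; exact: gap_ge.
have g0 := gap_gt0 j; have aj := a0 j.
have a10 : 0 < a j.+1 by [].
have -> : (V1 j - V2 j) / gap j - q =
  ((V1 j - (p + q * a j.+1 ^- 2)) - (V2 j - (p + q * a j.+2 ^- 2))) / gap j.
  rewrite -[q in LHS](mulfK (lt0r_neq0 g0)) -mulrBl; congr (_ / _); rewrite /gap; ring.
rewrite normrM normrM normfV (gtr0_norm g0) (ger0_norm (sqrtr_ge0 _)).
have h4 : C * a j.+2 ^- 4 <= C * a j.+1 ^- 4.
  by rewrite ler_wpM2l// lef_pV2 ?posrE ?exprn_gt0// lerXn2r ?nnegrE ?ltW.
have h5 : `|(V1 j - (p + q * a j.+1 ^- 2)) - (V2 j - (p + q * a j.+2 ^- 2))| <= 2 * C * a j.+1 ^- 4.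
  by apply: (le_trans (ler_normB _ _)); lra.
have h6 : `|(V1 j - (p + q * a j.+1 ^- 2)) - (V2 j - (p + q * a j.+2 ^- 2))| / gap j <= 2 * C / th * a j ^- 2.
  rewrite ler_pdivrMr//; apply: (le_trans h5).
  apply: (@le_trans _ _ (2 * C / th * a j.+1 ^- 2 * (th * a j.+1 ^- 2))).
    by rewrite le_eqVlt; apply/orP; left; apply/eqP; field; rewrite !gt_eqF.
  have c0 : 0 <= 2 * C / th by rewrite divr_ge0 ?mulr_ge0// ltW.
  apply: ler_pM => //.
  - by rewrite mulr_ge0// invr_ge0 exprn_ge0// ltW.
  - by rewrite mulr_ge0 ?(ltW th0)// invr_ge0 exprn_ge0// ltW.
  - by rewrite ler_wpM2l// lef_pV2 ?posrE ?exprn_gt0// lerXn2r ?nnegrE ?ltW.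
rewrite [leRHS](_ : _ = Num.sqrt (m j)%:R * (2 * C / th * a j ^- 2)).
  by rewrite ler_wpM2l.
rewrite sqrtrM// -exprVn -[4%N]/(2 * 2)%N exprM sqrtr_sqr ger0_norm ?sqr_ge0// exprVn; ring.
Unshelve. all: by end_near. Qed.

End scales.

(** * Covariances within a scale and between scales *)

Section covariance.
Context {R : realType}.
Notation leb := (@lebesgue_measure R).
Variables (psi f : R -> R) (c : R).
Hypotheses (Lpsi : L1 leb psi) (Lf : L1 leb f) (c0 : 0 < c).
Let wav (a b : R) : R -> R := fun t => psi ((t - b) / a).
Let cov (a b a' b' : R) : R := (Num.sqrt a)^-1 * (Num.sqrt a')^-1 * Int leb (fun l =>
  (FT_re (wav a b) l * FT_re (wav a' b') l + FT_im (wav a b) l * FT_im (wav a' b') l) * f l).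

Lemma cov_same_scale (a g b b' : R) (z : int) : 0 < a -> 0 < g -> b - b' = g * z%:~R ->
  cov a b a b' = coef c true z (symbol psi f c a g).
Proof.
move=> a0 g0 bz; rewrite (coef_symbol Lpsi Lf c0)// /cov -invfM -expr2 sqr_sqrtr ?(ltW a0)//.
set J := Int leb _; have -> : J = Int leb (fun l => a ^+ 2 * (cos (l * (g * z%:~R)) * FT_abs2 psi (l * a) * f l)).
  apply: eq_Int => l; rewrite /wav; have [-> ->] := FT_wavelet Lpsi b l a0.
  have [-> ->] := FT_wavelet Lpsi b' l a0.
  rewrite -bz [l * (b - b')]mulrBr cosB /FT_abs2.
  ring.
have [S S0 HS] := FT_abs2_bounded Lpsi.
rewrite IntZ.
  by rewrite mulrA expr2 mulKf// gt_eqF.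
apply: (@L1Mb _ _ R leb S) => [//||l].
  apply: measurable_funM; first by mfun.
  by apply: (measurableT_comp (meas_FT_abs2 Lpsi)); mfun.
rewrite normrM (@ger0_norm _ (FT_abs2 _ _)) ?FT_abs2_ge0//.
apply: le_trans (HS (l * a)); rewrite ler_piMl ?FT_abs2_ge0//; exact: cos_max.
Qed.

Variables (A B : R).
Hypotheses (B0 : 0 < B) (BA : B < A).
Hypothesis sA : forall l, A < `|l| -> FT_re psi l = 0 /\ FT_im psi l = 0.
Hypothesis sB : forall l, `|l| < B -> FT_re psi l = 0 /\ FT_im psi l = 0.

(** At each frequency one of the two transforms vanishes: either [|l * a| < B], or [|l * a'| >= A]
    because [a' / a >= A / B]. The case of equality is covered by continuity. *)
Lemma cov_distinct_scales (a a' b b' : R) : 0 < a -> 0 < a' -> A / B <= a' / a ->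
  cov a b a' b' = 0 /\ cov a' b' a b = 0.
Proof.
move=> a0 a'0 aa; have A0 : 0 < A by exact: lt_trans BA.
have re0 := continuous_zero_le (FT_re_continuous Lpsi) A0 (fun l h => (sA h).1).
have im0 := continuous_zero_le (FT_im_continuous Lpsi) A0 (fun l h => (sA h).2).
have key l : (FT_re (wav a b) l = 0 /\ FT_im (wav a b) l = 0) \/
             (FT_re (wav a' b') l = 0 /\ FT_im (wav a' b') l = 0).
  have [lB|lB] := ltP `|l * a| B; [left|right].
    by have [h1 h2] := sB lB; have [-> ->] := FT_wavelet Lpsi b l a0; rewrite h1 h2 !mulr0 addr0 subr0 mulr0.
  have lA : A <= `|l * a'|.
    have -> : l * a' = l * a * (a' / a) by field; rewrite gt_eqF.
    have r0 : 0 <= a' / a by rewrite divr_ge0 ?ltW.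
    have AB0 : 0 <= A / B by rewrite divr_ge0 ?ltW.
    have AE : A = B * (A / B) by field; rewrite gt_eqF.
    by rewrite AE normrM (ger0_norm r0); apply: ler_pM => //; rewrite ltW.
  by have [-> ->] := FT_wavelet Lpsi b' l a'0; rewrite re0// im0// !mulr0 addr0 subr0 mulr0.
split; rewrite /cov [X in _ * X](_ : _ = 0) ?mulr0// -[RHS](Int0 leb); apply: eq_Int => l.
  by case: (key l) => -[-> ->]; rewrite ?(mul0r, mulr0) addr0 mul0r.
by case: (key l) => -[-> ->]; rewrite ?(mul0r, mulr0) addr0 mul0r.
Qed.

End covariance.

(** * The quadratic form of the theorem *)

Section toeplitz_matrix.
Context {R : realType}.
Variable c : R.

Definition tmx (M : nat) (g : R -> R) : 'M[R]_M :=
  \matrix_(k, l) coef c true ((k : nat)%:Z - (l : nat)%:Z) g.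

Lemma coefN z (g : R -> R) : coef c true (- z) g = coef c true z g.
Proof. by apply: eq_Int => x; rewrite /= rmorphN/= !mulNr cosN. Qed.

Lemma tmx_tr M g : (tmx M g)^T = tmx M g.
Proof. by apply/matrixP => k l; rewrite !mxE -coefN opprB. Qed.

Lemma tr_tmx M g : \tr (tmx M g) = M%:R * coef c true 0 g.
Proof.
rewrite /mxtrace (eq_bigr (fun=> coef c true 0 g)) => [|k _]; last by rewrite mxE subrr.
by rewrite sumr_const card_ord mulr_natl.
Qed.

Lemma tr_tmx2 M g : (0 < M)%N -> (forall z, coef c false z g = 0) ->
  \tr (mxpw (tmx M g) 2) = M%:R * toep c M g g.
Proof.
move=> M0 g0; rewrite tr_sym2 ?tmx_tr// toepE mulrA divff ?pnatr_eq0 -?lt0n// mul1r.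
by apply: eq_bigr => k _; apply: eq_bigr => l _; rewrite mxE g0 mulr0 addr0 expr2.
Qed.

End toeplitz_matrix.

Section contrast.
Context {R : realType} (M : nat) (nu : R).
Implicit Types S : 'M[R]_M.

(* [quad] with this matrix is [nu] times the difference of the centred sums of squares
   over the two scales. *)
Definition contrast : 'M[R]_(M + M) := block_mx nu%:M 0 0 (- nu)%:M.

Lemma contrast_sym i j : contrast i j = contrast j i.
Proof. by rewrite -[in RHS](trmxK contrast) [in RHS]mxE tr_block_mx !tr_scalar_mx !trmx0. Qed.

Lemma contrastM S1 S2 : contrast *m block_mx S1 0 0 S2 = block_mx (nu *: S1) 0 0 (- nu *: S2).
Proof.
by rewrite mulmx_block !(mul0mx, mulmx0, addr0, add0r) !mul_scalar_mx.
Qed.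

Lemma tr_contrast_pow S1 S2 k : \tr (mxpw (contrast *m block_mx S1 0 0 S2) k) =
  nu ^+ k * \tr (mxpw S1 k) + (- nu) ^+ k * \tr (mxpw S2 k).
Proof. by rewrite contrastM mxpw_block mxtrace_block !mxpwZ !mxtraceZ. Qed.

(** The sign of the second scale is squared away, so the two scales add up in the variance. *)
Lemma tr_contrast2 S1 S2 : \tr (mxpw (contrast *m block_mx S1 0 0 S2) 2) =
  nu ^+ 2 * (\tr (mxpw S1 2) + \tr (mxpw S2 2)).
Proof. by rewrite tr_contrast_pow sqrrN mulrDr. Qed.

(** Odd powers keep the sign of the second block, hence the absolute value. Each factor beyond the
    second costs [nu * b], which tends to 0 in the application. *)
Lemma tr_contrast_pow_le S1 S2 b k : 0 <= nu -> 0 < b -> S1^T = S1 -> S2^T = S2 ->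
  (forall u : 'I_M -> R, 0 <= \sum_k \sum_l u k * u l * S1 k l <= b * \sum_k u k ^+ 2) ->
  (forall u : 'I_M -> R, 0 <= \sum_k \sum_l u k * u l * S2 k l <= b * \sum_k u k ^+ 2) ->
  `|\tr (mxpw (contrast *m block_mx S1 0 0 S2) k.+3)| <=
    (nu * b) ^+ k.+1 * \tr (mxpw (contrast *m block_mx S1 0 0 S2) 2).
Proof.
move=> nu0 b0 T1 T2 H1 H2; rewrite tr_contrast2 tr_contrast_pow.
have /andP[p1 q1] := tr_mxpw_geom T1 b0 H1 k.+1.
have /andP[p2 q2] := tr_mxpw_geom T2 b0 H2 k.+1.
apply: (le_trans (ler_normD _ _)).
rewrite (normrM (nu ^+ _)) (normrM ((- nu) ^+ _)) !normrX normrN (ger0_norm nu0) (ger0_norm p1) (ger0_norm p2) -mulrDr.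
have -> : (nu * b) ^+ k.+1 * (nu ^+ 2 * (\tr (mxpw S1 2) + \tr (mxpw S2 2))) =
  nu ^+ k.+3 * (b ^+ k.+1 * \tr (mxpw S1 2) + b ^+ k.+1 * \tr (mxpw S2 2)).
  by rewrite exprMn -[k.+3]/((2 + k.+1)%N) [nu ^+ (2 + _)]exprD; ring.
by rewrite ler_wpM2l ?exprn_ge0// lerD.
Qed.

Lemma quad_contrast (T : Type) (Y : 'I_(M + M) -> T -> R) S1 S2 w :
  \sum_i \sum_j contrast i j * (Y i w * Y j w) - \tr (contrast *m block_mx S1 0 0 S2) =
  nu * (\sum_k Y (lshift M k) w ^+ 2 - \sum_k Y (rshift M k) w ^+ 2 - (\tr S1 - \tr S2)).
Proof.
rewrite contrastM mxtrace_block !mxtraceZ big_split_ord/=.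
have -> : \sum_(i < M) \sum_j contrast (lshift M i) j * (Y (lshift M i) w * Y j w) =
    nu * \sum_k Y (lshift M k) w ^+ 2.
  rewrite big_distrr/=; apply: eq_bigr => i _.
  rewrite big_split_ord/= [X in _ + X]big1 ?addr0 => [|k _]; last by rewrite block_mxEur mxE mul0r.
  rewrite (bigD1 i)//= big1 => [|k ki]; last by rewrite block_mxEul mxE eq_sym (negbTE ki) mul0r.
  by rewrite addr0 block_mxEul mxE eqxx mulr1n expr2.
have -> : \sum_(i < M) \sum_j contrast (rshift M i) j * (Y (rshift M i) w * Y j w) =
    - nu * \sum_k Y (rshift M k) w ^+ 2.
  rewrite big_distrr/=; apply: eq_bigr => i _.
  rewrite big_split_ord/= [X in X + _]big1 ?add0r => [|k _]; last by rewrite block_mxEdl mxE mul0r.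
  rewrite (bigD1 i)//= big1 => [|k ki]; last by rewrite block_mxEdr mxE eq_sym (negbTE ki) mul0r.
  by rewrite addr0 block_mxEdr mxE eqxx mulr1n expr2.
ring.
Qed.

(* The [M + M] coordinates of the Gaussian vector: scale index and position. *)
Definition lev (j : nat) (i : 'I_(M + M)) : nat := if fintype.split i is inl _ then j.+1 else j.+2.
Definition pos (i : 'I_(M + M)) : int := (match fintype.split i with inl k | inr k => (k : nat).+1 end)%:Z.

Lemma split_lshiftE (i : 'I_M) : fintype.split (lshift M i) = inl i.
Proof. by rewrite -[lshift _ _]/(unsplit (inl i)) unsplitK. Qed.

Lemma split_rshiftE (i : 'I_M) : fintype.split (rshift M i) = inr i.
Proof. by rewrite -[rshift _ _]/(unsplit (inr i)) unsplitK. Qed.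

End contrast.

Section limits.
Context {R : realType}.

Lemma near_cvg (u x : nat -> R) (l : R) : (\forall j \near \oo, u j = x j) ->
  x j @[j --> \oo] --> l -> u j @[j --> \oo] --> l.
Proof.
move=> E H; apply: (cvg_trans _ H); apply: near_eq_cvg.
by apply: filterS E => j ->.
Qed.

Lemma inv_cvg0 (x : nat -> R) : x j @[j --> \oo] --> +oo -> (x j)^-1 @[j --> \oo] --> (0 : R).
Proof.
move=> xoo; apply/cvgrPdist_le => e e0; move/cvgryPge: xoo => /(_ e^-1); apply: filterS => j h.
have x0 : 0 < x j by apply: lt_le_trans h; rewrite invr_gt0.
by rewrite sub0r normrN ger0_norm ?invr_ge0 ?(ltW x0)// -[e]invrK lef_pV2 ?posrE ?invr_gt0.
Qed.

Lemma sqr_cvg0 (x : nat -> R) : (forall j, 0 <= x j) -> x j ^+ 2 @[j --> \oo] --> (0 : R) ->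
  x j @[j --> \oo] --> (0 : R).
Proof.
move=> x0 H; rewrite (_ : x = fun j => Num.sqrt (x j ^+ 2)); last first.
  by apply/funext => j; rewrite sqrtr_sqr ger0_norm.
by rewrite -[X in _ --> X](@sqrtr0 R); apply: (cvg_comp _ _ H); exact: sqrt_continuous.
Qed.

Lemma exprS_cvg0 (x : nat -> R) k : x j @[j --> \oo] --> (0 : R) ->
  x j ^+ k.+1 @[j --> \oo] --> (0 : R).
Proof.
move=> H; have C : {for (0 : R), continuous (fun y : R => y ^+ k.+1)} by exact: exprn_continuous.
by have := continuous_cvg _ C H; rewrite /= expr0n; exact.
Qed.

End limits.

(** On one period the series is a finite sum, and the closed interval differs from the half-open box
    by one point. *)
Lemma Int_periodized (R : realType) (psi : R -> R) (c A S : R) (N : nat) :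
  L1 (@lebesgue_measure R) psi -> 0 < c -> 0 < A ->
  (forall x, A < `|x| -> FT_abs2 psi x = 0) -> (forall l, FT_abs2 psi l <= S) ->
  2 * A < N.+1%:R * (c * pi) ->
  Rintegral (@lebesgue_measure R) `[- (c * pi), c * pi] (fun x => periodized psi c x ^+ 2) =
  Int (@lebesgue_measure R) (fun x => persum c (FT_abs2 psi) N.+1 x ^+ 2 * box (c * pi) x).
Proof.
move=> Lpsi c0 A0 wA wS AN; set w := FT_abs2 psi in wA wS *.
have L0 : 0 < c * pi by rewrite mulr_gt0 ?pi_gt0.
have AN' : A < (2 * N.+1%:R - 1) * (c * pi).
  have N1 : 1 <= N.+1%:R :> R by rewrite ler1n.
  have : N.+1%:R * (c * pi) <= (2 * N.+1%:R - 1) * (c * pi) by rewrite ler_pM2r//; lra.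
  lra.
have mw : measurable_fun setT w by exact: meas_FT_abs2.
have wS' l : `|w l| <= S by rewrite ger0_norm ?FT_abs2_ge0// wS.
pose g x := persum c w N.+1 x ^+ 2.
have mp : measurable_fun setT (persum c w N.+1).
  rewrite /persum; apply: measurable_sum => n.
  by apply: measurable_funD; apply: (measurableT_comp mw); mfun.
have pS x : `|persum c w N.+1 x| <= \sum_(0 <= n < N.+1) (S + S).
  by apply: (le_trans (ler_norm_sum _ _ _)); apply: ler_sum => n _;
     apply: (le_trans (ler_normD _ _)); exact: lerD.
have LI : L1 (@lebesgue_measure R) (fun x => g x * box (c * pi) x).
  apply: (@L1Mb _ _ R (@lebesgue_measure R) ((\sum_(0 <= n < N.+1) (S + S)) ^+ 2)) => [||x].
  - exact: L1_box.
  - by rewrite /g; mfun.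
  - by rewrite normrX lerXn2r ?nnegrE// (le_trans (normr_ge0 _) (pS x)).
have EI : (fun x => g x * box (c * pi) x) = g \_ `[- (c * pi), c * pi[.
  by apply/funext => x; rewrite patchE /box indicE; case: (_ \in _); rewrite ?mulr1 ?mulr0.
have -> : Rintegral (@lebesgue_measure R) `[- (c * pi), c * pi] (fun x => periodized psi c x ^+ 2) =
    Rintegral (@lebesgue_measure R) `[- (c * pi), c * pi] g.
  apply: eq_Rintegral => x; rewrite inE /= in_itv/= => xL.
  by rewrite /g (periodizedE c0 wA AN')// ler_norml.
rewrite -Rintegral_itv_bndo_bndc.
  by rewrite -/(g _) EI [LHS]Rintegral_mkcond.
apply/integrable_mkcond => //; move: LI; rewrite /L1 EI.
by congr (_.-integrable _ _); apply/funext => x; rewrite /= !patchE; case: (_ \in _).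
Qed.

Unset Implicit Arguments.

Theorem theorem3 (R : realType) (d : measure_display) (Omega : measurableType d)
  (P : probability Omega R) (X : R -> Omega -> R)
  (s0 alpha : R) (h psi : R -> R) (A : R)
  (a : nat -> R) (m : nat -> nat) (b : nat -> int -> R) (c : R) :
  (* standing setting: the process X *)
  measurable_fun setT (fun p : R * Omega => X p.1 p.2) ->
  (forall t : R, (\int[P]_w ((X s w - X t w) ^+ 2)%:E)%E @[s --> t] --> 0%E) ->
  centred_gaussian_process P X (cov_fun (spec_dens h s0 alpha)) ->
  1 < s0 -> 0 < alpha < 2^-1 ->
  (* the function h *)
  (forall l, h (- l) = h l) -> (forall l, 0 <= h l) ->
  (exists K, forall l, h l <= K) -> C4 h ->
  (forall i, (1 <= i <= 4)%N -> derive1n i h 0 = 0) -> h 0 = 1 ->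
  (exists e, 0 < e /\ forall l, (`|l - s0| < e \/ `|l + s0| < e) -> 0 < h l) ->
  (forall eps, 0 < eps ->
     (@lebesgue_measure R).-integrable setT (fun l => (h l * (1 + `|l|) `^ (- eps))%:E)) ->
  (* the function psi *)
  (@lebesgue_measure R).-integrable setT (fun t => (psi t)%:E) ->
  0 < A ->
  (forall l, A < `|l| -> FT_re psi l = 0 /\ FT_im psi l = 0) ->
  bounded_variation (- A) A (FT_re psi) -> bounded_variation (- A) A (FT_im psi) ->
  (* the sequences *)
  (forall j, 0 < a j) -> (forall j, a j < a j.+1) -> (forall K, exists j, K < a j) ->
  (forall j, (0 < m j)%N) -> (forall j, (m j <= m j.+1)%N) ->
  (forall N, exists j, (N < m j)%N) ->
  (* (i) *)
  (exists B, 0 < B < A /\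
     (forall l, `|l| < B -> FT_re psi l = 0 /\ FT_im psi l = 0) /\
     (* (ii), last part *)
     (exists j0 : nat, forall j, (j0 <= j)%N -> A / B <= a j.+1 / a j)) ->
  (* (ii) *)
  0 < c ->
  (exists gamma : nat -> R,
     (forall j, 0 < gamma j) /\
     (forall j (k l : int), b j k - b j l = gamma j * (k - l)%:~R) /\
     (a j / gamma j) @[j --> \oo] --> c /\
     ((m j)%:R ^+ 2 * a j ^+ 8 * (gamma j / a j - c^-1)) @[j --> \oo] --> 0) ->
  (* (iii) *)
  ((m j)%:R / a j ^+ 4) @[j --> \oo] --> (0 : R) ->
  cvg_in_law P
    (fun j w => Num.sqrt (m j)%:R *
       (Delta_delta_bar X psi a b m j w
        - 2 * alpha * s0 `^ (- 4 * alpha - 2) *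
          Rintegral (@lebesgue_measure R) setT (fun eta => eta ^+ 2 * FT_abs2 psi eta)))
    (centred_gauss_law
       (2 * (4 * c * pi * s0 `^ (- 8 * alpha) *
          Rintegral (@lebesgue_measure R) `[- (c * pi), c * pi]
            (fun eta => (periodized psi c eta) ^+ 2)))).

Proof.
move=> mX msc GX s1 al he h0 hK hC4 hd h1 _ hint Lpsi A0 sA _ _ a0 ai aunb m0 _ _.
move=> [B [/andP[B0 BA] [sB [j0 ar]]]] c0 [gamma [g0 [bg [ag _]]]] ma.
set leb := @lebesgue_measure R in hint Lpsi *.
pose f := spec_dens h s0 alpha.
pose p := s0 `^ (- 4 * alpha).
pose q := 2 * alpha * s0 `^ (- 4 * alpha - 2).
pose w := FT_abs2 psi.
pose L := c * pi.
have f0 : forall l, 0 <= f l := spec_dens_ge0 s0 alpha h0.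
have Lf : L1 leb f := spec_dens_L1 s1 al h0 hK hC4 hint.
have [K [r [K0 r0 fT]]] := spec_taylor s1 al hC4 hd h1.
have fe l : f (- l) = f l by rewrite /f /spec_dens he sqrrN.
have p0 : 0 <= p by exact: powR_ge0.
have wA x : A < `|x| -> FT_abs2 psi x = 0.
  by move=> /sA[h1' h2']; rewrite /FT_abs2 h1' h2' expr0n addr0.
have [S S0 wS] := FT_abs2_bounded Lpsi.
have L0 : 0 < L by rewrite mulr_gt0 ?pi_gt0.
(* Enough periods to contain the doubled support, as [symbol_close] requires. *)
pose N := (Num.truncn (2 * A / L)).+1.
have N0 : (0 < N)%N by [].
have AN : 2 * A < N%:R * L by rewrite -ltr_pdivrMr// truncnS_gt.
have aoo : a j @[j --> \oo] --> +oo.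
  apply/cvgryPge => D; have [i Di] := aunb D; exists i => // j /= ij.
  have anon : {homo a : x y / (x <= y)%N >-> x <= y} by apply: (homo_leq _ le_trans) => // x; exact: ltW.
  by apply: (le_trans (ltW Di)); exact: anon.
have shift1 (u : nat -> R) (F : set_system R) : u j @[j --> \oo] --> F -> u j.+1 @[j --> \oo] --> F.
  by move=> H; have := cvg_shiftS u F => ->.
have aoo1 := shift1 _ _ aoo; have aoo2 := shift1 _ _ aoo1.
have ag1 := shift1 _ _ ag; have ag2 := shift1 _ _ ag1.
have AB1 : 1 < A / B by rewrite ltr_pdivlMr// mul1r.
have ar' : \forall j \near \oo, A / B <= a j.+1 / a j by exists j0.
have woo := window_cvgy a0 aoo ai m0.
have Moo : ((Mj a m j)%:R : R) @[j --> \oo] --> +oo by exact: truncn_cvgy woo.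
have ratio : (m j)%:R / gap a j ^+ 2 / (Mj a m j)%:R @[j --> \oo] --> (1 : R) by exact: truncn_ratio woo.
have [M ME] : exists M, M = Mj a m by exists (Mj a m).
rewrite -ME in Moo ratio.
have [sym symE] : exists sym, sym = (fun j => symbol psi f c (a j) (gamma j)) by eexists.
(* With this factor the form of the contrast matrix is [Z_j] minus its mean, and the choice of [M_j]
   gives [nu j ^+ 2 * M j --> 1]. *)
pose nu j := Num.sqrt (m j)%:R / ((M j)%:R * gap a j).
pose V j := coef c true 0 (sym j).
pose I2 := Int leb (fun x => x ^+ 2 * w x).
(* The mean of [Z_j], as [V n] is the variance of a coefficient of scale [n]. *)
pose e j := Num.sqrt (m j)%:R * ((V j.+1 - V j.+2) / gap a j - q * I2).
pose phi j (i : 'I_(M j + M j)) (t : R) := psi ((t - b (lev j i) (pos i)) / a (lev j i)).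
pose s j (i : 'I_(M j + M j)) : R := (Num.sqrt (a (lev j i)))^-1.
pose Y j (i : 'I_(M j + M j)) (om : Omega) : R := s j i * Yf X (@phi j i) om.
pose Sg j : 'M[R]_(M j + M j) := \matrix_(i, k) (s j i * s j k * Int leb (fun l =>
  (FT_re (@phi j i) l * FT_re (@phi j k) l + FT_im (@phi j i) l * FT_im (@phi j k) l) * f l)).
have GV j : gauss_vec P (@Y j) (Sg j).
  by apply: (gauss_vec_Yf Lf f0 GX mX msc) => i; exact: L1_wavelet.
have block : \forall j \near \oo, Sg j = block_mx (tmx c (M j) (sym j.+1)) 0 0 (tmx c (M j) (sym j.+2)).
  exists j0 => // j /= jj.
  have far := cov_distinct_scales f Lpsi B0 BA sA sB _ _ (a0 j.+1) (a0 j.+2) (ar j.+1 (leqW jj)).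
  (* Positions count from 1 in the averages and from 0 in the matrices; only differences matter. *)
  have bz n k l : b n (Posz k.+1) - b n (Posz l.+1) = gamma n * (k%:Z - l%:Z)%:~R.
    by rewrite bg; congr (_ * _%:~R); rewrite -addn1 -[in X in _ - X]addn1 !PoszD; ring.
  apply/matrixP => i k; rewrite [LHS]mxE /s /phi /lev /pos.
  case: (split_ordP i) => i' ->; case: (split_ordP k) => k' ->; rewrite ?split_lshiftE ?split_rshiftE.
  - rewrite block_mxEul mxE symE; exact: (cov_same_scale Lpsi Lf c0 (a0 _) (g0 _) (bz _ _ _)).
  - rewrite block_mxEur mxE; exact: (far _ _).1.
  - rewrite block_mxEdl mxE; exact: (far _ _).2.
  - rewrite block_mxEdr mxE symE; exact: (cov_same_scale Lpsi Lf c0 (a0 _) (g0 _) (bz _ _ _)).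
pose I := Int leb (fun x => persum c w N x ^+ 2 * box L x).
have t1 : toep c (M j) (sym j.+1) (sym j.+1) @[j --> \oo] --> 2 * L * (p ^+ 2 * I).
  rewrite symE; exact: (toep_symbol_cvg Lpsi Lf c0 A0 p0 K0 r0 wA fT S0 wS N0 AN (fun j => a0 j.+1) (fun j => g0 j.+1) aoo1 ag1 Moo).
have t2 : toep c (M j) (sym j.+2) (sym j.+2) @[j --> \oo] --> 2 * L * (p ^+ 2 * I).
  rewrite symE; exact: (toep_symbol_cvg Lpsi Lf c0 A0 p0 K0 r0 wA fT S0 wS N0 AN (fun j => a0 j.+2) (fun j => g0 j.+2) aoo2 ag2 Moo).
pose bb := (1 + p * S) * (2 * (N%:R * (c * pi))).
pose opb (g : R -> R) := forall n (u : 'I_n -> R), 0 <= \sum_k \sum_l u k * u l *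
  coef c true ((k : nat)%:Z - (l : nat)%:Z) g <= bb * \sum_k u k ^+ 2.
have o1 : \forall j \near \oo, opb (sym j.+1).
  rewrite symE; exact: (symbol_opbound Lpsi Lf f0 c0 A0 p0 K0 r0 wA fT S0 wS N0 AN (fun j => a0 j.+1) (fun j => g0 j.+1) aoo1 ag1).
have o2 : \forall j \near \oo, opb (sym j.+2).
  rewrite symE; exact: (symbol_opbound Lpsi Lf f0 c0 A0 p0 K0 r0 wA fT S0 wS N0 AN (fun j => a0 j.+2) (fun j => g0 j.+2) aoo2 ag2).
have Mpos : \forall j \near \oo, (0 < M j)%N.
  move/cvgryPge: Moo => /(_ 1); apply: filterS => j M1.
  by rewrite -(ltr0n R); exact: lt_le_trans M1.
have gp j : 0 < gap a j := gap_gt0 a0 ai j.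
have nu0 j : 0 <= nu j by rewrite divr_ge0 ?sqrtr_ge0// mulr_ge0// ltW.
have nuM : \forall j \near \oo, nu j ^+ 2 * (M j)%:R = (m j)%:R / gap a j ^+ 2 / (M j)%:R.
  apply: filterS Mpos => j Mj0; rewrite /nu expr_div_n sqr_sqrtr//.
  by field; rewrite !gt_eqF// ltr0n.
have tr2E : \forall j \near \oo, \tr (mxpw (contrast (M j) (nu j) *m Sg j) 2) =
    (m j)%:R / gap a j ^+ 2 / (M j)%:R * (toep c (M j) (sym j.+1) (sym j.+1) + toep c (M j) (sym j.+2) (sym j.+2)).
  near=> j.
  have -> : Sg j = block_mx (tmx c (M j) (sym j.+1)) 0 0 (tmx c (M j) (sym j.+2)) by near: j.
  have Mj0 : (0 < M j)%N by near: j.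
  have z1 z : coef c false z (sym j.+1) = 0 by rewrite symE; exact: coef_symbol_sin.
  have z2 z : coef c false z (sym j.+2) = 0 by rewrite symE; exact: coef_symbol_sin.
  rewrite tr_contrast2 (tr_tmx2 Mj0 z1) (tr_tmx2 Mj0 z2).
  by rewrite -mulrDr mulrA; congr (_ * _); near: j.
pose v := 2 * (4 * c * pi * s0 `^ (- 8 * alpha) *
          Rintegral leb `[- (c * pi), c * pi] (fun eta => (periodized psi c eta) ^+ 2)).
have p2 : s0 `^ (- 8 * alpha) = p ^+ 2.
  by rewrite -powR_mulrn ?powR_ge0// -powRrM; congr (_ `^ _); ring.
(* Each of the two scales contributes [2 * L * (p ^+ 2 * I)] to the trace, whence the factor 4. *)
have vE : v = 2 * (2 * L * (p ^+ 2 * I) + 2 * L * (p ^+ 2 * I)).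
  rewrite /v p2; suff -> : Rintegral leb `[- (c * pi), c * pi] (fun eta => periodized psi c eta ^+ 2) = I.
    by rewrite /L; ring.
  exact: (Int_periodized Lpsi c0 A0 wA wS AN).
have trc : \tr (mxpw (contrast (M j) (nu j) *m Sg j) 2) @[j --> \oo] -->
    2 * L * (p ^+ 2 * I) + 2 * L * (p ^+ 2 * I).
  apply: (near_cvg tr2E); rewrite -[X in _ --> X]mul1r; apply: cvgM; first exact: ratio.
  by apply: cvgD; [exact: t1|exact: t2].
apply: (@quad_cvg_in_law _ _ _ P (fun j => (M j + M j)%N) Y Sg (fun j => contrast (M j) (nu j)) _ e).
- rewrite -/v vE; have I0 : 0 <= I by apply: Int_ge0 => x; rewrite mulr_ge0 ?sqr_ge0 ?box_ge0.
  have LI0 : 0 <= 2 * L * (p ^+ 2 * I).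
    apply: mulr_ge0; first by apply: mulr_ge0 => //; exact: ltW.
    by apply: mulr_ge0 => //; exact: sqr_ge0.
  by apply: mulr_ge0 => //; exact: addr_ge0.
- exact: GV.
- by move=> j i k; exact: contrast_sym.
- by rewrite -/v vE; apply: cvgM => //; exact: cvg_cst.
- move=> k.
  have bb0 : 0 < bb.
    by rewrite mulr_gt0 ?mulr_gt0 ?ltr0n ?pi_gt0// ltr_wpDr// mulr_ge0// ltW.
  (* [nu j ^+ 2] is a quantity tending to 1 divided by [M j]. *)
  have nuc : nu j @[j --> \oo] --> (0 : R).
    apply: sqr_cvg0 => //.
    have E : \forall j \near \oo, nu j ^+ 2 = (m j)%:R / gap a j ^+ 2 / (M j)%:R * (M j)%:R^-1.
      near=> j; have Mj0 : (M j)%:R != 0 :> R by rewrite pnatr_eq0 -lt0n; near: j.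
      have <- : nu j ^+ 2 * (M j)%:R = (m j)%:R / gap a j ^+ 2 / (M j)%:R by near: j.
      by rewrite mulfK.
    apply: (near_cvg E); rewrite -(mulr0 1); apply: cvgM; [exact: ratio|exact: inv_cvg0].
  have nub : (nu j * bb) ^+ k.+1 @[j --> \oo] --> (0 : R).
    apply: exprS_cvg0; rewrite -(mul0r bb); apply: cvgM => //; exact: cvg_cst.
  have up : (nu j * bb) ^+ k.+1 * \tr (mxpw (contrast (M j) (nu j) *m Sg j) 2) @[j --> \oo] --> (0 : R).
    by rewrite -(mul0r (2 * L * (p ^+ 2 * I) + 2 * L * (p ^+ 2 * I))); apply: cvgM; [exact: nub|exact: trc].
  apply/norm_cvg0P; apply: (squeeze_cvgr _ (@cvg_cst _ _ _ _ _) up).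
  near=> j; rewrite normr_ge0/=.
  have -> : Sg j = block_mx (tmx c (M j) (sym j.+1)) 0 0 (tmx c (M j) (sym j.+2)) by near: j.
  have ob1 : opb (sym j.+1) by near: j.
  have ob2 : opb (sym j.+2) by near: j.
  have bnd g : opb g -> forall u : 'I_(M j) -> R,
      0 <= \sum_k \sum_l u k * u l * tmx c (M j) g k l <= bb * \sum_k u k ^+ 2.
    by move=> og u; under eq_bigr do under eq_bigr do rewrite mxE; exact: og.
  exact: (tr_contrast_pow_le k (nu0 j) bb0 (tmx_tr _ _ _) (tmx_tr _ _ _) (bnd _ ob1) (bnd _ ob2)).
- have [C [aa [C0 aa0 HC]]] := mean_expand Lpsi Lf A0 K0 r0 wA fT.
  have VE n : V n = Int leb (fun x => w x * f (x / a n)) by rewrite /V symE; exact: coef_symbol0.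
  have HV n : aa <= a n -> `|V n - (p * Int leb w + q * I2 * a n ^- 2)| <= C * a n ^- 4.
    by move=> /HC; rewrite VE; congr (`|_ - (_ + _)| <= _); rewrite mulrAC.
  apply: (bias_cvg0 a0 ai AB1 ar' ma C0 (p := p * Int leb w)).
    by move/cvgryPge: aoo1 => /(_ aa); apply: filterS => j; exact: HV.
  by move/cvgryPge: aoo2 => /(_ aa); apply: filterS => j; exact: HV.
- near=> j => om.
  have Sj : Sg j = block_mx (tmx c (M j) (sym j.+1)) 0 0 (tmx c (M j) (sym j.+2)) by near: j.
  have Mj0 : (M j)%:R != 0 :> R by rewrite pnatr_eq0 -lt0n; near: j.
  rewrite /quad Sj quad_contrast !tr_tmx.
  have YE1 (k : 'I_(M j)) : Y j (lshift (M j) k) om = delta X psi a b j.+1 (k.+1)%:Z om.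
    by rewrite /Y /s /phi /lev /pos split_lshiftE.
  have YE2 (k : 'I_(M j)) : Y j (rshift (M j) k) om = delta X psi a b j.+2 (k.+1)%:Z om.
    by rewrite /Y /s /phi /lev /pos split_rshiftE.
  rewrite (eq_bigr _ (fun k _ => congr1 (fun y => y ^+ 2) (YE1 k))).
  rewrite [in X in _ - X - _](eq_bigr _ (fun k _ => congr1 (fun y => y ^+ 2) (YE2 k))).
  (* The sums over [1 <= k < M + 1] are reindexed from 0; the subtracted traces and the bias [e j]
     recombine into the centring constant. *)
  rewrite /Delta_delta_bar /delta_bar2 -ME -/(gap a j) !big_add1 /= !big_mkord /e /nu -/(V j.+1) -/(V j.+2).
  rewrite -/q -/w -/I2.
  have gj := gp j.
  by field; rewrite Mj0 gt_eqF.
Unshelve. all: by end_near. Qed.
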